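(* Let $\mathcal{G}(m,\Delta)$ be the class of uniform hypergraphs with minimum edge size $m\geq 3$ and maximum degree $\Delta$. Computing the number of (proper) $q$-colourings of hypergraphs in $\mathcal{G}(m,\Delta)$ is #P-complete if $\Delta,q>1$. If $\Delta\leq 1$ or $q\leq 1$, it is in P (that is, computable in polynomial time).
   Context: A hypergraph $\mathcal{H}=(\mathcal{V},\mathcal{E})$ has a finite vertex set $\mathcal{V}$ and edges that are subsets of $\mathcal{V}$; it is uniform if all its edges have the same size. The degree of a vertex is the number of edges containing it. A $q$-colouring is a map $\mathcal{V}\to\{1,\dots,q\}$ in which no edge is monochromatic. Here $m$, $\Delta$ and $q$ are fixed and the input is a hypergraph in $\mathcal{G}(m,\Delta)$. #P-completeness is with respect to polynomial-time Turing reductions. *)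

(* Defs.v *)
From HB Require Import structures.
From mathcomp Require Import all_boot all_algebra.

Set Implicit Arguments.
Unset Strict Implicit.
Unset Printing Implicit Defensive.

(** * Hypergraphs and their colourings *)

Section Hypergraph.

Variables (V : finType) (E : {set {set V}}).

Definition uniform : bool :=
  [forall e in E, forall f in E, #|e| == #|f|].

(* An edgeless hypergraph has every minimum edge size, so that the hypergraphs
   of maximum degree 0 are instances. *)
Definition min_edge_size (m : nat) : bool :=
  [forall e in E, m <= #|e|] && ((E != set0) ==> [exists e in E, #|e| == m]).

Definition degree (v : V) : nat := #|[set e in E | v \in e]|.

Definition max_degree : nat := \max_(v : V) degree v.

Definition hclass (m Delta : nat) : bool :=
  [&& uniform, min_edge_size m & max_degree == Delta].

Definition monochromatic (q : nat) (c : {ffun V -> 'I_q}) (e : {set V}) : bool :=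
  [forall u in e, forall v in e, c u == c v].

Definition colouring (q : nat) (c : {ffun V -> 'I_q}) : bool :=
  [forall e in E, ~~ monochromatic c e].

Definition num_colourings (q : nat) : nat :=
  #|[set c : {ffun V -> 'I_q} | colouring c]|.

End Hypergraph.

(** * Hypergraphs as bit strings *)

(* The incidence matrix preceded by its dimensions in unary: 1^n 0 1^k 0
   followed by the k characteristic vectors, of length n, of the edges. *)
Definition encode (n : nat) (s : seq {set 'I_n}) : seq bool :=
  nseq n true ++ false :: nseq (size s) true ++ false ::
  flatten [seq [seq i \in e | i <- enum 'I_n] | e : {set 'I_n} <- s].

(* The edges may be listed in any order, without repetition. *)
Definition encodes (x : seq bool) (n : nat) (E : {set {set 'I_n}}) : bool :=
  [exists s : #|E|.-tuple {set 'I_n}, ([set:: s] == E) && (encode s == x)].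

Definition count_colourings_on (m Delta q n : nat) (x : seq bool) : nat :=
  if [pick E : {set {set 'I_n}} | hclass E m Delta && encodes x E] is Some E
  then num_colourings E q else 0.

(* Strings that do not encode a hypergraph of the class are sent to 0. In an
   encoding the number of vertices is the index of the first 0. *)
Definition count_colourings (m Delta q : nat) (x : seq bool) : nat :=
  count_colourings_on m Delta q (index false x) x.

Lemma encode_inj (n : nat) : injective (@encode n).
Proof.
move=> s t; rewrite /encode => /eqP.
rewrite eqseq_cat // eqxx /= eqseq_cons eqxx /= => /eqP st.
have szE (u : seq {set 'I_n}) r : index false (nseq (size u) true ++ false :: r) = size u.
  by rewrite index_cat mem_nseq andbF size_nseq /= addn0.
have sz : size s = size t.
  by have := congr1 (index false) st; rewrite !szE.
move/eqP: st; rewrite sz eqseq_cat // eqxx /= eqseq_cons eqxx /= => /eqP.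
elim: s t sz => [|e s IH] [|f t] //= [sz] /eqP.
rewrite eqseq_cat ?size_map // => /andP[/eqP/eq_in_map ef /eqP st].
rewrite (IH t sz st); congr (_ :: _); apply/setP => i.
by apply: ef; rewrite mem_enum.
Qed.

Lemma count_colourings_encode (m Delta q n : nat) (s : seq {set 'I_n}) :
  uniq s -> hclass [set:: s] m Delta ->
  count_colourings m Delta q (encode s) = num_colourings [set:: s] q.
Proof.
move=> us hs.
have nE : index false (encode s) = n.
  by rewrite index_cat mem_nseq andbF size_nseq /= addn0.
rewrite /count_colourings nE /count_colourings_on.
case: pickP => [E /andP[_ /existsP[t /andP[/eqP tE /eqP/encode_inj ts]]]|].
  by rewrite -ts tE.
move=> /(_ [set:: s]); rewrite hs /= => /existsP[].
have sz : size s == #|[set:: s]| by rewrite cardsE (card_uniqP us).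
by exists (Tuple sz); rewrite /= !eqxx.
Qed.

(** * Deterministic multitape Turing machines with an oracle *)

(* Least significant bit first, without leading zeros; 0 is the empty string. *)
Definition binary (n : nat) : seq bool :=
  [seq odd (n %/ 2 ^ i) | i <- iota 0 (up_log 2 n.+1)].

(* [None] is the blank; [G] provides auxiliary symbols. *)
Definition symbol (G : finType) : finType := option (bool + G).

Definition bit {G : finType} (b : bool) : symbol G := Some (inl b).

(* A two-way infinite tape: the cells to the left of the head, nearest first,
   and the cells from the head rightwards; all the other cells are blank. *)
Definition tape (G : finType) : Type := (seq (symbol G) * seq (symbol G))%type.

Definition tape_of {G : finType} (x : seq bool) : tape G :=
  ([::], [seq bit b | b <- x]).

Definition read {G : finType} (t : tape G) : symbol G := head None t.2.

Definition write {G : finType} (a : symbol G) (t : tape G) : tape G :=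
  (t.1, a :: behead t.2).

(* [Some false]: left; [Some true]: right; [None]: stay. *)
Definition move_head {G : finType} (d : option bool) (t : tape G) : tape G :=
  match d with
  | Some false => (behead t.1, head None t.1 :: t.2)
  | Some true => (head None t.2 :: t.1, behead t.2)
  | None => t
  end.

Fixpoint leading_bits {G : finType} (r : seq (symbol G)) : seq bool :=
  if r is Some (inl b) :: r' then b :: leading_bits r' else [::].

(* The string written on a tape: from the head to the first non-bit. *)
Definition contents {G : finType} (t : tape G) : seq bool := leading_bits t.2.

Record machine := Machine {
  states : finType;
  aux : finType;
  ntapes : nat; (* the tapes are indexed by 'I_ntapes.+1 *)
  start : states;
  halting : pred states;
  querying : pred states;
  trans : states -> {ffun 'I_ntapes.+1 -> symbol aux} ->
    states * {ffun 'I_ntapes.+1 -> symbol aux * option bool}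
}.

Definition config (M : machine) : Type :=
  (states M * ('I_(ntapes M).+1 -> tape (aux M)))%type.

(* The input, and the output on halting, are on tape [ord0]. *)
Definition init (M : machine) (x : seq bool) : config M :=
  (start M, fun i => tape_of (if i == ord0 then x else [::])).

Definition query (M : machine) (O : seq bool -> seq bool)
    (ts : 'I_(ntapes M).+1 -> tape (aux M)) : 'I_(ntapes M).+1 -> tape (aux M) :=
  fun i => if i == ord_max then tape_of (O (contents (ts i))) else ts i.

(* In a querying state the string on tape [ord_max] is first replaced by the
   answer of the oracle, with the head on its first symbol, and then an ordinary
   transition is made, all in a single step. Halting configurations are fixed. *)
Definition step (M : machine) (O : seq bool -> seq bool) (c : config M) : config M :=
  if halting c.1 then c else
  let ts := if querying c.1 then query O c.2 else c.2 in
  let: (s, w) := trans c.1 [ffun i => read (ts i)] in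
  (s, fun i => move_head (w i).2 (write (w i).1 (ts i))).

Definition runs_in (M : machine) (O : seq bool -> seq bool) (x : seq bool) (t : nat)
    (y : seq bool) : Prop :=
  let c := iter t (step O) (init M x) in halting c.1 /\ contents (c.2 ord0) = y.

(** * Complexity classes *)

Definition polytime_oracle (O f : seq bool -> seq bool) : Prop :=
  exists (M : machine) (p : {poly nat}),
    forall x, runs_in M O x (p.[size x])%R (f x).

(* No state queries, so the oracle passed to [runs_in] is irrelevant. *)
Definition polytime (f : seq bool -> seq bool) : Prop :=
  exists (M : machine) (p : {poly nat}),
    (forall s : states M, ~~ querying s) /\
    forall x, runs_in M (fun=> [::]) x (p.[size x])%R (f x).

(* The bits of [x] are doubled and [01] marks the end of [x]. *)
Definition pair_code (x y : seq bool) : seq bool :=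
  flatten [seq [:: b; b] | b <- x] ++ [:: false; true] ++ y.

Definition polytime_counting (f : seq bool -> nat) : Prop :=
  polytime (fun x => binary (f x)).

Definition sharpP (f : seq bool -> nat) : Prop :=
  exists (p : {poly nat}) (R : pred (seq bool)),
    polytime (fun z => [:: R z]) /\
    forall x, f x = #|[set w : (p.[size x])%R.-tuple bool | R (pair_code x w)]|.

Definition turing_reducible (f g : seq bool -> nat) : Prop :=
  polytime_oracle (fun x => binary (g x)) (fun x => binary (f x)).

Definition sharpP_complete (f : seq bool -> nat) : Prop :=
  sharpP f /\ forall g, sharpP g -> turing_reducible g f.

(* Main.v *)
(* The interesting case is hardness. By the Cook-Levin construction a function
   of #P counts the inputs accepted by a polynomial-size NAND circuit, and the
   circuit is turned into a graph whose q-spin configurations with the least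
   number t of monochromatic edges number q! times the accepted inputs.
   In a hypergraph of degree 2, an edge made of one open vertex and of m - 1 new
   ones, one of which becomes open, acts on the colour of the open vertex by the
   matrix q^(m-2) J - I, whose eigenvalues are L = q^(m-1) - 1 on constants and
   -1 elsewhere; an edge with three open vertices is q^(m-3) minus the equality.
   Two such edges joined by long paths couple two open vertices by a weight that
   depends only on whether their colours agree, exactly modulo a suitable number:
   modulo a power of a power B of q - 1 if q > 2, and modulo (L^(2h+1) + 1) / 4
   if q = 2. The number of colourings then determines the sum of B^mono over the
   configurations modulo B^(t+1) (of B^mono (B+1)^(ne - mono) if q = 2), and its
   digit of rank t in base B counts the minimal configurations.
   The maximum degree Delta is attained at an extra vertex, the centre of Delta
   edges that share nothing else.
   Machines are reached through programs on stacks, functions on binary trees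
   and, finally, functions on coded data, for which closure properties give
   polynomial running times. If Delta <= 1 the edges are disjoint. *)

Require Import Defs.
From HB Require Import structures.
From mathcomp Require Import all_boot all_algebra all_fingroup zify ring.
From Stdlib Require Import FunctionalExtensionality.

Set Implicit Arguments.
Unset Strict Implicit.
Unset Printing Implicit Defensive.

(** * Stack programs *)

(** As [Delta] may be 2, a spin cannot be a single vertex that meets all its neighbours. Its colour
    is handed on from gadget to gadget by fresh open vertices, so a gadget must act as the identity
    on two colours besides coupling them. Not-all-equal edges give equality only up to sign and an
    additive constant, and over the integers the constant part (L^r - (-1)^r)/q of a path only grows
    with its length. Modulo a power of q - 1, which divides L, the term L^r dies and a long even
    path becomes I - J/q, the projection that kills the constant. For q = 2 that modulus is 1;
    instead the three legs of an edge get a common length h, and the modulus is the number whose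
    vanishing makes all unequal triples of leg colours weigh 0. For q > 2 a spin edge weighs (q -
    1)/q or -1/q; repeating it an even number of times yields B or 1 after clearing denominators.
    For q = 2 the weights are B and B + 1, and B + 1 is 1 modulo B. Agreement carries the factor B,
    so the lowest nonzero digit sees the configurations with the fewest monochromatic edges. *)

Inductive cmd : Type :=
| Skip
| Push of nat & bool
| Pop of nat & cmd & cmd & cmd
| Loop of nat & cmd & cmd
| Seq of cmd & cmd
| Query of nat.

Definition store := nat -> seq bool.

Definition upd (st : store) (r : nat) (s : seq bool) : store :=
  fun i => if i == r then s else st i.

(* The cost is the exact number of steps of the compiled machine. *)
Inductive exec (O : seq bool -> seq bool) : cmd -> store -> nat -> store -> Prop :=
| ESkip st : exec O Skip st 1 st
| EPush r b st : exec O (Push r b) st 2 (upd st r (b :: st r))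
| EPop_nil r ce c0 c1 st t st' :
    st r = [::] -> exec O ce st t st' -> exec O (Pop r ce c0 c1) st t.+1 st'
| EPop_cons r ce c0 c1 st b s t st' :
    st r = b :: s -> exec O (if b then c1 else c0) (upd st r s) t st' ->
    exec O (Pop r ce c0 c1) st t.+1 st'
| ELoop_nil r c0 c1 st : st r = [::] -> exec O (Loop r c0 c1) st 1 st
| ELoop_cons r c0 c1 st b s t1 st1 t2 st2 :
    st r = b :: s -> exec O (if b then c1 else c0) (upd st r s) t1 st1 ->
    exec O (Loop r c0 c1) st1 t2 st2 ->
    exec O (Loop r c0 c1) st (t1 + t2).+1 st2
| ESeq c1 c2 st t1 st1 t2 st2 :
    exec O c1 st t1 st1 -> exec O c2 st1 t2 st2 ->
    exec O (Seq c1 c2) st (t1 + t2) st2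
| EQuery r st : exec O (Query r) st 1 (upd st r (O (st r))).

Inductive instr : Type :=
| IJump of nat
| ILeft of nat & nat
| IWrite of nat & bool & nat
| IPop of nat & nat & nat & nat
| IQuery of nat & nat.

Fixpoint len (c : cmd) : nat :=
  match c with
  | Skip => 1
  | Push _ _ => 2
  | Pop _ ce c0 c1 => (len ce + len c0 + len c1).+1
  | Loop _ c0 c1 => (len c0 + len c1).+1
  | Seq c1 c2 => len c1 + len c2
  | Query _ => 1
  end.

(* [comp c a k]: the code of [c] placed at address [a] and continuing at [k]. *)
Fixpoint comp (c : cmd) (a k : nat) : seq instr :=
  match c with
  | Skip => [:: IJump k]
  | Push r b => [:: ILeft r a.+1; IWrite r b k]
  | Pop r ce c0 c1 =>
      let a0 := a.+1 + len ce in let a1 := a0 + len c0 in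
      IPop r a.+1 a0 a1 :: comp ce a.+1 k ++ comp c0 a0 k ++ comp c1 a1 k
  | Loop r c0 c1 =>
      let a1 := a.+1 + len c0 in
      IPop r k a.+1 a1 :: comp c0 a.+1 a ++ comp c1 a1 a
  | Seq c1 c2 => comp c1 a (a + len c1) ++ comp c2 (a + len c1) k
  | Query r => [:: IQuery r k]
  end.

Lemma size_comp c a k : size (comp c a k) = len c.
Proof.
elim: c a k => //= [r ce IHe c0 IH0 c1 IH1|r c0 IH0 c1 IH1|c1 IH1 c2 IH2] a k;
  by rewrite !size_cat ?IHe ?IH0 ?IH1 ?IH2 ?addnA.
Qed.

(** A branch of positive length keeps its entry address within the code, so that [inord] represents
    it faithfully as a state. *)
Lemma len_gt0 c : 0 < len c.
Proof. by elim: c => //= c1 h1 c2 h2; rewrite addn_gt0 h1. Qed.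

(** A machine queries its oracle on the last tape only, hence the equality for [Query]. *)
Fixpoint regs_le (K : nat) (c : cmd) : bool :=
  match c with
  | Skip => true
  | Push r _ => r <= K
  | Pop r ce c0 c1 => [&& r <= K, regs_le K ce, regs_le K c0 & regs_le K c1]
  | Loop r c0 c1 => [&& r <= K, regs_le K c0 & regs_le K c1]
  | Seq c1 c2 => regs_le K c1 && regs_le K c2
  | Query r => r == K
  end.

Fixpoint qfree (c : cmd) : bool :=
  match c with
  | Pop r ce c0 c1 => [&& qfree ce, qfree c0 & qfree c1]
  | Loop r c0 c1 => qfree c0 && qfree c1
  | Seq c1 c2 => qfree c1 && qfree c2
  | Query _ => false
  | _ => true
  end.

Fixpoint maxreg (c : cmd) : nat :=
  match c with
  | Skip => 0
  | Push r _ => r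
  | Pop r ce c0 c1 => maxn r (maxn (maxreg ce) (maxn (maxreg c0) (maxreg c1)))
  | Loop r c0 c1 => maxn r (maxn (maxreg c0) (maxreg c1))
  | Seq c1 c2 => maxn (maxreg c1) (maxreg c2)
  | Query r => r
  end.

Lemma regs_le_maxreg c K : qfree c -> maxreg c <= K -> regs_le K c.
Proof.
elim: c => //= [r ce IHe c0 IH0 c1 IH1|r c0 IH0 c1 IH1|c1 IH1 c2 IH2].
- by case/and3P=> *; rewrite IHe ?IH0 ?IH1 //; lia.
- by case/andP=> *; rewrite ?IH0 ?IH1 //; lia.
- by case/andP=> *; rewrite ?IH2 ?IH1 //; lia.
Qed.

(** * The machine that executes a list of instructions *)

Section Machine.

Variables (code : seq instr) (K : nat).

Notation N := (size code).

(** The top of a stack is under the head. A push takes two steps, left and then write; a pop blanks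
    the cell before moving right, so that everything to the left of the head stays blank. *)
Definition action (G : finType) (i : instr) (rd : {ffun 'I_K.+1 -> symbol G}) :
    nat * (nat -> symbol G -> symbol G * option bool) :=
  match i with
  | IJump k => (k, fun _ a => (a, None))
  | ILeft r k => (k, fun j a => (a, if j == r then Some false else None))
  | IWrite r b k => (k, fun j a => (if j == r then bit b else a, None))
  | IPop r ke k0 k1 =>
      (match rd (inord r) with
       | Some (inl true) => k1
       | Some (inl false) => k0
       | _ => ke
       end,
       fun j a => if (j == r) && isSome a then (None, Some true) else (a, None))
  | IQuery r k => (k, fun _ a => (a, None))
  end.

Definition is_query (i : instr) : bool := if i is IQuery _ _ then true else false.

Definition fetch (s : nat) : instr := nth (IJump N) code s.

(** The state past the last instruction is the halting one, so falling off the code means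
    stopping. *)
Definition stack_machine : machine :=
  @Machine 'I_N.+1 void K ord0 (fun s => N <= s)
    (fun s => is_query (fetch s))
    (fun s rd =>
       let act := action (fetch s) rd in
       (inord act.1, [ffun j : 'I_K.+1 => act.2 j (rd j)])).

(** Blanks visited by the head are stored explicitly in the two lists, so one stack corresponds to
    many tapes; [a] and [b] count these blanks. *)
Definition represents (s : seq bool) (t : tape void) : Prop :=
  exists a b, t = (nseq a None, [seq bit x | x <- s] ++ nseq b None).

Definition matches (pc : nat) (st : store) (c : config stack_machine) : Prop :=
  c.1 = pc :> nat /\ forall j : 'I_K.+1, represents (st j) (c.2 j).

Lemma leading_bits_represents s t : represents s t -> contents t = s.
Proof.
move=> [a [b ->]]; rewrite /contents /=.
by elim: s => [|x s IH] /=; [case: b | rewrite IH].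
Qed.

Lemma read_represents s t : represents s t -> read t = omap (@inl bool void) (ohead s).
Proof. by move=> [a [b ->]]; rewrite /read; case: s => //; case: b. Qed.

Lemma write_read_represents s t : represents s t -> represents s (write (read t) t).
Proof.
move=> [a [b ->]]; rewrite /write /read.
case: s => [|x s] /=; last by exists a, b.
case: b => [|b] /=; first by exists a, 1.
by exists a, b.+1.
Qed.

Lemma represents_tape_of s : represents s (tape_of s).
Proof. by exists 0, 0; rewrite cats0. Qed.

Lemma represents_pop x s t :
  represents (x :: s) t -> represents s (move_head (Some true) (write None t)).
Proof. by move=> [a [b ->]]; exists a.+1, b. Qed.

(** The tape between the two steps of a push. *)
Definition shifted (s : seq bool) (t : tape void) : Prop :=
  exists a b, t = (nseq a None, None :: [seq bit x | x <- s] ++ nseq b None).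

Lemma represents_left s t :
  represents s t -> shifted s (move_head (Some false) (write (read t) t)).
Proof.
move=> [a [b ->]]; rewrite /write /read.
case: s => [|x s] /=.
  case: b => [|b] /=; case: a => [|a] /=.
  - by exists 0, 1.
  - by exists a, 1.
  - by exists 0, b.+1.
  - by exists a, b.+1.
by case: a => [|a]; [exists 0, b | exists a, b].
Qed.

Lemma shifted_write x s t : shifted s t -> represents (x :: s) (write (bit x) t).
Proof. by move=> [a [b ->]]; exists a, b. Qed.

End Machine.

(** * Correctness of the compilation *)

Section Simulation.

Variables (code : seq instr) (K : nat) (O : seq bool -> seq bool).

Notation M := (stack_machine code K).
Notation N := (size code).
Notation mstep := (@step M O).

Definition code_at (a : nat) (cs : seq instr) : Prop :=
  forall i, i < size cs -> a + i < N /\ fetch code (a + i) = nth (IJump N) cs i.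

Lemma code_at_cons a i cs : code_at a (i :: cs) ->
  [/\ a < N, fetch code a = i & code_at a.+1 cs].
Proof.
move=> h; have := h 0 isT; rewrite addn0 => -[-> ->]; split=> // j hj.
by have := h j.+1 hj; rewrite addnS -addSn.
Qed.

Lemma code_at_cat a cs1 cs2 :
  code_at a (cs1 ++ cs2) -> code_at a cs1 /\ code_at (a + size cs1) cs2.
Proof.
move=> h; split=> i hi.
  by have := h i; rewrite size_cat nth_cat hi => -[]; rewrite ?ltn_addr.
have := h (size cs1 + i); rewrite size_cat ltn_add2l hi nth_cat.
have -> : (size cs1 + i < size cs1) = false by lia.
by rewrite addKn addnA; apply.
Qed.

Lemma mstepE pc st (c : config M) : pc < N -> matches pc st c ->
  mstep c = let ts := if is_query (fetch code pc) then @query M O c.2 else c.2 in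
    let act := action (fetch code pc) [ffun i => read (ts i)] in
    (inord act.1, fun i : 'I_K.+1 => let a := act.2 i (read (ts i)) in move_head a.2 (write a.1 (ts i))).
Proof.
move=> hpc [epc _]; rewrite /step /= epc leqNgt hpc /= /fetch.
congr pair; apply: functional_extensionality => i.
by rewrite !ffunE.
Qed.

Lemma step_jump a k st (c : config M) : a < N -> fetch code a = IJump k -> k <= N ->
  matches a st c -> matches k st (mstep c).
Proof.
move=> ha ea hk h; rewrite (mstepE ha h) ea /=; split=> /=; first by rewrite inordK.
by move=> j; apply: write_read_represents; apply: (h.2 j).
Qed.

Lemma step_push a k r b st (c : config M) : a.+1 < N -> k <= N ->
  fetch code a = ILeft r a.+1 -> fetch code a.+1 = IWrite r b k ->
  matches a st c -> matches k (upd st r (b :: st r)) (mstep (mstep c)).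
Proof.
move=> ha hk e1 e2 h.
have ha' : a < N by apply: ltnW.
have := mstepE ha' h; rewrite e1 /= => E1.
set c1 := mstep c in E1 *.
have p1 : c1.1 = a.+1 :> nat by rewrite E1 /= inordK //; lia.
rewrite /step /= p1 leqNgt ha /= e2 /=; split=> /=; first by rewrite inordK.
move=> j; rewrite !ffunE /upd E1 /=; case: eqP => [<-|_].
  by apply: shifted_write; apply: represents_left; apply: (h.2 j).
by apply: write_read_represents; apply: write_read_represents; apply: (h.2 j).
Qed.

Lemma step_pop_nil a r ke k0 k1 st (c : config M) : a < N -> ke <= N -> r <= K ->
  fetch code a = IPop r ke k0 k1 -> st r = [::] ->
  matches a st c -> matches ke st (mstep c).
Proof.
move=> ha hk hr ea es h; rewrite (mstepE ha h) ea /=.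
have rdr : read (c.2 (inord r : 'I_K.+1)) = None.
  by rewrite (read_represents (h.2 _)) inordK // es.
split=> /=; first by rewrite ffunE rdr inordK.
move=> j; case: (eqVneq (j : nat) r) => [ej|_] /=.
  have -> : j = inord r by apply: val_inj; rewrite /= inordK.
  rewrite rdr /= -rdr; apply: write_read_represents; exact: h.2.
by apply: write_read_represents; exact: h.2.
Qed.

Lemma step_pop_cons a r ke k0 k1 b s st (c : config M) : a < N -> r <= K ->
  (if b then k1 else k0) <= N ->
  fetch code a = IPop r ke k0 k1 -> st r = b :: s ->
  matches a st c -> matches (if b then k1 else k0) (upd st r s) (mstep c).
Proof.
move=> ha hr hk ea es h; rewrite (mstepE ha h) ea /=.
have rdr : read (c.2 (inord r : 'I_K.+1)) = bit b.
  by rewrite (read_represents (h.2 _)) inordK // es.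
split=> /=; first by rewrite ffunE rdr /=; case: b hk {rdr es} => hk; rewrite inordK.
move=> j; rewrite /upd; case: (eqVneq (j : nat) r) => [ej|_] /=.
  have -> : j = inord r by apply: val_inj; rewrite /= inordK.
  rewrite rdr /=; apply: (@represents_pop b); rewrite -es -{1}(inordK (_ : r < K.+1)) //; exact: h.2.
by apply: write_read_represents; exact: h.2.
Qed.

Lemma step_query a k st (c : config M) : a < N -> k <= N ->
  fetch code a = IQuery K k ->
  matches a st c -> matches k (upd st K (O (st K))) (mstep c).
Proof.
move=> ha hk ea h; rewrite (mstepE ha h) ea /=; split=> /=; first by rewrite inordK.
move=> j; apply: write_read_represents; rewrite /query /upd.
have [->|nj] := eqVneq j ord_max.
  rewrite /= eqxx; have := leading_bits_represents (h.2 ord_max) => /= ->.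
  exact: represents_tape_of.
case: eqP => [ej|_]; last exact: h.2.
by case/eqP: nj; apply: val_inj.
Qed.

Lemma exec_sim c st t st' : exec O c st t st' ->
  forall a k cf, code_at a (comp c a k) -> k <= N -> regs_le K c ->
  matches a st cf -> matches k st' (iter t mstep cf).
Proof.
elim=> {c st t st'}.
- move=> st a k cf /code_at_cons[ha ea _] hk _ h.
  exact: step_jump h.
- move=> r b st a k cf /code_at_cons[ha ea /code_at_cons[ha' ea' _]] hk _ h.
  exact: step_push h.
- move=> r ce c0 c1 st t st' es _ IH a k cf /= /code_at_cons[ha ea].
  move=> /code_at_cat[he /code_at_cat[h0 h1]] hk /and4P[hr re r0 r1] h.
  rewrite -/(iter t.+1 _ _) iterSr; apply: IH he hk re _.
  have he' : a.+1 <= N by [].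
  exact: step_pop_nil ea es h.
- move=> r ce c0 c1 st b s t st' es _ IH a k cf /= /code_at_cons[ha ea].
  move=> /code_at_cat[he /code_at_cat[]]; rewrite !size_comp => h0 h1 hk /and4P[hr re r0 r1] h.
  rewrite -/(iter t.+1 _ _) iterSr.
  have b0 : a.+1 + len ce < N.
    by have [|] := h0 0; rewrite ?size_comp ?len_gt0 ?addn0.
  have b1 : a.+1 + len ce + len c0 < N.
    by have [|] := h1 0; rewrite ?size_comp ?len_gt0 ?addn0.
  have st1 := step_pop_cons (b := b) ha hr (_ : _ <= N) ea es h.
  by case: b IH es st1 => IH es st1; apply: (IH _ _ _ _ hk _ (st1 _)) => //; apply: ltnW.
- move=> r c0 c1 st es a k cf /= /code_at_cons[ha ea] _ hk /and3P[hr _ _] h.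
  exact: step_pop_nil ea es h.
- move=> r c0 c1 st b s t1 st1 t2 st2 es _ IH1 _ IH2 a k cf hc hk hr' h.
  have /= /code_at_cons[ha ea] := hc.
  move=> /code_at_cat[]; rewrite !size_comp => h0 h1.
  have /and3P[hr r0 r1] := hr'.
  rewrite -/(iter (t1 + t2).+1 mstep cf).
  have -> : (t1 + t2).+1 = t2 + t1.+1 by lia.
  rewrite iterD; apply: (IH2 a k) => //; rewrite iterSr.
  have b0 : a.+1 < N.
    by have [|] := h0 0; rewrite ?size_comp ?len_gt0 ?addn0.
  have b1 : a.+1 + len c0 < N.
    by have [|] := h1 0; rewrite ?size_comp ?len_gt0 ?addn0.
  have sst := step_pop_cons (b := b) ha hr (_ : _ <= N) ea es h.
  by case: b IH1 es sst => IH es sst; apply: (IH _ _ _ _ _ _ (sst _)) => //; apply: ltnW.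
- move=> c1 c2 st t1 st1 t2 st2 _ IH1 _ IH2 a k cf /= /code_at_cat[]; rewrite size_comp.
  move=> h1 h2 hk /andP[r1 r2] h.
  rewrite (addnC t1) iterD; apply: (IH2 _ _ _ h2 hk r2); apply: (IH1 _ _ _ h1 _ r1 h).
  by have [|] := h2 0; rewrite ?size_comp ?len_gt0 ?addn0 // => /ltnW.
- move=> r st a k cf /= /code_at_cons[ha ea _] hk /eqP rK h; subst r.
  exact: step_query h.
Qed.

End Simulation.

Definition input (x : seq bool) : store := fun i => if i == 0 then x else [::].

Definition runs (O : seq bool -> seq bool) (c : cmd) (st : store) (T : nat) (st' : store) : Prop :=
  exists2 t, t <= T & exec O c st t st'.

(** Halting configurations are fixed, so the output is still there at any later time [T']; an upper
    bound on the cost is enough. *)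
Lemma runs_in_stack_machine O c K x T st' T' : regs_le K c ->
  runs O c (input x) T st' -> T <= T' ->
  runs_in (stack_machine (comp c 0 (len c)) K) O x T' (st' 0).
Proof.
move=> hr [t tT ex] TT'; set M := stack_machine _ _.
have m0 : matches 0 (input x) (init M x).
  split=> //= j; rewrite /input -[(j : nat) == 0]/(j == ord0).
  by case: eqP => _; apply: represents_tape_of.
have hc : code_at (comp c 0 (len c)) 0 (comp c 0 (len c)).
  by move=> i hi; rewrite add0n.
have := exec_sim ex hc (_ : len c <= _) hr m0.
rewrite size_comp leqnn => /(_ isT) [pc tp].
set cf := iter t _ _ in pc tp.
have hh : halting cf.1 by rewrite /= pc size_comp.
have fixp n : iter n (@step M O) cf = cf.
  by elim: n => //= n ->; rewrite /step hh.
have -> : T' = (T' - t) + t by lia.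
rewrite /runs_in iterD -/cf fixp; split=> //.
exact: leading_bits_represents (tp ord0).
Qed.

Lemma qfree_comp c a k : qfree c -> all (fun i => ~~ is_query i) (comp c a k).
Proof.
elim: c a k => //= [r ce IHe c0 IH0 c1 IH1|r c0 IH0 c1 IH1|c1 IH1 c2 IH2] a k.
- by case/and3P=> *; rewrite !all_cat IHe ?IH0 ?IH1.
- by case/andP=> *; rewrite !all_cat IH0 ?IH1.
- by case/andP=> *; rewrite !all_cat IH2 ?IH1.
Qed.

Lemma qfree_stack_machine c K s :
  qfree c -> ~~ @querying (stack_machine (comp c 0 (len c)) K) s.
Proof.
move=> qc; rewrite /= /fetch.
have [h|h] := ltnP s (size (comp c 0 (len c))).
  exact: all_nthP (qfree_comp 0 (len c) qc) s h.
by rewrite nth_default.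
Qed.

(** * Polynomial bounds *)

(** A single monomial in the successor of the size is monotone and makes closure under sums,
    products and composition immediate; true polynomials appear only in [pbd_poly]. *)
Definition pbd {A : Type} (s : A -> nat) (T : A -> nat) : Prop :=
  exists a d, forall x, T x <= a * (s x).+1 ^ d.

Section PolyBounds.

Variables (A : Type) (s : A -> nat).

Lemma pbd_le (T1 T2 : A -> nat) : (forall x, T1 x <= T2 x) -> pbd s T2 -> pbd s T1.
Proof. by move=> h [a [d hd]]; exists a, d => x; apply: leq_trans (h x) (hd x). Qed.

Lemma pbd_const c : pbd s (fun=> c).
Proof. by exists c, 0 => x; rewrite muln1. Qed.

Lemma pbd_size : pbd s s.
Proof. by exists 1, 1 => x; rewrite mul1n expn1. Qed.

Lemma pbd_add T1 T2 : pbd s T1 -> pbd s T2 -> pbd s (fun x => T1 x + T2 x).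
Proof.
move=> [a1 [d1 h1]] [a2 [d2 h2]]; exists (a1 + a2), (d1 + d2) => x.
rewrite mulnDl leq_add //.
  by apply: leq_trans (h1 x) _; rewrite leq_mul2l leq_pexp2l ?leq_addr ?orbT.
by apply: leq_trans (h2 x) _; rewrite leq_mul2l leq_pexp2l ?leq_addl ?orbT.
Qed.

Lemma pbd_mul T1 T2 : pbd s T1 -> pbd s T2 -> pbd s (fun x => T1 x * T2 x).
Proof.
move=> [a1 [d1 h1]] [a2 [d2 h2]]; exists (a1 * a2), (d1 + d2) => x.
by rewrite expnD mulnACA leq_mul.
Qed.

Lemma pbd_succ T : pbd s T -> pbd s (fun x => (T x).+1).
Proof. by move=> h; apply: pbd_le (pbd_add h (pbd_const 1)) => x; rewrite addn1. Qed.

Lemma pbd_exp T d : pbd s T -> pbd s (fun x => T x ^ d).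
Proof.
move=> h; elim: d => [|d IH]; first exact: pbd_const.
by apply: pbd_le (pbd_mul h IH) => x; rewrite expnS.
Qed.

Lemma pbd_comp {B : Type} (sB : B -> nat) (f : A -> B) T :
  pbd sB T -> pbd s (fun x => sB (f x)) -> pbd s (fun x => T (f x)).
Proof.
move=> [a [d h]] hf.
by apply: pbd_le (pbd_mul (pbd_const a) (pbd_exp d (pbd_succ hf))) => x; apply: h.
Qed.

End PolyBounds.

Lemma pbd_poly (A : Type) (s T : A -> nat) : pbd s T ->
  exists p : {poly nat}, forall x, T x <= (p.[s x])%R.
Proof.
move=> [a [d h]]; exists (a%:P * ('X + 1) ^+ d)%R => x.
rewrite hornerM hornerC horner_exp hornerD hornerX hornerC natrXE natrDE natr1E addn1.
exact: h.
Qed.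

Lemma polytime_oracle_of_cmd O c K (f : seq bool -> seq bool) (T : seq bool -> nat) :
  regs_le K c -> pbd size T ->
  (forall x, exists2 st', runs O c (input x) (T x) st' & st' 0 = f x) ->
  polytime_oracle O f.
Proof.
move=> hr /pbd_poly[p hp] h; exists (stack_machine (comp c 0 (len c)) K), p => x.
have [st' rx <-] := h x.
exact: runs_in_stack_machine hr rx (hp x).
Qed.

Lemma polytime_of_cmd c (f : seq bool -> seq bool) (T : seq bool -> nat) :
  qfree c -> pbd size T ->
  (forall O x, exists2 st', runs O c (input x) (T x) st' & st' 0 = f x) ->
  polytime f.
Proof.
move=> qc /pbd_poly[p hp] h; exists (stack_machine (comp c 0 (len c)) (maxreg c)), p.
split=> [s|x]; first exact: qfree_stack_machine.
have [st' rx <-] := h (fun=> [::]) x.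
exact: runs_in_stack_machine (regs_le_maxreg qc (leqnn _)) rx (hp x).
Qed.

(** * Polynomial-time functions on binary trees *)

Inductive tree : Type := Leaf | Node of tree & tree.

(** The preorder code is prefix-free: a tree can be read off the front of a stack without an end
    mark, which is what splitting a pair requires. *)
Fixpoint ser (t : tree) : seq bool :=
  if t is Node a b then true :: ser a ++ ser b else [:: false].

Definition sz (t : tree) : nat := size (ser t).

Lemma sz_node a b : sz (Node a b) = (sz a + sz b).+1.
Proof. by rewrite /sz /= size_cat. Qed.

Lemma sz_gt0 t : 0 < sz t.
Proof. by case: t. Qed.

Lemma runs_le O c st T T' st' : runs O c st T st' -> T <= T' -> runs O c st T' st'.
Proof. by move=> [t h ex] h'; exists t => //; apply: leq_trans h'. Qed.

Lemma runs_eq O c st T st' st'' : runs O c st T st' -> st' = st'' -> runs O c st T st''.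
Proof. by move=> h <-. Qed.

Lemma runs_start O c st0 st T st' : runs O c st T st' -> st0 = st -> runs O c st0 T st'.
Proof. by move=> h ->. Qed.

Lemma runs_seq O c1 c2 st T1 st1 T2 st2 :
  runs O c1 st T1 st1 -> runs O c2 st1 T2 st2 -> runs O (Seq c1 c2) st (T1 + T2) st2.
Proof.
move=> [t1 h1 e1] [t2 h2 e2]; exists (t1 + t2); first exact: leq_add.
exact: ESeq e1 e2.
Qed.

Lemma runs_push O r b st : runs O (Push r b) st 2 (upd st r (b :: st r)).
Proof. by exists 2 => //; constructor. Qed.

Lemma runs_skip O st : runs O Skip st 1 st.
Proof. by exists 1 => //; constructor. Qed.

Lemma runs_pop_cons O r ce c0 c1 st b s T st' :
  st r = b :: s -> runs O (if b then c1 else c0) (upd st r s) T st' ->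
  runs O (Pop r ce c0 c1) st T.+1 st'.
Proof. by move=> e [t h ex]; exists t.+1 => //; apply: EPop_cons e ex. Qed.

Lemma runs_loop_cons O r c0 c1 st b s T1 st1 T2 st2 :
  st r = b :: s -> runs O (if b then c1 else c0) (upd st r s) T1 st1 ->
  runs O (Loop r c0 c1) st1 T2 st2 ->
  runs O (Loop r c0 c1) st (T1 + T2).+1 st2.
Proof.
move=> e [t1 h1 e1] [t2 h2 e2]; exists (t1 + t2).+1; first by rewrite ltnS leq_add.
exact: ELoop_cons e e1 e2.
Qed.

Lemma runs_loop_nil O r c0 c1 st : st r = [::] -> runs O (Loop r c0 c1) st 1 st.
Proof. by move=> e; exists 1 => //; constructor. Qed.

Ltac store_eq :=
  apply: functional_extensionality => ?; rewrite /upd;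
  repeat (case: eqP => [?|?]); subst => //=; try congruence.

(** * Renaming of registers *)

Fixpoint ren (p : nat -> nat) (c : cmd) : cmd :=
  match c with
  | Skip => Skip
  | Push r b => Push (p r) b
  | Pop r ce c0 c1 => Pop (p r) (ren p ce) (ren p c0) (ren p c1)
  | Loop r c0 c1 => Loop (p r) (ren p c0) (ren p c1)
  | Seq c1 c2 => Seq (ren p c1) (ren p c2)
  | Query r => Query (p r)
  end.

Lemma qfree_ren p c : qfree (ren p c) = qfree c.
Proof. by elim: c => //= [r ce -> c0 -> c1 ->|r c0 -> c1 ->|c1 -> c2 ->]. Qed.

(** A program sees only the registers in the range of [p]; the others survive, so programs written
    for registers 0, 1, ... can be embedded in a larger store at no cost. *)
Lemma exec_ren O p c st t st' : injective p -> exec O c st t st' ->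
  forall z, (forall i, z (p i) = st i) ->
  exists z', [/\ exec O (ren p c) z t z', forall i, z' (p i) = st' i
    & forall j, (forall i, j <> p i) -> z' j = z j].
Proof.
move=> pI; elim=> {c st t st'}.
- by move=> st z h; exists z; split=> //; constructor.
- move=> r b st z h; exists (upd z (p r) (b :: z (p r))); split; first by constructor.
    by move=> i; rewrite /upd (inj_eq pI) !h.
  by move=> j hj; rewrite /upd; case: eqP => // /hj.
- move=> r ce c0 c1 st t st' e _ IH z h; have [z' [h1 h2 h3]] := IH z h.
  by exists z'; split=> //; apply: EPop_nil h1; rewrite h.
- move=> r ce c0 c1 st b s t st' e _ IH z h.
  have [|z' [h1 h2 h3]] := IH (upd z (p r) s).
    by move=> i; rewrite /upd (inj_eq pI) !h.
  exists z'; split=> //.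
    have e' : z (p r) = b :: s by rewrite h.
    by apply: EPop_cons e' _; move: h1; case: (b).
  by move=> j hj; rewrite h3 // /upd; case: eqP => // /hj.
- by move=> r c0 c1 st e z h; exists z; split=> //; constructor; rewrite h.
- move=> r c0 c1 st b s t1 st1 t2 st2 e _ IH1 _ IH2 z h.
  have [|z1 [h1 h2 h3]] := IH1 (upd z (p r) s).
    by move=> i; rewrite /upd (inj_eq pI) !h.
  have [z2 [g1 g2 g3]] := IH2 z1 h2.
  exists z2; split=> //.
    have e' : z (p r) = b :: s by rewrite h.
    by apply: ELoop_cons e' _ g1; move: h1; case: (b).
  by move=> j hj; rewrite g3 // h3 // /upd; case: eqP => // /hj.
- move=> c1 c2 st t1 st1 t2 st2 _ IH1 _ IH2 z h.
  have [z1 [h1 h2 h3]] := IH1 z h; have [z2 [g1 g2 g3]] := IH2 z1 h2.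
  exists z2; split=> //; first exact: ESeq h1 g1.
  by move=> j hj; rewrite g3 // h3.
- move=> r st z h; exists (upd z (p r) (O (z (p r)))); split; first by constructor.
    by move=> i; rewrite /upd (inj_eq pI) !h.
  by move=> j hj; rewrite /upd; case: eqP => // /hj.
Qed.

Definition empty_from (d : nat) (st : store) : Prop := forall i, d <= i -> st i = [::].

Class code (A : Type) := Code { enc : A -> tree; dflt : A }.

#[export] Instance code_tree : code tree := Code id Leaf.

Definition sze {A : Type} {cA : code A} (x : A) : nat := sz (enc x).

(* [c] replaces the code of [x] on register [r] by [g x], using the registers
   from [d] on, which are initially and finally empty. *)
Definition computes_at {A : Type} {cA : code A} (r d : nat) (c : cmd) (T : A -> nat)
    (g : A -> tree) : Prop :=
  forall O x st, st r = ser (enc x) -> empty_from d st ->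
    runs O c st (T x) (upd st r (ser (g x))).

(* Nothing is required of the trees that are not codes. *)
Definition PT {A : Type} {cA : code A} (g : A -> tree) : Prop :=
  exists c T, [/\ qfree c, pbd sze T, pbd sze (fun x => sz (g x)) & computes_at 0 1 c T g].

Definition shift_regs (r d i : nat) : nat := if i is j.+1 then d + j else r.

Lemma runs_shift O c r d x y t :
  (forall st, st 0 = x -> empty_from 1 st -> runs O c st t (upd st 0 y)) -> r < d ->
  forall st, st r = x -> empty_from d st -> runs O (ren (shift_regs r d) c) st t (upd st r y).
Proof.
move=> h rd st er ed; set p := shift_regs r d.
have pI : injective p by move=> [|i] [|j] /=; lia.
have [||t' tT ex] := h (fun i => st (p i)).
- by rewrite /= er.
- by move=> [//|i] _ /=; apply: ed; rewrite leq_addr.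
have [z' [h1 h2 h3]] := exec_ren pI ex (z := st) (fun i => erefl).
exists t' => //; suff -> : upd st r y = z' by [].
apply: functional_extensionality => j; rewrite /upd.
case: eqP => [->|jr]; first by rewrite (h2 0).
have [dj|dj] := leqP d j.
  by have := h2 (j - d).+1; rewrite /upd /= subnKC //.
by rewrite h3 // => -[|i] /=; lia.
Qed.

Lemma PT_at {A : Type} {cA : code A} (g : A -> tree) r d : PT g -> r < d ->
  exists c T, [/\ qfree c, pbd sze T & computes_at r d c T g].
Proof.
move=> [c [T [qc hT _ h]]] rd.
exists (ren (shift_regs r d) c), T; split=> //; first by rewrite qfree_ren.
move=> O x; apply: runs_shift rd => st; exact: h.
Qed.

(** The string arrives reversed; a second move restores its order. *)
Definition mv (r s : nat) : cmd := Loop r (Push s false) (Push s true).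

Lemma runs_mv O r s st : r != s ->
  runs O (mv r s) st (3 * size (st r)).+1
    (upd (upd st s (catrev (st r) (st s))) r [::]).
Proof.
move=> /eqP rs; move e: (st r) => l; elim: l st e => [|b l IH] st e.
  by apply: (runs_le (T := 1)) => //; apply: runs_eq (runs_loop_nil _ _ _ e) _; store_eq.
apply: (runs_le (T := (2 + (3 * size l).+1).+1)); last by rewrite /=; lia.
apply: (runs_loop_cons (b := b) (s := l) (st1 := upd (upd st r l) s (b :: st s))) => //.
  have -> : (if b then Push s true else Push s false) = Push s b by case: b {e}.
  by apply: runs_eq (runs_push _ _ _ _) _; store_eq.
apply: runs_eq (IH _ _) _; first by rewrite /upd; case: eqP => // _; rewrite eqxx.
by store_eq.
Qed.

Definition clear (r : nat) : cmd := Loop r Skip Skip.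

Lemma runs_clear O r st : runs O (clear r) st (2 * size (st r)).+1 (upd st r [::]).
Proof.
move e: (st r) => l; elim: l st e => [|b l IH] st e.
  by apply: (runs_le (T := 1)) => //; apply: runs_eq (runs_loop_nil _ _ _ e) _; store_eq.
apply: (runs_le (T := (1 + (2 * size l).+1).+1)); last by rewrite /=; lia.
apply: (runs_loop_cons (b := b) (s := l) (st1 := upd st r l)) => //.
  by case: b {e}; apply: runs_skip.
by apply: runs_eq (IH _ _) _; [rewrite /upd eqxx | store_eq].
Qed.

Definition copy (r s u : nat) : cmd :=
  Seq (mv r u)
    (Loop u (Seq (Push r false) (Push s false)) (Seq (Push r true) (Push s true))).

Lemma runs_copy O r s u st : r != s -> s != u -> r != u -> st s = [::] -> st u = [::] ->
  runs O (copy r s u) st (8 * size (st r) + 2) (upd st s (st r)).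
Proof.
move=> rs su ru es eu.
have loop2 l : forall z, z u = l -> runs O
    (Loop u (Seq (Push r false) (Push s false)) (Seq (Push r true) (Push s true))) z
    (5 * size l).+1
    (upd (upd (upd z r (catrev l (z r))) s (catrev l (z s))) u [::]).
  move/eqP: rs => rs; move/eqP: su => su; move/eqP: ru => ru.
  elim: l => [|b l IH] z e.
    by apply: (runs_le (T := 1)) => //; apply: runs_eq (runs_loop_nil _ _ _ e) _; store_eq.
  apply: (runs_le (T := (4 + (5 * size l).+1).+1)); last by rewrite /=; lia.
  apply: (runs_loop_cons (b := b) (s := l)
    (st1 := upd (upd (upd z u l) r (b :: z r)) s (b :: z s))) => //.
    have -> : (if b then Seq (Push r true) (Push s true)
               else Seq (Push r false) (Push s false)) = Seq (Push r b) (Push s b).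
      by case: b {e}.
    apply: runs_eq (runs_seq (runs_push _ _ _ _) (runs_push _ _ _ _)) _.
    by store_eq.
  apply: runs_eq (IH _ _) _; last by store_eq.
  by rewrite /upd; repeat (case: eqP => [?|?]; subst => //).
apply: runs_le (runs_eq (runs_seq (runs_mv O st ru) (loop2 (rev (st r)) _ _)) _) _.
- rewrite /upd (eq_sym u r) (negPf ru) eqxx eu //.
- move/eqP: rs => rs; move/eqP: su => su; move/eqP: ru => ru.
  have e1 : catrev (rev (st r)) [::] = st r by rewrite -/(rev _) revK.
  apply: functional_extensionality => i; rewrite /upd.
  repeat (case: eqP => [?|?]); subst => //=; rewrite ?es ?eu ?e1 //.
- by rewrite size_rev; lia.
Qed.

(* Moves one tree from [r], reversed, onto [s]; [u] holds, in unary, the number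
   of subtrees that remain to be read. *)
Definition parse_body (r s u : nat) : cmd :=
  Pop r Skip (Push s false) (Seq (Push s true) (Seq (Push u true) (Push u true))).

Definition parse_tree (r s u : nat) : cmd :=
  Seq (Push u true) (Loop u (parse_body r s u) (parse_body r s u)).

Section Parse.

Variables (O : seq bool -> seq bool) (r s u : nat).
Hypotheses (rs : r <> s) (ru : r <> u) (su : s <> u).

Notation loop := (Loop u (parse_body r s u) (parse_body r s u)).

(** A leaf spends one unit of the counter; a node spends one and adds two. The rest of the loop,
    with its time [T], is a continuation, so that the induction hypotheses for the two subtrees can
    be chained. *)
Lemma runs_parse_loop t : forall st w b cnt T st',
  st r = ser t ++ w -> st u = b :: cnt ->
  runs O loop (upd (upd (upd st r w) s (catrev (ser t) (st s))) u cnt) T st' ->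
  runs O loop st (8 * sz t + T) st'.
Proof.
elim: t => [|t1 IH1 t2 IH2] st w b cnt T st' er eu h.
  apply: (runs_le (T := (3 + T).+1)); last by rewrite /sz /=; lia.
  apply: (runs_loop_cons eu _ h).
  have er' : upd st u cnt r = false :: w by rewrite /upd; case: eqP.
  rewrite if_same; apply: runs_pop_cons er' _.
  by apply: runs_eq (runs_push _ _ _ _) _; store_eq.
apply: (runs_le (T := (7 + (8 * sz t1 + (8 * sz t2 + T))).+1)).
  apply: (runs_loop_cons (st1 := upd (upd (upd st r (ser t1 ++ ser t2 ++ w)) s (true :: st s)) u (true :: true :: cnt)) eu).
    have er' : upd st u cnt r = true :: ser t1 ++ ser t2 ++ w.
      by rewrite /upd; case: eqP => //; rewrite er /= catA.
    rewrite if_same; apply: runs_pop_cons er' _.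
    apply: runs_eq (runs_seq (runs_push _ _ _ _) (runs_seq (runs_push _ _ _ _) (runs_push _ _ _ _))) _.
    by store_eq.
  apply: IH1.
  - by rewrite /upd; repeat case: eqP => //.
  - by rewrite /upd eqxx.
  apply: IH2.
  - by rewrite /upd; repeat case: eqP => //.
  - by rewrite /upd eqxx.
  by apply: runs_start h _; store_eq; rewrite /= !catrev_catl.
by rewrite sz_node; lia.
Qed.

Lemma runs_parse t st w : st r = ser t ++ w -> st u = [::] ->
  runs O (parse_tree r s u) st (8 * sz t + 3)
    (upd (upd st r w) s (catrev (ser t) (st s))).
Proof.
move=> er eu; apply: (runs_le (T := 2 + (8 * sz t + 1))); last by lia.
apply: runs_seq (runs_push _ _ _ _) _.
apply: (@runs_parse_loop t _ w true [::]).
- by rewrite /upd; case: eqP.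
- by rewrite /upd eqxx eu.
apply: runs_eq (runs_loop_nil _ _ _ _) _; first by rewrite /upd eqxx.
by store_eq.
Qed.

End Parse.

Ltac pbd_tac :=
  repeat first [ assumption | apply: pbd_size | apply: pbd_const | apply: pbd_succ
    | apply: pbd_add | apply: pbd_mul | apply: pbd_exp ].

Section Closure.

Context {A : Type} {cA : code A}.

Lemma PT_ext (g h : A -> tree) : g =1 h -> PT g -> PT h.
Proof.
move=> e [c [T [qc hT hs hc]]]; exists c, T; split=> //.
  by apply: pbd_le hs => x; rewrite e.
by move=> O x st h1 h2; rewrite -e; apply: hc.
Qed.

Lemma PT_size (g : A -> tree) : PT g -> pbd sze (fun x => sz (g x)).
Proof. by move=> [c [T []]]. Qed.

Lemma PT_id : PT (@enc A cA).
Proof.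
exists Skip, (fun=> 1); split=> //; try by pbd_tac.
by move=> O x st e _; apply: runs_eq (runs_skip _ _) _; store_eq.
Qed.

(** The time of the second program is bounded in the size of the intermediate result, which is why
    [PT] also records a bound on the size of the output. *)
Lemma PT_comp {B : Type} {cB : code B} (g : B -> tree) (f : A -> B) :
  PT g -> PT (fun x => enc (f x)) -> PT (fun x => g (f x)).
Proof.
move=> [cg [Tg [qg hTg hsg hg]]] [cf [Tf [qf hTf hsf hf]]].
exists (Seq cf cg), (fun x => Tf x + Tg (f x)); split=> //=; first by rewrite qf.
- by pbd_tac; apply: pbd_comp hTg hsf.
- exact: pbd_comp hsg hsf.
move=> O x st e0 e1; apply: runs_eq (runs_seq (hf _ _ _ e0 e1) (hg _ (f x) _ _ _)) _.
- by rewrite /upd eqxx.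
- by move=> i hi; rewrite /upd; case: eqP => [?|_]; [lia | apply: e1].
- by store_eq.
Qed.

Lemma PT_leaf : PT (fun _ : A => Leaf).
Proof.
exists (Seq (clear 0) (Push 0 false)), (fun x => (2 * sze x).+1 + 2); split=> //; try by pbd_tac.
move=> O x st e _; apply: runs_seq; first (apply: runs_le; first exact: runs_clear).
  by rewrite e.
by apply: runs_eq (runs_push _ _ _ _) _; store_eq.
Qed.

Lemma PT_node (f g : A -> tree) : PT f -> PT g -> PT (fun x => Node (f x) (g x)).
Proof.
move=> pf pg; have szf := PT_size pf; have szg := PT_size pg.
have [cf [Tf [qf hTf hf]]] := PT_at pf (isT : 1 < 2).
have [cg [Tg [qg hTg hg]]] := PT_at pg (isT : 0 < 2).
exists (Seq (copy 0 1 2) (Seq cf (Seq cg (Seq (mv 1 2) (Seq (mv 2 0) (Push 0 true)))))).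
exists (fun x => 8 * sze x + 2 + (Tf x + (Tg x + ((3 * sz (f x)).+1 + ((3 * sz (f x)).+1 + 2))))).
split; first by rewrite /= qf qg.
- by pbd_tac.
- have h : pbd sze (fun x => (sz (f x) + sz (g x)).+1) by pbd_tac.
  by apply: pbd_le h => x; rewrite sz_node.
move=> O x st e0 e1.
have := runs_copy O (r := 0) (s := 1) (u := 2) (st := st) isT isT isT (e1 1 isT) (e1 2 isT).
rewrite e0 => r1; apply: runs_seq r1 _.
apply: runs_seq.
  apply: (hf _ x); first by [].
  by move=> i hi; rewrite /upd; case: eqP => [?|_]; [lia | apply: e1; lia].
apply: runs_seq.
  apply: (hg _ x); first by [].
  by move=> i hi; rewrite /upd; repeat (case: eqP => [?|_]; first lia); apply: e1; lia.
apply: runs_seq; first exact: runs_mv.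
rewrite /=; apply: runs_seq; first (apply: runs_le; first exact: runs_mv).
  by rewrite /upd /= e1 // -/(rev _) size_rev.
apply: runs_eq (runs_push _ _ _ _) _.
apply: functional_extensionality => i; rewrite /upd /= e1 //.
case: i => [|[|[|i]]] //=; try by rewrite e1.
congr cons; rewrite -/(rev _) catrevE revK //.
Qed.

End Closure.

Definition car (t : tree) : tree := if t is Node a _ then a else Leaf.
Definition cdr (t : tree) : tree := if t is Node _ b then b else Leaf.

Lemma runs_split_leaf O st c : st 0 = ser Leaf ->
  runs O (Pop 0 Skip (Push 0 false) c) st 3 (upd st 0 [:: false]).
Proof.
move=> e0; apply: runs_pop_cons e0 _.
by apply: runs_eq (runs_push _ _ _ _) _; store_eq.
Qed.

Lemma sz_car t : sz (car t) <= sz t.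
Proof. by case: t => // a b; rewrite sz_node /=; lia. Qed.

Lemma sz_cdr t : sz (cdr t) <= sz t.
Proof. by case: t => // a b; rewrite sz_node /=; lia. Qed.

Lemma PT_car : PT car.
Proof.
exists (Pop 0 Skip (Push 0 false) (Seq (parse_tree 0 1 2) (Seq (clear 0) (mv 1 0)))).
exists (fun x => 20 * sz x + 20); split=> //.
- by pbd_tac.
- exact: pbd_le sz_car (pbd_size _).
move=> O [|a b] st e0 e1.
  apply: runs_le (runs_split_leaf _ _ e0) _; lia.
apply: runs_le; first apply: runs_pop_cons e0 _; first apply: runs_seq.
- by apply: (runs_parse _ _ _ _ (t := a) (w := ser b)) => //; rewrite /upd e1.
- apply: runs_seq; first exact: runs_clear.
  apply: runs_eq; first exact: runs_mv.
  apply: functional_extensionality => i; rewrite /upd /= e1 //.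
  by case: i => [|[|i]] //=; rewrite -/(rev _) ?e1 // -/(rev _) revK.
rewrite /upd /= e1 // -/(rev _) size_rev sz_node; rewrite -/(sz b) -/(sz a); lia.
Qed.

Lemma PT_cdr : PT cdr.
Proof.
exists (Pop 0 Skip (Push 0 false) (Seq (parse_tree 0 1 2) (clear 1))).
exists (fun x => 20 * sz x + 20); split=> //.
- by pbd_tac.
- exact: pbd_le sz_cdr (pbd_size _).
move=> O [|a b] st e0 e1.
  apply: runs_le (runs_split_leaf _ _ e0) _; lia.
apply: runs_le; first apply: runs_pop_cons e0 _; first apply: runs_seq.
- by apply: (runs_parse _ _ _ _ (t := a) (w := ser b)) => //; rewrite /upd e1.
- apply: runs_eq; first exact: runs_clear.
  apply: functional_extensionality => i; rewrite /upd /=.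
  by case: i => [|[|i]] //=; rewrite e1.
rewrite /upd /= e1 // -/(rev _) size_rev sz_node -/(sz a); lia.
Qed.

Definition is_node (t : tree) : bool := if t is Node _ _ then true else false.

Lemma PT_if {A : Type} {cA : code A} (f g h : A -> tree) : PT f -> PT g -> PT h -> PT (fun x => if is_node (f x) then g x else h x).
Proof.
move=> pf pg ph.
have szf := PT_size pf; have szg := PT_size pg; have szh := PT_size ph.
have [cf [Tf [qf hTf hf]]] := PT_at pf (isT : 1 < 2).
have [cg [Tg [qg hTg hg]]] := PT_at pg (isT : 0 < 2).
have [ch [Th [qh hTh hh]]] := PT_at ph (isT : 0 < 2).
exists (Seq (copy 0 1 2) (Seq cf (Pop 1 Skip ch (Seq (clear 1) cg)))).
exists (fun x => 8 * sze x + 2 + (Tf x + ((2 * sz (f x)).+1 + Tg x + Th x).+1)).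
split; first by rewrite /= qf qg qh.
- by pbd_tac.
- have h' : pbd sze (fun x => sz (g x) + sz (h x)) by pbd_tac.
  by apply: pbd_le h' => x; case: ifP => _; rewrite ?leq_addl ?leq_addr.
move=> O x st e0 e1.
have := runs_copy O (r := 0) (s := 1) (u := 2) (st := st) isT isT isT (e1 1 isT) (e1 2 isT).
rewrite e0 => r1; apply: runs_seq r1 _.
apply: runs_seq.
  apply: (hf _ x); first by [].
  by move=> i hi; rewrite /upd; case: eqP => [?|_]; [lia | apply: e1; lia].
case efx: (f x) => [|a b]; rewrite [is_node _]/=.
  apply: (runs_le (T := (Th x).+1)); last by lia.
  have E : upd (upd st 1 (ser (enc x))) 1 [:: false] 1 = [:: false] by [].
  apply: runs_pop_cons E _.
  apply: runs_eq; first apply: (hh _ x) => //.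
    by move=> i hi; rewrite /upd; repeat (case: eqP => [?|_]; first lia); apply: e1; lia.
  by store_eq; rewrite e1.
apply: (runs_le (T := ((2 * sz (f x)).+1 + Tg x).+1)); last by rewrite efx; lia.
set z := upd _ _ _; have E : z 1 = ser (Node a b) by [].
apply: runs_pop_cons E _; apply: runs_seq.
  apply: runs_le; first exact: runs_clear.
  by rewrite /upd [size _]/= efx sz_node size_cat -!/(sz _); lia.
apply: runs_eq; first apply: (hg _ x) => //.
  by move=> i hi; rewrite /z /upd; repeat (case: eqP => [?|_]; first lia); apply: e1; lia.
by rewrite /z; store_eq; rewrite e1.
Qed.

Lemma leq_pexp2 d m n : m <= n -> m.+1 ^ d <= n.+1 ^ d.
Proof. by case: d => // d h; rewrite leq_exp2r. Qed.

(** Each bit of the code of [n x] drives one turn of the loop, hence the count [sz (n x)].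
    Polynomial growth at every turn could compound to an exponential, so a bound on all the iterates
    is a hypothesis. *)
Lemma PT_iter {A C : Type} {cA : code A} {cC : code C} (s : C -> C) (n : A -> tree) (y : A -> C) :
  PT (fun z => enc (s z)) -> PT n -> PT (fun x => enc (y x)) ->
  (exists2 S : A -> nat, pbd sze S & forall x i, i <= sz (n x) -> sze (iter i s (y x)) <= S x) ->
  PT (fun x => enc (iter (sz (n x)) s (y x))).
Proof.
move=> ps pn py [S hS hi].
have pf := PT_node pn py; have szn := PT_size pn; have szy := PT_size py.
have [cf [Tf [qf hTf _ hf]]] := pf.
have szs := PT_size ps; have [cs [Ts [qs [a [D hTs]] hs]]] := PT_at ps (isT : 0 < 2).
exists (Seq cf (Pop 0 Skip (Push 0 false) (Seq (parse_tree 0 1 2) (Loop 1 cs cs)))).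
exists (fun x => Tf x + (8 * sz (n x) + 3 + (sz (n x) * (a * (S x).+1 ^ D).+1 + 1)).+1).
split; first by rewrite /= qf qs.
- by pbd_tac.
- by apply: pbd_le hS => x; apply: hi.
move=> O x st e0 e1; apply: runs_seq; first exact: hf e0 e1.
have E : upd st 0 (ser (Node (n x) (enc (y x)))) 0 = true :: ser (n x) ++ ser (enc (y x)) by [].
apply: runs_pop_cons E _; apply: runs_seq.
  by apply: (runs_parse _ _ _ _ (t := n x) (w := ser (enc (y x)))) => //; rewrite /upd e1.
set z := upd _ _ _.
have loop l : forall i (z : store), z 1 = l -> z 0 = ser (enc (iter i s (y x))) -> empty_from 2 z ->
    i + size l <= sz (n x) ->
    runs O (Loop 1 cs cs) z (size l * (a * (S x).+1 ^ D).+1 + 1)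
      (upd (upd z 0 (ser (enc (iter (size l + i) s (y x))))) 1 [::]).
  elim: l => [|b l IH] i w w1 w0 we /= hl.
    by rewrite add0n; apply: runs_eq (runs_loop_nil _ _ _ w1) _; store_eq.
  apply: (runs_le (T := (a * (S x).+1 ^ D + (size l * (a * (S x).+1 ^ D).+1 + 1)).+1)); last by lia.
  apply: (runs_loop_cons (st1 := upd (upd w 0 (ser (enc (iter i.+1 s (y x))))) 1 l) w1).
    rewrite if_same; apply: runs_eq; first (apply: runs_le; first apply: (hs _ (iter i s (y x)))).
    - by rewrite /upd /= w0.
    - by move=> j hj; rewrite /upd; case: eqP => [?|_]; [lia | apply: we].
    - apply: leq_trans (hTs _) _; rewrite leq_mul2l leq_pexp2 ?orbT //; apply: hi; lia.
    - by store_eq.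
  apply: runs_eq; first apply: (IH i.+1) => //.
  - by move=> j hj; rewrite /upd; repeat (case: eqP => [?|_]; first lia); apply: we.
  - by lia.
  - by rewrite addnS; store_eq.
apply: runs_eq; first (apply: runs_le; first apply: (loop (rev (ser (n x))) 0 z)) => //.
- by rewrite /z /upd /= e1.
- by move=> j hj; rewrite /z /upd; repeat (case: eqP => [?|_]; first lia); apply: e1; lia.
- by rewrite add0n size_rev.
- by rewrite size_rev leq_add2r leq_mul2r; apply/orP; right; rewrite /sz; lia.
rewrite addn0 size_rev -/(sz (n x)) /=; rewrite /z; store_eq; by rewrite e1.
Qed.

(** * Polynomial-time functions on coded data *)

(* [nat] is coded in unary and [bin] in binary. *)
Inductive bin : Type := Bin of nat.
Definition bval (b : bin) : nat := let: Bin n := b in n.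

#[export] Instance code_unit : code unit := Code (fun=> Leaf) tt.
#[export] Instance code_bool : code bool :=
  Code (fun b : bool => if b then Node Leaf Leaf else Leaf) false.
#[export] Instance code_nat : code nat := Code (fun n => iter n (Node Leaf) Leaf) 0.
#[export] Instance code_prod {A B} {cA : code A} {cB : code B} : code (A * B) :=
  Code (fun x => Node (enc x.1) (enc x.2)) (dflt, dflt).
#[export] Instance code_seq {A} {cA : code A} : code (seq A) :=
  Code (foldr (fun a t => Node (enc a) t) Leaf) [::].
#[export] Instance code_bin : code bin := Code (fun b => enc (binary (bval b))) (Bin 0).

Definition pt {A B : Type} {cA : code A} {cB : code B} (f : A -> B) : Prop :=
  PT (fun x => enc (f x)).

Lemma sze_gt0 {A : Type} {cA : code A} (a : A) : 0 < sze a.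
Proof. exact: sz_gt0. Qed.

Section Sizes.

Context {A B : Type} {cA : code A} {cB : code B}.

Lemma sze_nil : sze ([::] : seq A) = 1.
Proof. by []. Qed.

Lemma sze_cons (a : A) l : sze (a :: l) = (sze a + sze l).+1.
Proof. exact: sz_node. Qed.

Lemma sze_pair (a : A) (b : B) : sze (a, b) = (sze a + sze b).+1.
Proof. exact: sz_node. Qed.

Lemma sze_nat n : sze n = n.*2.+1.
Proof.
elim: n => // n IH; rewrite /sze (_ : enc n.+1 = Node Leaf (enc n)) // sz_node -/(sze n) IH.
by rewrite [sz Leaf]/= doubleS add1n.
Qed.

Lemma sze_bool (b : bool) : sze b <= 3.
Proof. by case: b. Qed.

Lemma sze_cat (l1 l2 : seq A) : (sze (l1 ++ l2)).+1 = sze l1 + sze l2.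
Proof. by elim: l1 => [|a l IH]; rewrite ?cat_cons ?sze_cons ?sze_nil //; lia. Qed.

Lemma sze_rev (l : seq A) : sze (rev l) = sze l.
Proof.
elim: l => // a l IH; rewrite rev_cons -cats1.
by have := sze_cat (rev l) [:: a]; rewrite !sze_cons sze_nil IH; lia.
Qed.

Lemma sze_take (l : seq A) k : sze (take k l) <= sze l.
Proof.
have h1 := sze_cat (take k l) (drop k l); rewrite cat_take_drop in h1.
have h2 : 0 < sze (drop k l) by apply: sze_gt0.
lia.
Qed.

Lemma sze_behead (l : seq A) : sze (behead l) <= sze l.
Proof. by case: l => // a l; rewrite sze_cons /=; lia. Qed.

Lemma sze_size (l : seq A) : size l < sze l.
Proof. elim: l => // a l; rewrite sze_cons /=; have h : 0 < sze a by apply: sze_gt0.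
lia. Qed.

Lemma sze_le_const (l : seq A) c : (forall i, i < size l -> sze (nth dflt l i) <= c) ->
  sze l <= (size l * c.+1).+1.
Proof.
elim: l => // a l IH h; rewrite sze_cons /=.
have := h 0 isT; rewrite /= => h0; have := IH (fun i hi => h i.+1 hi); lia.
Qed.

End Sizes.

Section Basic.

Context {A B C : Type} {cA : code A} {cB : code B} {cC : code C}.

Lemma pt_ext (f g : A -> B) : f =1 g -> pt f -> pt g.
Proof. by move=> e; apply: PT_ext => x; rewrite e. Qed.

Lemma pt_size (f : A -> B) : pt f -> pbd sze (fun x => sze (f x)).
Proof. exact: PT_size. Qed.

Lemma pt_id : pt (fun x : A => x).
Proof. exact: PT_id. Qed.

Lemma pt_comp (g : B -> C) (f : A -> B) : pt g -> pt f -> pt (fun x => g (f x)).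
Proof. by move=> pg pf; apply: (PT_comp (g := fun y => enc (g y)) pg). Qed.

Lemma pt_pair (f : A -> B) (g : A -> C) : pt f -> pt g -> pt (fun x => (f x, g x)).
Proof. exact: PT_node. Qed.

Lemma PT_tree_comp (g : tree -> tree) (f : A -> tree) : PT g -> PT f -> PT (fun x => g (f x)).
Proof. exact: (@PT_comp A cA tree code_tree). Qed.

Lemma pt_fst (f : A -> B * C) : pt f -> pt (fun x => (f x).1).
Proof. exact: (PT_tree_comp PT_car). Qed.

Lemma pt_snd (f : A -> B * C) : pt f -> pt (fun x => (f x).2).
Proof. exact: (PT_tree_comp PT_cdr). Qed.

Lemma PT_const (t : tree) : PT (fun _ : A => t).
Proof. by elim: t => [|a ha b hb]; [apply: PT_leaf | apply: PT_node]. Qed.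

Lemma pt_const (b : B) : pt (fun _ : A => b).
Proof. exact: PT_const. Qed.

Lemma pt_if (b : A -> bool) (f g : A -> B) :
  pt b -> pt f -> pt g -> pt (fun x => if b x then f x else g x).
Proof.
move=> pb pf pg; apply: PT_ext (PT_if pb pf pg) => x.
by rewrite /enc /=; case: (b x).
Qed.

Lemma pt_cons (f : A -> B) (g : A -> seq B) : pt f -> pt g -> pt (fun x => f x :: g x).
Proof. exact: PT_node. Qed.

Lemma pt_succ (f : A -> nat) : pt f -> pt (fun x => (f x).+1).
Proof. exact: (PT_node (PT_leaf)). Qed.

Lemma pt_pred (f : A -> nat) : pt f -> pt (fun x => (f x).-1).
Proof.
move=> pf; apply: PT_ext (PT_tree_comp PT_cdr pf) => x.
by case: (f x).
Qed.

Lemma pt_nilp (f : A -> seq B) : pt f -> pt (fun x => nilp (f x)).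
Proof.
move=> pf; apply: PT_ext (PT_if pf PT_leaf (PT_const (Node Leaf Leaf))) => x.
by rewrite /enc /=; case: (f x).
Qed.

Lemma pt_eq0 (f : A -> nat) : pt f -> pt (fun x => f x == 0).
Proof.
move=> pf; apply: PT_ext (PT_if pf PT_leaf (PT_const (Node Leaf Leaf))) => x.
by rewrite /enc /=; case: (f x).
Qed.

Lemma pt_head (f : A -> B) (g : A -> seq B) : pt f -> pt g -> pt (fun x => head (f x) (g x)).
Proof.
move=> pf pg; apply: PT_ext (PT_if pg (PT_tree_comp PT_car pg) pf) => x.
by rewrite /enc /=; case: (g x).
Qed.

Lemma pt_behead (f : A -> seq B) : pt f -> pt (fun x => behead (f x)).
Proof.
move=> pf; apply: PT_ext (PT_tree_comp PT_cdr pf) => x.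
by rewrite /enc /=; case: (f x).
Qed.

End Basic.

(** * Folds over lists *)

Section Fold.

Context {X A B : Type} {cX : code X} {cA : code A} {cB : code B}.

(** Stationary once the list is used up: [PT_iter] makes as many turns as the code of the list is
    long, which exceeds the number of its elements. *)
Definition fold_step (h : X -> B -> A -> B) (z : seq A * (X * B)) : seq A * (X * B) :=
  if nilp z.1 then z else (behead z.1, (z.2.1, h z.2.1 z.2.2 (head dflt z.1))).

Lemma iter_fold_step h i l x b :
  iter i (fold_step h) (l, (x, b)) = (drop i l, (x, foldl (h x) b (take i l))).
Proof.
elim: i => [|i IH]; first by rewrite drop0 take0.
rewrite iterS IH /fold_step /=; have [hi|hi] := leqP (size l) i.
  by rewrite /nilp size_drop (eqP (hi : size l - i == 0)) /= !drop_oversize ?take_oversize // ltnW.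
rewrite /nilp size_drop subn_eq0 leqNgt hi /=.
by rewrite (drop_nth dflt hi) /= (take_nth dflt hi) -cats1 foldl_cat.
Qed.

Lemma pt_foldl (h : X -> B -> A -> B) (l : X -> seq A) (b : X -> B) :
  pt l -> pt b -> pt (fun y : X * B * A => h y.1.1 y.1.2 y.2) ->
  (exists2 S : X -> nat, pbd sze S & forall x k, sze (foldl (h x) (b x) (take k (l x))) <= S x) ->
  pt (fun x => foldl (h x) (b x) (l x)).
Proof.
move=> pl pb ph [S hS hk].
have pst : pt (fold_step h).
  apply: pt_if; first exact: pt_nilp (pt_fst pt_id).
    exact: pt_id.
  apply: pt_pair; first exact: pt_behead (pt_fst pt_id).
  apply: pt_pair; first exact: pt_fst (pt_snd pt_id).
  apply: (pt_comp (g := fun y : X * B * A => h y.1.1 y.1.2 y.2)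
    (f := fun z : seq A * (X * B) => (z.2.1, z.2.2, head dflt z.1))) => //.
  apply: pt_pair; last by apply: pt_head (pt_const _) (pt_fst pt_id).
  apply: pt_pair; [exact: pt_fst (pt_snd pt_id) | exact: pt_snd (pt_snd pt_id)].
have py : pt (fun x => (l x, (x, b x))) by apply: pt_pair => //; apply: pt_pair => //; apply: pt_id.
have := PT_iter pst pl py; case.
  exists (fun x => (sze (l x) + (sze x + S x).+1).+1).
    by pbd_tac; apply: pt_size pl.
  move=> x i _; rewrite iter_fold_step !sze_pair ltnS leq_add //.
    pose proof (sze_cat (take i (l x)) (drop i (l x))) as e; rewrite cat_take_drop in e.
    by pose proof (sze_gt0 (take i (l x))) as e'; lia.
  by rewrite ltnS leq_add2l.
move=> c [T hT].
have {}hT : pt (fun x => iter (sz (enc (l x))) (fold_step h) (l x, (x, b x))) by exists c, T.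
apply: pt_ext (pt_snd (pt_snd hT)) => x; rewrite iter_fold_step /=.
by rewrite take_oversize // ltnW // -/(sze (l x)) sze_size.
Qed.

(** A step may add to the accumulator an amount controlled by the parameter and the current element,
    but may not multiply its size; the total growth is then at most the number of steps times a
    polynomial. *)
Lemma pt_foldl_add (h : X -> B -> A -> B) (l : X -> seq A) (b : X -> B) (a d : nat) :
  pt l -> pt b -> pt (fun y : X * B * A => h y.1.1 y.1.2 y.2) ->
  (forall x y z, sze (h x y z) <= sze y + a * (sze x + sze z).+1 ^ d) ->
  pt (fun x => foldl (h x) (b x) (l x)).
Proof.
move=> pl pb ph hh; apply: pt_foldl => //.
exists (fun x => sze (b x) + sze (l x) * (a * (sze x + sze (l x)).+1 ^ d)).
  by have szl := pt_size pl; have szb := pt_size pb; pbd_tac.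
move=> x k; have le : forall l' b', sze l' <= sze (l x) ->
    sze (foldl (h x) b' l') <= sze b' + sze l' * (a * (sze x + sze (l x)).+1 ^ d).
  elim=> [|y l' IH] b' /=; first by rewrite leq_addr.
  rewrite sze_cons => hl; apply: leq_trans (IH _ _) _; first by lia.
  apply: leq_trans (leq_add (hh _ _ _) (leqnn _)) _.
  have : a * (sze x + sze y).+1 ^ d <= a * (sze x + sze (l x)).+1 ^ d.
    by rewrite leq_mul2l leq_pexp2 ?orbT //; lia.
  by move: (a * (_ + sze y).+1 ^ d) (a * (_ + sze (l x)).+1 ^ d) => u v uv; nia.
apply: leq_trans (le _ _ (sze_take _ _)) _.
by rewrite leq_add2l leq_mul2r sze_take orbT.
Qed.

End Fold.

(* Hooks through which later closure lemmas are made known to [pt_tac]. *)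
Ltac pt_user := fail.
Ltac pt_user2 := fail.
Ltac pt_user3 := fail.

Ltac pt1 :=
  lazy beta zeta;
  lazymatch goal with
  | |- pt (fun x => x) => apply: pt_id
  | |- pt fst => apply: (pt_fst pt_id)
  | |- pt snd => apply: (pt_snd pt_id)
  | |- pt succn => apply: (pt_succ pt_id)
  | |- pt predn => apply: (pt_pred pt_id)
  | |- pt behead => apply: (pt_behead pt_id)
  | |- pt (fun x => (@?f x, @?g x)) => apply: pt_pair
  | |- pt (fun x => fst (@?f x)) => apply: pt_fst
  | |- pt (fun x => snd (@?f x)) => apply: pt_snd
  | |- pt (fun x => @?f x :: @?g x) => apply: pt_cons
  | |- pt (fun x => (@?f x).+1) => apply: pt_succ
  | |- pt (fun x => (@?f x).-1) => apply: pt_pred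
  | |- pt (fun x => nilp (@?f x)) => apply: pt_nilp
  | |- pt (fun x => head (@?f x) (@?g x)) => apply: pt_head
  | |- pt (fun x => behead (@?f x)) => apply: pt_behead
  | |- pt (fun x => @eq_op _ (@?f x) 0) => apply: pt_eq0
  | |- pt _ => first [ apply: pt_const | assumption | pt_user | pt_user2 | pt_user3 | apply: pt_if ]
  end.

Ltac pt_tac := repeat (intros; pt1).

Section Fold.

Context {X A B C : Type} {cX : code X} {cA : code A} {cB : code B} {cC : code C}.

Lemma pt_foldl_pt (h : X -> B -> A -> B) (l : X -> seq A) (b : X -> B) (g : X * A -> C) (c : nat) :
  pt l -> pt b -> pt (fun y : X * B * A => h y.1.1 y.1.2 y.2) -> pt g ->
  (forall x y z, sze (h x y z) <= sze y + sze (g (x, z)) + c) ->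
  pt (fun x => foldl (h x) (b x) (l x)).
Proof.
move=> pl pb ph pg hh; have [a [d hg]] := pt_size pg.
(* The pair (x, z) is one larger than its components together; doubling the base absorbs this, hence
   [2 ^ d]. *)
apply: (@pt_foldl_add _ _ _ _ _ _ h l b (a * 2 ^ d + c) d) => // x y z.
apply: leq_trans (hh x y z) _; rewrite -addnA leq_add2l mulnDl leq_add //; last first.
  by rewrite leq_pmulr // expn_gt0.
apply: leq_trans (hg _) _; rewrite -mulnA leq_mul2l -expnMn.
apply/orP; right; set u := _ * _.
have e : u = u.-1.+1 by rewrite /u; lia.
by rewrite e leq_pexp2 // sze_pair /u; lia.
Qed.

Lemma pt_foldl_const (h : X -> B -> A -> B) (l : X -> seq A) (b : X -> B) (c : nat) :
  pt l -> pt b -> pt (fun y : X * B * A => h y.1.1 y.1.2 y.2) ->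
  (forall x y z, sze (h x y z) <= sze y + c) ->
  pt (fun x => foldl (h x) (b x) (l x)).
Proof.
move=> pl pb ph hh.
apply: (@pt_foldl_add _ _ _ _ _ _ h l b c 0) => // x y z.
by rewrite muln1.
Qed.

End Fold.

Section Seq.

Context {X A B : Type} {cX : code X} {cA : code A} {cB : code B}.

Lemma pt_rev (f : X -> seq A) : pt f -> pt (fun x => rev (f x)).
Proof.
move=> pf; apply: (pt_ext (f := fun x => foldl (fun acc a => a :: acc) [::] (f x))).
  move=> x; rewrite -[f x in LHS]revK foldl_rev.
  by elim: (rev (f x)) => //= a s ->.
apply: (pt_foldl_pt (g := fun y : X * A => y.2) (c := 1)) => //; try by pt_tac.
by move=> x y z; rewrite sze_cons /=; lia.
Qed.

Lemma pt_cat (f g : X -> seq A) : pt f -> pt g -> pt (fun x => f x ++ g x).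
Proof.
move=> pf pg.
apply: (pt_ext (f := fun x => foldl (fun acc a => a :: acc) (g x) (rev (f x)))).
  by move=> x; rewrite foldl_rev; elim: (f x) => //= a s ->.
apply: (pt_foldl_pt (g := fun y : X * A => y.2) (c := 1)) => //; try by pt_tac.
  exact: pt_rev.
by move=> x y z; rewrite sze_cons /=; lia.
Qed.

Lemma pt_map (h : X -> A -> B) (l : X -> seq A) :
  pt l -> pt (fun y : X * A => h y.1 y.2) -> pt (fun x => [seq h x a | a <- l x]).
Proof.
move=> pl ph.
apply: (pt_ext (f := fun x => foldl (fun acc a => h x a :: acc) [::] (rev (l x)))).
  by move=> x; rewrite foldl_rev; elim: (l x) => //= a s ->.
apply: (pt_foldl_pt (g := fun y : X * A => h y.1 y.2) (c := 1)) => //.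
- exact: pt_rev.
- by pt_tac.
- apply: pt_cons; last by pt_tac.
  by apply: (pt_comp (f := fun y : X * seq B * A => (y.1.1, y.2)) ph); pt_tac.
by move=> x y z; rewrite sze_cons /=; lia.
Qed.

End Seq.

Ltac pt_user ::= first
  [ apply: pt_rev | apply: pt_cat | apply: pt_map ].

Section Seq2.

Context {X A : Type} {cX : code X} {cA : code A}.

Lemma pt_flatten (f : X -> seq (seq A)) : pt f -> pt (fun x => flatten (f x)).
Proof.
move=> pf; apply: (pt_ext (f := fun x => foldl (fun acc s => s ++ acc) [::] (rev (f x)))).
  by move=> x; rewrite foldl_rev.
apply: (pt_foldl_pt (g := fun y : X * seq A => y.2) (c := 0)) => //; try by pt_tac.
move=> x y z; pose proof (sze_cat z y) as e; rewrite [sze (_, _).2]/=; lia.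
Qed.

Lemma pt_size_seq (f : X -> seq A) : pt f -> pt (fun x => size (f x)).
Proof.
move=> pf; apply: (pt_ext (f := fun x => foldl (fun acc _ => acc.+1) 0 (f x))).
  move=> x; rewrite -[RHS]add0n; elim: (f x) 0 => //= [|a s IH] n; first by rewrite addn0.
  by rewrite IH addSnnS.
apply: (pt_foldl_const (c := 2)) => //; try by pt_tac.
by move=> x y z; rewrite !sze_nat; lia.
Qed.

(** A unary number and a list of that many units have the same tree as code. This turns iteration
    into a fold. *)
Lemma pt_nseq_tt (f : X -> nat) : pt f -> pt (fun x => nseq (f x) tt).
Proof. by apply: PT_ext => x; rewrite /enc /=; elim: (f x) => //= n ->. Qed.

Lemma foldl_nseq_tt (B : Type) (h : B -> B) b n : foldl (fun b _ => h b) b (nseq n tt) = iter n h b.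
Proof. by elim: n b => //= n IH b; rewrite IH -iterSr. Qed.

Lemma pt_iter {B : Type} {cB : code B} (h : X -> B -> B) (n : X -> nat) (b : X -> B) :
  pt n -> pt b -> pt (fun y : X * B => h y.1 y.2) ->
  (exists2 S : X -> nat, pbd sze S & forall x k, k <= n x -> sze (iter k (h x) (b x)) <= S x) ->
  pt (fun x => iter (n x) (h x) (b x)).
Proof.
move=> pn pb ph [S hS hk].
apply: (pt_ext (f := fun x => foldl (fun acc _ => h x acc) (b x) (nseq (n x) tt))).
  by move=> x; rewrite foldl_nseq_tt.
apply: pt_foldl => //; first exact: pt_nseq_tt.
  by apply: (pt_comp (f := fun y : X * B * unit => y.1) ph); pt_tac.
exists S => // x k; have [kn|kn] := leqP k (n x).
  by rewrite take_nseq // foldl_nseq_tt; apply: hk.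
by rewrite take_oversize ?size_nseq ?(ltnW kn) // foldl_nseq_tt; apply: (hk _ _ (leqnn _)).
Qed.

Lemma pt_iter_const {B : Type} {cB : code B} (h : X -> B -> B) (n : X -> nat) (b : X -> B) c :
  pt n -> pt b -> pt (fun y : X * B => h y.1 y.2) ->
  (forall x y, sze (h x y) <= sze y + c) ->
  pt (fun x => iter (n x) (h x) (b x)).
Proof.
move=> pn pb ph hc; apply: pt_iter => //.
exists (fun x => sze (b x) + sze (n x) * c).
  by have := pt_size pn; have := pt_size pb; move=> *; pbd_tac.
move=> x k hk; have : sze (iter k (h x) (b x)) <= sze (b x) + k * c.
  elim: k {hk} => [|k IH]; first by rewrite mul0n addn0.
  by rewrite iterS; apply: leq_trans (hc _ _) _; rewrite mulSn; lia.
by rewrite sze_nat; nia.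
Qed.

Lemma pt_addn (f g : X -> nat) : pt f -> pt g -> pt (fun x => f x + g x).
Proof.
move=> pf pg; apply: (pt_ext (f := fun x => iter (f x) succn (g x))).
  by move=> x; rewrite iter_succn addnC.
apply: (pt_iter_const (c := 2)) => //; first by pt_tac.
by move=> x y; rewrite !sze_nat; lia.
Qed.

Lemma pt_subn (f g : X -> nat) : pt f -> pt g -> pt (fun x => f x - g x).
Proof.
move=> pf pg; apply: (pt_ext (f := fun x => iter (g x) predn (f x))).
  by move=> x; elim: (g x) => [|n IH]; rewrite ?subn0 // subnS -IH.
apply: (pt_iter_const (c := 0)) => //; first by pt_tac.
by move=> x y; rewrite !sze_nat; lia.
Qed.

Lemma pt_drop (f : X -> nat) (g : X -> seq A) : pt f -> pt g -> pt (fun x => drop (f x) (g x)).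
Proof.
move=> pf pg; apply: (pt_ext (f := fun x => iter (f x) behead (g x))).
  by move=> x; elim: (f x) => [|n IH]; rewrite ?drop0 // iterS IH -drop1 drop_drop add1n.
apply: (pt_iter_const (c := 0)) => //; first by pt_tac.
by move=> x y; rewrite addn0 sze_behead.
Qed.

End Seq2.

Ltac pt_user ::= first
  [ apply: pt_rev | apply: pt_cat | apply: pt_map | apply: pt_flatten | apply: pt_size_seq
  | apply: pt_addn | apply: pt_subn | apply: pt_drop ].

Section Seq3.

Context {X A : Type} {cX : code X} {cA : code A}.

Lemma pt_muln (f g : X -> nat) : pt f -> pt g -> pt (fun x => f x * g x).
Proof.
move=> pf pg; apply: (pt_ext (f := fun x => iter (f x) (addn (g x)) 0)).
  by move=> x; rewrite iter_addn_0 mulnC.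
apply: pt_iter => //; first by pt_tac.
  by apply: pt_addn; last (by pt_tac); apply: (pt_comp (f := fst) pg); pt_tac.
exists (fun x => (sze (f x) * sze (g x)).+1).
  by have := pt_size pf; have := pt_size pg; move=> *; pbd_tac.
by move=> x k hk; rewrite iter_addn_0 !sze_nat; nia.
Qed.

Lemma pt_leq (f g : X -> nat) : pt f -> pt g -> pt (fun x => f x <= g x).
Proof. by move=> pf pg; rewrite /leq; pt_tac. Qed.

Lemma pt_andb (f g : X -> bool) : pt f -> pt g -> pt (fun x => f x && g x).
Proof. by move=> pf pg; rewrite /andb; pt_tac. Qed.

Lemma pt_orb (f g : X -> bool) : pt f -> pt g -> pt (fun x => f x || g x).
Proof. by move=> pf pg; rewrite /orb; pt_tac. Qed.

Lemma pt_negb (f : X -> bool) : pt f -> pt (fun x => ~~ f x).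
Proof. by move=> pf; rewrite /negb; pt_tac. Qed.

Lemma pt_eqn (f g : X -> nat) : pt f -> pt g -> pt (fun x => f x == g x).
Proof.
move=> pf pg; apply: (pt_ext (f := fun x => (f x <= g x) && (g x <= f x))).
  by move=> x; rewrite -eqn_leq.
by apply: pt_andb; apply: pt_leq.
Qed.

Lemma pt_eqb (f g : X -> bool) : pt f -> pt g -> pt (fun x => f x == g x).
Proof.
move=> pf pg; apply: (pt_ext (f := fun x => if f x then g x else ~~ g x)).
  by move=> x; case: (f x); case: (g x).
by apply: pt_if => //; apply: pt_negb.
Qed.

Lemma pt_take (f : X -> nat) (g : X -> seq A) : pt f -> pt g -> pt (fun x => take (f x) (g x)).
Proof.
move=> pf pg; apply: (pt_ext (f := fun x => rev (drop (size (g x) - f x) (rev (g x))))).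
  move=> x; rewrite drop_rev revK; have [h|h] := leqP (f x) (size (g x)); first by rewrite subKn.
  by rewrite (eqP (ltnW h : size (g x) - f x == 0)) subn0 take_size take_oversize // ltnW.
by pt_tac.
Qed.

Lemma pt_nth (d : X -> A) (f : X -> seq A) (i : X -> nat) :
  pt d -> pt f -> pt i -> pt (fun x => nth (d x) (f x) (i x)).
Proof.
move=> pd pf pi; apply: (pt_ext (f := fun x => head (d x) (drop (i x) (f x)))).
  by move=> x; rewrite -nth0 nth_drop addn0.
by pt_tac.
Qed.

Lemma pt_nseq (f : X -> nat) (a : X -> A) : pt f -> pt a -> pt (fun x => nseq (f x) (a x)).
Proof.
move=> pf pa; apply: (pt_ext (f := fun x => [seq a x | _ <- nseq (f x) tt])).
  by move=> x; elim: (f x) => //= n ->.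
apply: pt_map; first exact: pt_nseq_tt.
by apply: (pt_comp (f := fst) pa); pt_tac.
Qed.

Lemma pt_iota (f g : X -> nat) : pt f -> pt g -> pt (fun x => iota (f x) (g x)).
Proof.
move=> pf pg; apply: (pt_ext (f := fun x => rev (iter (g x) (fun acc => (f x + size acc) :: acc) [::]))).
  move=> x; suff E : iter (g x) (fun acc => (f x + size acc) :: acc) [::] = rev (iota (f x) (g x)).
    by rewrite E revK.
  elim: (g x) => // n IH; rewrite iterS IH size_rev size_iota.
  by rewrite -addn1 iotaD rev_cat.
apply: pt_rev; apply: pt_iter => //; first by pt_tac.
  apply: pt_cons; last by pt_tac.
  by apply: pt_addn; last (by pt_tac); apply: (pt_comp (f := fst) pf); pt_tac.
exists (fun x => (sze (g x) * (2 * sze (f x) + 2 * sze (g x))).+1).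
  by have := pt_size pf; have := pt_size pg; move=> *; pbd_tac.
move=> x k hk; have -> : iter k (fun acc => (f x + size acc) :: acc) [::] = rev (iota (f x) k).
  elim: k {hk} => // n IH; rewrite iterS IH size_rev size_iota.
  by rewrite -addn1 iotaD rev_cat.
rewrite sze_rev; apply: leq_trans (@sze_le_const _ _ _ (2 * (f x + k)).+1 _) _.
  by move=> i; rewrite size_iota => hi; rewrite nth_iota // sze_nat; lia.
by rewrite size_iota !sze_nat; nia.
Qed.

End Seq3.

Ltac pt_user ::= first
  [ apply: pt_rev | apply: pt_cat | apply: pt_map | apply: pt_flatten | apply: pt_size_seq
  | apply: pt_addn | apply: pt_subn | apply: pt_drop | apply: pt_muln | apply: pt_leq
  | apply: pt_andb | apply: pt_orb | apply: pt_negb | apply: pt_eqn | apply: pt_eqb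
  | apply: pt_take | apply: pt_nth | apply: pt_nseq | apply: pt_iota ].

Section Seq4.

Context {X A : Type} {cX : code X} {cA : code A}.

Lemma pt_foldl_bool (h : X -> bool -> A -> bool) (l : X -> seq A) (b : X -> bool) :
  pt l -> pt b -> pt (fun y : X * bool * A => h y.1.1 y.1.2 y.2) ->
  pt (fun x => foldl (h x) (b x) (l x)).
Proof.
move=> pl pb ph; apply: (pt_foldl_const (c := 3)) => // x y z.
by apply: leq_trans (sze_bool _) _; rewrite leq_addl.
Qed.

Lemma pt_all (p : X -> A -> bool) (l : X -> seq A) :
  pt l -> pt (fun y : X * A => p y.1 y.2) -> pt (fun x => all (p x) (l x)).
Proof.
move=> pl pp; apply: (pt_ext (f := fun x => foldl (fun b a => b && p x a) true (l x))).
  move=> x; rewrite -[RHS]/(true && _); elim: (l x) true => //= [|a s IH] b; first by rewrite andbT.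
  by rewrite IH andbA.
apply: pt_foldl_bool => //; first by pt_tac.
lazy beta; apply: pt_andb; first by pt_tac.
by apply: (pt_comp (f := fun y : X * bool * A => (y.1.1, y.2)) pp); pt_tac.
Qed.

Lemma pt_has (p : X -> A -> bool) (l : X -> seq A) :
  pt l -> pt (fun y : X * A => p y.1 y.2) -> pt (fun x => has (p x) (l x)).
Proof.
move=> pl pp; apply: (pt_ext (f := fun x => ~~ all (fun a => ~~ p x a) (l x))).
  by move=> x; rewrite -has_predC; apply: eq_has => a /=; rewrite negbK.
by apply: pt_negb; apply: pt_all => //; lazy beta; apply: pt_negb.
Qed.

Lemma pt_count (p : X -> A -> bool) (l : X -> seq A) :
  pt l -> pt (fun y : X * A => p y.1 y.2) -> pt (fun x => count (p x) (l x)).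
Proof.
move=> pl pp; apply: (pt_ext (f := fun x => foldl (fun n a => if p x a then n.+1 else n) 0 (l x))).
  move=> x; rewrite -[RHS]add0n; elim: (l x) 0 => //= [|a s IH] n; first by rewrite addn0.
  by rewrite IH; case: (p x a); rewrite ?addn1 addnA ?addn0 ?addn1.
apply: (pt_foldl_const (c := 2)) => //; first by pt_tac.
  lazy beta; apply: pt_if; last (by pt_tac); last by pt_tac.
  by apply: (pt_comp (f := fun y : X * nat * A => (y.1.1, y.2)) pp); pt_tac.
by move=> x n a; case: (p x a); rewrite !sze_nat; lia.
Qed.

Lemma pt_index_false (f : X -> seq bool) : pt f -> pt (fun x => index false (f x)).
Proof.
move=> pf; apply: (pt_ext (f := fun x =>
  (foldl (fun (st : bool * nat) b => if st.1 then (if b then (true, st.2.+1) else (false, st.2)) else st)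
    (true, 0) (f x)).2)).
  move=> x; rewrite -[RHS]add0n.
  have stop n s : foldl (fun (st : bool * nat) (b : bool) =>
      if st.1 then (if b then (true, st.2.+1) else (false, st.2)) else st) (false, n) s = (false, n).
    by elim: s.
  elim: (f x) 0 => //= [|b s IH] n; first by rewrite addn0.
  by case: b; rewrite /= ?stop ?addn0 // IH addSnnS.
apply: pt_snd; apply: (pt_foldl_const (c := 5)) => //; try by pt_tac.
move=> x [[] n] [] /=; rewrite !sze_pair !sze_nat; try lia.
all: by have := sze_bool true; have := sze_bool false; have := sze_gt0 true; lia.
Qed.

End Seq4.

Ltac pt_user ::= fail.

Ltac pt_hyp :=
  match goal with
  | h : pt ?f |- pt (fun x => ?f (@?g x)) => apply: (pt_comp (g := f) (f := g) h)
  end.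

Ltac pt1 ::=
  lazy beta zeta;
  lazymatch goal with
  | |- pt (fun x => x) => apply: pt_id
  | |- pt fst => apply: (pt_fst pt_id)
  | |- pt snd => apply: (pt_snd pt_id)
  | |- pt (fun x => (@?f x, @?g x)) => apply: pt_pair
  | |- pt (fun x => fst (@?f x)) => apply: pt_fst
  | |- pt (fun x => snd (@?f x)) => apply: pt_snd
  | |- pt (fun x => @?f x :: @?g x) => apply: pt_cons
  | |- pt (fun x => (@?f x).+1) => first [ apply: pt_const | apply: pt_succ ]
  | |- pt (fun x => (@?f x).-1) => apply: pt_pred
  | |- pt (fun x => nilp (@?f x)) => apply: pt_nilp
  | |- pt (fun x => head (@?f x) (@?g x)) => apply: pt_head
  | |- pt (fun x => behead (@?f x)) => apply: pt_behead
  | |- pt (fun x => @eq_op _ (@?f x) 0) => apply: pt_eq0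
  | |- pt size => apply: (pt_size_seq pt_id)
  | |- pt rev => apply: (pt_rev pt_id)
  | |- pt negb => apply: (pt_negb pt_id)
  | |- pt flatten => apply: (pt_flatten pt_id)
  | |- pt (fun x => rev (@?f x)) => apply: pt_rev
  | |- pt (fun x => (@?f x) ++ (@?g x)) => apply: pt_cat
  | |- pt (fun x => map (@?f x) (@?g x)) => apply: pt_map
  | |- pt (fun x => flatten (@?f x)) => apply: pt_flatten
  | |- pt (fun x => size (@?f x)) => apply: pt_size_seq
  | |- pt (fun x => (@?f x) + (@?g x)) => apply: pt_addn
  | |- pt (fun x => (@?f x) - (@?g x)) => apply: pt_subn
  | |- pt (fun x => (@?f x) * (@?g x)) => apply: pt_muln
  | |- pt (fun x => (@?f x) <= (@?g x)) => apply: pt_leq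
  | |- pt (fun x => drop (@?f x) (@?g x)) => apply: pt_drop
  | |- pt (fun x => take (@?f x) (@?g x)) => apply: pt_take
  | |- pt (fun x => (@?f x) && (@?g x)) => apply: pt_andb
  | |- pt (fun x => (@?f x) || (@?g x)) => apply: pt_orb
  | |- pt (fun x => ~~ (@?f x)) => apply: pt_negb
  | |- pt (fun x => @eq_op Datatypes_nat__canonical__eqtype_Equality (@?f x) (@?g x)) => apply: pt_eqn
  | |- pt (fun x => @eq_op Datatypes_bool__canonical__eqtype_Equality (@?f x) (@?g x)) => apply: pt_eqb
  | |- pt (fun x => nth (@?d x) (@?f x) (@?g x)) => apply: pt_nth
  | |- pt (fun x => nseq (@?f x) (@?g x)) => apply: pt_nseq
  | |- pt (fun x => iota (@?f x) (@?g x)) => apply: pt_iota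
  | |- pt (fun x => all (@?f x) (@?g x)) => apply: pt_all
  | |- pt (fun x => has (@?f x) (@?g x)) => apply: pt_has
  | |- pt (fun x => count (@?f x) (@?g x)) => apply: pt_count
  | |- pt (fun x => index false (@?f x)) => apply: pt_index_false
  | |- pt _ => first [ assumption | apply: pt_const | pt_hyp | pt_user | pt_user2 | pt_user3 | apply: pt_if ]
  end.

Lemma pt_eqseq {X : Type} {cX : code X} (f g : X -> seq bool) :
  pt f -> pt g -> pt (fun x => f x == g x).
Proof.
move=> pf pg; apply: (pt_ext (f := fun x => (size (f x) == size (g x)) &&
    all (fun i => nth false (f x) i == nth false (g x) i) (iota 0 (size (f x))))).
  move=> x; apply/andP/eqP => [[/eqP es /allP h]|->]; last by rewrite eqxx; split=> //; apply/allP.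
  by apply: (@eq_from_nth _ false) => // i hi; apply/eqP/h; rewrite mem_iota.
by pt_tac.
Qed.

(** * Binary arithmetic *)

Fixpoint val2 (s : seq bool) : nat := if s is b :: s' then b + (val2 s').*2 else 0.

Definition trim (s : seq bool) : seq bool :=
  foldr (fun b t => if nilp t && ~~ b then [::] else b :: t) [::] s.

Lemma binary0 : binary 0 = [::].
Proof. by rewrite /binary up_log1. Qed.

Lemma binaryE n : 0 < n -> binary n = odd n :: binary n./2.
Proof.
move=> n0; rewrite /binary up_log2S // /= divn1; congr cons.
rewrite (iotaDl 1 0) -map_comp; apply: eq_map => i /=.
by rewrite expnS divnMA divn2.
Qed.

Lemma binary_cons (b : bool) n :
  binary (b + n.*2) = if nilp (binary n) && ~~ b then [::] else b :: binary n.
Proof.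
case: (posnP (b + n.*2)) => [e|p].
  have [-> ->] : n = 0 /\ b = false by case: b e; lia.
  by rewrite binary0.
rewrite binaryE // oddD odd_double addbF half_bit_double.
have -> : odd b = b by case: b {p}.
case: n p => [|n] p; first by rewrite binary0; case: b p.
by rewrite [in nilp _]binaryE.
Qed.

Lemma binary_val2 s : binary (val2 s) = trim s.
Proof. by elim: s => [|b s IH] /=; rewrite ?binary0 // binary_cons IH. Qed.

Lemma val2_binary n : val2 (binary n) = n.
Proof.
elim/ltn_ind: n => -[|n] IH; first by rewrite binary0.
rewrite binaryE // -[RHS]odd_double_half; set m := _./2; rewrite /= IH //.
by rewrite /m; lia.
Qed.

Definition blen (n : nat) : nat := size (binary n).

Lemma blen0 : blen 0 = 0.
Proof. by rewrite /blen binary0. Qed.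

Lemma blenE n : 0 < n -> blen n = (blen n./2).+1.
Proof. by move=> n0; rewrite /blen binaryE. Qed.

Lemma leq_blen n k : (blen n <= k) = (n < 2 ^ k).
Proof.
elim: k n => [|k IH] n; case: (posnP n) => [->|p]; rewrite ?blen0 ?expn_gt0 //.
  by rewrite blenE //; lia.
by rewrite blenE // ltnS IH expnS; have := odd_double_half n; lia.
Qed.

Lemma blen_mono m n : m <= n -> blen m <= blen n.
Proof. by move=> h; rewrite leq_blen; apply: leq_ltn_trans h _; rewrite -leq_blen. Qed.

Lemma blen_mul m n : blen (m * n) <= blen m + blen n.
Proof.
case: (posnP m) => [->|m0]; first by rewrite mul0n blen0.
by rewrite leq_blen expnD ltn_mul // -leq_blen.
Qed.

Lemma blen_exp m k : blen (m ^ k) <= (k * blen m).+1.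
Proof.
elim: k => [|k IH]; first by rewrite leq_blen.
rewrite expnS; apply: leq_trans (blen_mul _ _) _; rewrite mulSn; lia.
Qed.

Lemma blen_le n : blen n <= n.
Proof. by rewrite leq_blen ltn_expl. Qed.

Lemma sze_bits (s : seq bool) : (size s).*2 < sze s <= (size s * 4).+1.
Proof.
elim: s => // b s; rewrite sze_cons /=; have := sze_bool b; have : 0 < sze b by apply: sze_gt0.
by lia.
Qed.

Lemma sze_bin n : sze (Bin n) <= (blen n * 4).+1.
Proof. by have /andP[] := sze_bits (binary n). Qed.

Lemma blen_sze n : blen n <= sze (Bin n).
Proof. by have /andP[h _] := sze_bits (binary n); apply: leq_trans (ltnW h); rewrite /blen; lia. Qed.

Lemma iota_rcons k : iota 0 k.+1 = rcons (iota 0 k) k.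
Proof. by rewrite -addn1 iotaD cats1. Qed.

Section Bin.

Context {X : Type} {cX : code X}.

Lemma pbd_blen (f : X -> nat) : pt (fun x => Bin (f x)) -> pbd sze (fun x => blen (f x)).
Proof. by move=> h; apply: pbd_le (pt_size h) => x; apply: blen_sze. Qed.

Lemma pt_binary (f : X -> nat) : pt (fun x => Bin (f x)) -> pt (fun x => binary (f x)).
Proof. by []. Qed.

Lemma pt_bval (f : X -> bin) : pt f -> pt (fun x => Bin (bval (f x))).
Proof. by apply: pt_ext => x; case: (f x). Qed.

(** Any string is accepted and its high zeros are trimmed, so the arithmetic below may leave such
    zeros in its results. *)
Lemma pt_val2 (f : X -> seq bool) : pt f -> pt (fun x => Bin (val2 (f x))).
Proof.
move=> pf; have h : pt (fun x => trim (f x)).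
  apply: (pt_ext (f := fun x => foldl (fun t b => if nilp t && ~~ b then [::] else b :: t) [::] (rev (f x)))).
    by move=> x; rewrite foldl_rev.
  apply: (pt_foldl_const (c := 4)) => //; try by pt_tac.
  move=> x t b; case: ifP => _; first by rewrite sze_nil; lia.
  by rewrite sze_cons; have := sze_bool b; lia.
have e : (fun x => enc (trim (f x))) =1 (fun x => enc (Bin (val2 (f x)))).
  by move=> x; rewrite -binary_val2.
exact: PT_ext e h.
Qed.

(** A full adder: the new carry is the majority of three bits and the output bit their sum modulo 2.
    The outputs pile up with the most significant one first. *)
Definition add_bit (s t : seq bool) (y : bool * seq bool) (i : nat) : bool * seq bool :=
  (if nth false s i then nth false t i || y.1 else nth false t i && y.1,
   (nth false s i != (nth false t i != y.1)) :: y.2).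

Definition adder (c : bool) (s t : seq bool) (k : nat) : bool * seq bool :=
  foldl (add_bit s t) (c, [::]) (iota 0 k).

Lemma val2_rcons s b : val2 (rcons s b) = val2 s + b * 2 ^ size s.
Proof. by elim: s => [|a s IH] /=; rewrite ?IH ?expnS; lia. Qed.

Lemma val2_take s k : val2 (take k.+1 s) = val2 (take k s) + nth false s k * 2 ^ k.
Proof.
have [h|h] := ltnP k (size s).
  by rewrite (take_nth false h) val2_rcons size_take h.
by rewrite nth_default // !take_oversize // ?addn0 //; lia.
Qed.

Lemma adderP c s t k (y := adder c s t k) :
  size y.2 = k /\ val2 (rev y.2) + y.1 * 2 ^ k = c + val2 (take k s) + val2 (take k t).
Proof.
rewrite {}/y; elim: k => [|k [IHs IH]]; first by rewrite !take0 /adder /=; case: c.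
move: IHs IH; rewrite /adder iota_rcons foldl_rcons -/(adder c s t k).
case: (adder c s t k) => c' o /= so; rewrite so; split=> //.
rewrite rev_cons val2_rcons size_rev so !val2_take expnS.
by move: IH; case: (nth _ s k); case: (nth _ t k); case: c' => /=; lia.
Qed.

Lemma val2_lt s : val2 s < 2 ^ size s.
Proof. by elim: s => //= b s; rewrite expnS; case: b; lia. Qed.

Lemma pt_adder (c : X -> bool) (s t : X -> seq bool) (k : X -> nat) :
  pt c -> pt s -> pt t -> pt k -> pt (fun x => adder (c x) (s x) (t x) (k x)).
Proof.
move=> pc ps pt' pk.
apply: (pt_foldl_const (h := fun x => add_bit (s x) (t x)) (l := fun x => iota 0 (k x))
  (b := fun x => (c x, [::])) (c := 8)); [by pt_tac | by pt_tac | | ].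
  have ps' : pt (fun y : X * (bool * seq bool) * nat => s y.1.1).
    by apply: (pt_comp (f := fun y : X * (bool * seq bool) * nat => y.1.1) ps); pt_tac.
  have pt'' : pt (fun y : X * (bool * seq bool) * nat => t y.1.1).
    by apply: (pt_comp (f := fun y : X * (bool * seq bool) * nat => y.1.1) pt'); pt_tac.
  by rewrite /add_bit; pt_tac.
move=> x [b o] i; rewrite /add_bit !sze_pair /= sze_cons.
set b1 := if _ then _ else _; set b2 := _ != _.
by have := sze_bool b1; have := sze_bool b2; lia.
Qed.

Lemma pt_bin_add (f g : X -> nat) : pt (fun x => Bin (f x)) -> pt (fun x => Bin (g x)) ->
  pt (fun x => Bin (f x + g x)).
Proof.
move=> /pt_binary pf /pt_binary pg.
pose A x := adder false (binary (f x)) (binary (g x)) (size (binary (f x)) + size (binary (g x))).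
apply: (pt_ext (f := fun x => Bin (val2 (rev ((A x).1 :: (A x).2))))).
  move=> x; congr Bin; rewrite rev_cons val2_rcons size_rev.
  have [-> ->] := adderP false (binary (f x)) (binary (g x)) (size (binary (f x)) + size (binary (g x))).
  by rewrite !take_oversize ?leq_addl ?leq_addr // !val2_binary.
have pA : pt A by apply: pt_adder; pt_tac.
by apply: pt_val2; pt_tac.
Qed.

Definition complement (t : seq bool) (k : nat) : seq bool :=
  [seq ~~ nth false t i | i <- iota 0 k].

Lemma val2_complement t k : val2 (complement t k) + val2 (take k t) = 2 ^ k - 1.
Proof.
elim: k => [|k IH]; first by rewrite take0.
rewrite /complement iota_rcons map_rcons val2_rcons -/(complement t k) val2_take.
rewrite size_map size_iota expnS.
by move: IH; have := expn_gt0 2 k; rewrite /complement; case: (nth _ t k) => /=; lia.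
Qed.

(** The complement of [m] and an initial carry are added to [n], which makes 2^k + n - m; the final
    carry therefore decides the comparison. *)
Definition subtractor (n m : nat) : bool * seq bool :=
  let k := blen n + blen m in adder true (binary n) (complement (binary m) k) k.

Lemma subtractorP n m : ((subtractor n m).1 = (m <= n)) /\
  (m <= n -> val2 (rev (subtractor n m).2) = n - m).
Proof.
rewrite /subtractor; set k := _ + _; set A := adder _ _ _ _.
have [sA] := adderP true (binary n) (complement (binary m) k) k; rewrite -/A.
have -> : take k (complement (binary m) k) = complement (binary m) k.
  by rewrite take_oversize // size_map size_iota.
have := val2_complement (binary m) k.
rewrite !take_oversize ?leq_addl ?leq_addr // !val2_binary.
have := val2_lt (rev A.2); rewrite size_rev sA.
by case: A.1 => /=; have := expn_gt0 2 k; lia.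
Qed.

Lemma pt_subtractor (f g : X -> nat) : pt (fun x => Bin (f x)) -> pt (fun x => Bin (g x)) ->
  pt (fun x => subtractor (f x) (g x)).
Proof.
move=> /pt_binary pf /pt_binary pg; apply: pt_adder; rewrite /complement /blen; try by pt_tac.
have pg' : pt (fun y : X * nat => binary (g y.1)) by apply: (pt_comp (f := fst) pg); pt_tac.
by pt_tac.
Qed.

Lemma pt_bin_leq (f g : X -> nat) : pt (fun x => Bin (f x)) -> pt (fun x => Bin (g x)) ->
  pt (fun x => f x <= g x).
Proof.
move=> pf pg; have p := pt_subtractor pg pf.
by apply: pt_ext (pt_fst p) => x; rewrite (subtractorP _ _).1.
Qed.

Lemma pt_bin_sub (f g : X -> nat) : pt (fun x => Bin (f x)) -> pt (fun x => Bin (g x)) ->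
  pt (fun x => Bin (f x - g x)).
Proof.
move=> pf pg; have p := pt_subtractor pf pg; have p2 := pt_bin_leq pg pf.
apply: (pt_ext (f := fun x => if g x <= f x then Bin (val2 (rev (subtractor (f x) (g x)).2)) else Bin 0)).
  move=> x; case: leqP => h; first by rewrite (subtractorP _ _).2.
  by rewrite (eqP (ltnW h : f x - g x == 0)).
by apply: pt_if => //; [apply: pt_val2; pt_tac | pt_tac].
Qed.

Lemma pt_bin_bit (b : X -> bool) (f : X -> nat) : pt b -> pt (fun x => Bin (f x)) ->
  pt (fun x => Bin (b x + (f x).*2)).
Proof.
move=> pb /pt_binary pf; apply: (pt_ext (f := fun x => Bin (val2 (b x :: binary (f x))))).
  by move=> x /=; rewrite val2_binary.
by apply: pt_val2; pt_tac.
Qed.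

End Bin.

Lemma val2_drop s j : val2 s = val2 (take j s) + val2 (drop j s) * 2 ^ minn j (size s).
Proof.
elim: s j => [|b s IH] [|j] //=; rewrite ?min0n ?muln1 ?add0n //.
by rewrite minnSS expnS (IH j); lia.
Qed.

Lemma val2_drop_le s j : val2 (drop j s) <= val2 s.
Proof. by rewrite [leqRHS](val2_drop s j); have := expn_gt0 2 (minn j (size s)); nia. Qed.

(** Horner's scheme, starting from the most significant bit. *)
Lemma foldl_rev_val2 (T : Type) (h : T -> bool -> T) (g : nat -> T) s :
  (forall (b : bool) n, h (g n) b = g (b + n.*2)) -> foldl h (g 0) (rev s) = g (val2 s).
Proof. by move=> hh; rewrite foldl_rev; elim: s => //= b s ->; rewrite hh. Qed.

(** What Horner's scheme has read after [k] steps are the high bits, whose value is at most that of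
    the string; this bounds every intermediate result. *)
Lemma take_rev_val2 (s : seq bool) k : exists2 t, take k (rev s) = rev t & val2 t <= val2 s.
Proof. by exists (drop (size s - k) s); rewrite ?take_rev // val2_drop_le. Qed.

Section Bin2.

Context {X : Type} {cX : code X}.

Lemma pt_bin_mul (f g : X -> nat) : pt (fun x => Bin (f x)) -> pt (fun x => Bin (g x)) ->
  pt (fun x => Bin (f x * g x)).
Proof.
move=> pf pg.
pose h x acc (b : bool) := Bin ((bval acc).*2 + (if b then g x else 0)).
have hE x b n : h x (Bin (n * g x)) b = Bin ((b + n.*2) * g x).
  by rewrite /h /=; congr Bin; case: b; lia.
apply: (pt_ext (f := fun x => foldl (h x) (Bin 0) (rev (binary (f x))))).
  move=> x; rewrite -[Bin 0]/(Bin (0 * g x)) (foldl_rev_val2 (g := fun n => Bin (n * g x))) //.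
  by rewrite val2_binary.
apply: pt_foldl.
- by apply: pt_rev; apply: pt_binary.
- exact: pt_const.
- rewrite /h; apply: pt_bin_add.
    apply: (pt_ext (f := fun y : X * bin * bool => Bin (false + (bval y.1.2).*2))) => //.
    by apply: pt_bin_bit; [pt_tac | apply: pt_bval; pt_tac].
  apply: (pt_ext (f := fun y : X * bin * bool => if y.2 then Bin (g y.1.1) else Bin 0)).
    by move=> [[x a] []].
  have pg' : pt (fun y : X * bin * bool => Bin (g y.1.1)).
    by apply: (pt_comp (f := fun y : X * bin * bool => y.1.1) pg); pt_tac.
  by pt_tac.
exists (fun x => ((blen (f x) + blen (g x)) * 4).+1).
  by have := pbd_blen pf; have := pbd_blen pg; move=> *; pbd_tac.
move=> x k; have [t -> ht] := take_rev_val2 (binary (f x)) k.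
rewrite -[Bin 0]/(Bin (0 * g x)) (foldl_rev_val2 (g := fun n => Bin (n * g x))) //.
apply: leq_trans (sze_bin _) _; rewrite ltnS leq_mul2r /=.
apply: leq_trans (blen_mul _ _) _; rewrite leq_add2r blen_mono //.
by rewrite -[leqRHS]val2_binary.
Qed.

(** Long division: the old remainder is below [d], so after doubling and adding a bit it contains
    [d] at most once. *)
Definition div_bit (d : nat) (y : seq bool * bin) (b : bool) : seq bool * bin :=
  let r := b + (bval y.2).*2 in
  if d <= r then (true :: y.1, Bin (r - d)) else (false :: y.1, Bin r).

Lemma div_bitP d s (y := foldl (div_bit d) ([::], Bin 0) (rev s)) : 0 < d ->
  [/\ size y.1 = size s, val2 y.1 = val2 s %/ d & bval y.2 = val2 s %% d].
Proof.
move=> d0; rewrite {}/y foldl_rev; elim: s => [|b s]; first by rewrite div0n mod0n.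
rewrite [foldr _ _ (b :: s)]/=; case: (foldr _ _ s) => q [r] /= [sq vq vr].
have e : b + (val2 s).*2 = (val2 s %/ d).*2 * d + (b + r.*2).
  by rewrite {1}(divn_eq (val2 s) d) -vr; lia.
have rd : r < d by rewrite vr ltn_mod.
rewrite /div_bit /= e; case: leqP => h /=; rewrite sq vq; split=> //.
- rewrite divnMDl //; have -> : b + r.*2 = 1 * d + (b + r.*2 - d) by lia.
  have hs : b + r.*2 - d < d by case: (b) h => /=; lia.
  by rewrite divnMDl // (divn_small hs); move: (_ %/ _) => u; lia.
- rewrite modnMDl; have {2}-> : b + r.*2 = 1 * d + (b + r.*2 - d) by lia.
  by rewrite modnMDl modn_small //; case: (b) h => /=; lia.
- by rewrite divnMDl // (divn_small h) addn0.
- by rewrite modnMDl modn_small.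
Qed.

Lemma pt_bin_divmod (f g : X -> nat) : pt (fun x => Bin (f x)) -> pt (fun x => Bin (g x)) ->
  (forall x, 0 < g x) -> pt (fun x => (Bin (f x %/ g x), Bin (f x %% g x))).
Proof.
move=> pf pg g0.
pose F x := foldl (div_bit (g x)) ([::], Bin 0) (rev (binary (f x))).
have pF : pt F.
  apply: pt_foldl.
  - by apply: pt_rev; apply: pt_binary.
  - exact: pt_const.
  - have pg' : pt (fun y : X * (seq bool * bin) * bool => Bin (g y.1.1)).
      by apply: (pt_comp (f := fun y : X * (seq bool * bin) * bool => y.1.1) pg); pt_tac.
    have pr : pt (fun y : X * (seq bool * bin) * bool => Bin (y.2 + (bval y.1.2.2).*2)).
      by apply: pt_bin_bit; [pt_tac | apply: pt_bval; pt_tac].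
    rewrite /div_bit; apply: pt_if; first exact: pt_bin_leq.
      by apply: pt_pair; [pt_tac | apply: pt_bin_sub].
    by apply: pt_pair; [pt_tac | ].
  exists (fun x => ((blen (f x) * 4).+1 + (blen (g x) * 4).+1).+1).
    by have := pbd_blen pf; have := pbd_blen pg; move=> *; pbd_tac.
  move=> x k; pose s := drop (blen (f x) - k) (binary (f x)).
  have [sq _ vr] := div_bitP s (g0 x); rewrite take_rev -/s.
  have hs : size s <= blen (f x) by rewrite size_drop leq_subr.
  case: (foldl _ _ _) sq vr => q [r] /= sq vr.
  rewrite sze_pair ltnS leq_add //.
    by have /andP[_ h] := sze_bits q; apply: leq_trans h _; lia.
  apply: leq_trans (sze_bin _) _; rewrite ltnS leq_mul2r /= blen_mono //.
  by rewrite vr ltnW // ltn_mod.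
apply: (pt_ext (f := fun x => (Bin (val2 (F x).1), Bin (bval (F x).2)))).
  by move=> x; have [_ -> ->] := div_bitP (binary (f x)) (g0 x); rewrite val2_binary.
by apply: pt_pair; [apply: pt_val2; pt_tac | apply: pt_bval; pt_tac].
Qed.

Lemma pt_bin_div (f g : X -> nat) : pt (fun x => Bin (f x)) -> pt (fun x => Bin (g x)) ->
  (forall x, 0 < g x) -> pt (fun x => Bin (f x %/ g x)).
Proof. by move=> pf pg g0; apply: (pt_fst (pt_bin_divmod pf pg g0)). Qed.

Lemma pt_bin_mod (f g : X -> nat) : pt (fun x => Bin (f x)) -> pt (fun x => Bin (g x)) ->
  (forall x, 0 < g x) -> pt (fun x => Bin (f x %% g x)).
Proof. by move=> pf pg g0; apply: (pt_snd (pt_bin_divmod pf pg g0)). Qed.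

End Bin2.

Section Bin3.

Context {X : Type} {cX : code X}.

(** The exponent is in unary, since the length of the power is linear in it. *)
Lemma pt_bin_exp (f e : X -> nat) : pt (fun x => Bin (f x)) -> pt e ->
  pt (fun x => Bin (f x ^ e x)).
Proof.
move=> pf pe.
have hE x k : iter k (fun acc => Bin (f x * bval acc)) (Bin 1) = Bin (f x ^ k).
  by elim: k => //= k ->; rewrite expnS.
apply: (pt_ext (f := fun x => iter (e x) (fun acc => Bin (f x * bval acc)) (Bin 1))) => //.
apply: pt_iter => //; first exact: pt_const.
  lazy beta; apply: pt_bin_mul; last by apply: pt_bval; pt_tac.
  by apply: (pt_comp (f := fst) pf); pt_tac.
exists (fun x => ((sze (e x) * blen (f x)).+1 * 4).+1).
  by have := pbd_blen pf; have := pt_size pe; move=> *; pbd_tac.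
move=> x k hk; rewrite hE; apply: leq_trans (sze_bin _) _; rewrite ltnS leq_mul2r /=.
by apply: leq_trans (blen_exp _ _) _; rewrite ltnS leq_mul2r sze_nat; apply/orP; right; lia.
Qed.

Lemma pt_bin_of_nat (f : X -> nat) : pt f -> pt (fun x => Bin (f x)).
Proof.
move=> pf; have hE k : iter k (fun acc => Bin (bval acc + 1)) (Bin 0) = Bin k.
  by elim: k => //= k ->; rewrite addn1.
apply: (pt_ext (f := fun x => iter (f x) (fun acc => Bin (bval acc + 1)) (Bin 0))).
  by move=> x; rewrite hE.
apply: pt_iter => //; first exact: pt_const.
  by lazy beta; apply: pt_bin_add; [apply: pt_bval; pt_tac | exact: pt_const].
exists (fun x => (sze (f x) * 4).+1); first by have := pt_size pf; move=> *; pbd_tac.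
move=> x k hk; rewrite hE; apply: leq_trans (sze_bin _) _; rewrite ltnS leq_mul2r /= sze_nat.
by apply: leq_trans (blen_le k) _; lia.
Qed.

End Bin3.

(** * From bit strings to trees and back *)

(** In the serialised list a true bit reads 1100, a false bit 10 and the end 0; they are pushed
    backwards. *)
Definition raw_to_code : cmd :=
  Seq (mv 0 1) (Seq (Push 0 false)
    (Loop 1 (Seq (Push 0 false) (Push 0 true))
       (Seq (Push 0 false) (Seq (Push 0 false) (Seq (Push 0 true) (Push 0 true)))))).

Lemma runs_raw_to_code O st x : st 0 = x -> empty_from 1 st ->
  runs O raw_to_code st (20 * size x + 20) (upd st 0 (ser (enc x))).
Proof.
move=> e0 e1.
have loop l s (z : store) : z 1 = l -> z 0 = ser (enc s) ->
    runs O (Loop 1 (Seq (Push 0 false) (Push 0 true))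
       (Seq (Push 0 false) (Seq (Push 0 false) (Seq (Push 0 true) (Push 0 true))))) z
      (9 * size l).+1 (upd (upd z 0 (ser (enc (catrev l s)))) 1 [::]).
  elim: l s z => [|b l IH] s z z1 z0.
    by apply: runs_eq (runs_loop_nil _ _ _ z1) _; store_eq.
  apply: (runs_le (T := (8 + (9 * size l).+1).+1)); last by rewrite /=; lia.
  apply: (runs_loop_cons (st1 := upd (upd z 1 l) 0 (ser (enc (b :: s)))) z1).
    case: b {z1}.
      apply: runs_eq; first by do 3 (apply: runs_seq (runs_push _ _ _ _) _); apply: runs_push.
      by store_eq; rewrite z0.
    apply: (runs_le (T := 2 + 2)) => //.
    apply: runs_eq; first by do 1 (apply: runs_seq (runs_push _ _ _ _) _); apply: runs_push.
    by store_eq; rewrite z0.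
  by apply: runs_eq; [apply: (IH (b :: s)) | store_eq].
apply: (runs_le (T := (3 * size x).+1 + (2 + (9 * size x).+1))); last by lia.
apply: runs_seq; first (apply: runs_le; first exact: runs_mv); first by rewrite e0.
apply: runs_seq (runs_push _ _ _ _) _.
apply: runs_eq; first (apply: runs_le; first apply: (loop (rev x) [::])).
- by rewrite /upd /= e0 e1.
- by rewrite /upd /=.
- by rewrite size_rev.
by rewrite -/(rev _) revK; store_eq; rewrite e1.
Qed.

Definition code_to_raw : cmd :=
  Seq (Loop 0 Skip (Pop 0 Skip (Push 1 false) (Pop 0 Skip (Pop 0 Skip (Push 1 true) Skip) Skip)))
    (mv 1 0).

Lemma runs_code_to_raw O st x : st 0 = ser (enc x) -> empty_from 1 st ->
  runs O code_to_raw st (20 * size x + 20) (upd st 0 x).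
Proof.
move=> e0 e1.
have loop l s (z : store) : z 0 = ser (enc l) -> z 1 = s ->
    runs O (Loop 0 Skip (Pop 0 Skip (Push 1 false)
      (Pop 0 Skip (Pop 0 Skip (Push 1 true) Skip) Skip))) z
      (7 * size l).+3 (upd (upd z 0 [::]) 1 (catrev l s)).
  elim: l s z => [|b l IH] s z z0 z1.
    apply: (runs_le (T := (1 + 1).+1)) => //.
    apply: (runs_loop_cons (st1 := upd z 0 [::]) z0); first exact: runs_skip.
    apply: runs_eq; first by apply: runs_loop_nil.
    by store_eq.
  apply: (runs_le (T := (5 + (7 * size l).+3).+1)); last by rewrite /=; lia.
  have z0' : z 0 = true :: (if b then [:: true; false; false] else [:: false]) ++ ser (enc l).
    by rewrite z0; case: (b).
  apply: (runs_loop_cons (st1 := upd (upd z 0 (ser (enc l))) 1 (b :: s)) z0').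
    case: b {z0 z0'} => /=.
      apply: runs_pop_cons => //=; apply: runs_pop_cons => //=; apply: runs_pop_cons => //=.
      by apply: runs_eq (runs_push _ _ _ _) _; store_eq; rewrite z1.
    apply: (runs_le (T := 3)) => //; apply: runs_pop_cons => //=.
    by apply: runs_eq (runs_push _ _ _ _) _; store_eq; rewrite z1.
  by apply: runs_eq; [apply: (IH (b :: s)) | store_eq].
apply: (runs_le (T := (7 * size x).+3 + (3 * size x).+1)); last by lia.
apply: runs_seq; first exact: loop e0 (e1 1 isT).
apply: runs_eq; first (apply: runs_le; first exact: runs_mv).
  by rewrite /upd /= -/(rev _) size_rev.
apply: functional_extensionality => i; rewrite /upd /=.
by case: i => [|[|i]] //=; rewrite ?e1 // -/(rev _) -/(rev _) revK.
Qed.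

Lemma pbd_sze_bits (T : seq bool -> nat) : pbd sze T -> pbd size T.
Proof.
move=> h; apply: pbd_comp h _; apply: pbd_le (_ : pbd size (fun x => (size x * 4).+1)); last by pbd_tac.
by move=> x; have /andP[] := sze_bits x.
Qed.

Lemma pbd_size_bits {A : Type} {cA : code A} (f : A -> seq bool) :
  pbd sze (fun x => sze (f x)) -> pbd sze (fun x => size (f x)).
Proof.
apply: pbd_le => x; have /andP[h _] := sze_bits (f x); lia.
Qed.

Definition raw_computes (c : cmd) (T : seq bool -> nat) (f : seq bool -> seq bool) : Prop :=
  forall O x st, st 0 = x -> empty_from 1 st -> runs O c st (T x) (upd st 0 (f x)).

Lemma raw_of_pt (f : seq bool -> seq bool) : pt f ->
  exists c T, [/\ qfree c, pbd size T & raw_computes c T f].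
Proof.
move=> pf; have szf := pbd_size_bits (pt_size pf); have [c [T [qc hT _ h]]] := pf.
exists (Seq raw_to_code (Seq c code_to_raw)).
exists (fun x => 20 * size x + 20 + (T x + (20 * size (f x) + 20))).
split; first by rewrite /= qc.
  by move: hT szf => /pbd_sze_bits hT /pbd_sze_bits szf; pbd_tac.
move=> O x st e0 e1; apply: runs_seq; first exact: runs_raw_to_code e0 e1.
apply: runs_seq; first apply: (h _ x) => //.
  by move=> i hi; rewrite /upd; case: eqP => [?|_]; [lia | apply: e1].
apply: runs_eq; first apply: (@runs_code_to_raw O _ (f x)) => //.
  by move=> i hi; rewrite /upd; repeat (case: eqP => [?|_]; first lia); apply: e1.
by store_eq.
Qed.

Lemma polytime_of_pt (f : seq bool -> seq bool) : pt f -> polytime f.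
Proof.
move=> /raw_of_pt[c [T [qc hT h]]]; apply: (polytime_of_cmd qc hT) => O x.
exists (upd (input x) 0 (f x)) => //; apply: h => //.
by move=> [|i].
Qed.

(** Doubled bits agree, so the first unequal pair is the end mark of the first component. *)
Definition unpair (s : seq bool) : seq bool * seq bool :=
  let k := index false [seq nth false s (2 * i) == nth false s (2 * i).+1 | i <- iota 0 (size s)] in
  ([seq nth false s (2 * i) | i <- iota 0 k], drop (2 * k).+2 s).

Lemma pair_codeK x w : unpair (pair_code x w) = (x, w).
Proof.
set s := pair_code x w.
have pc_cons b y : pair_code (b :: y) w = b :: b :: pair_code y w by [].
have nx i : i < size x -> nth false s (2 * i) = nth false x i /\ nth false s (2 * i).+1 = nth false x i.
  rewrite /s; elim: x i {s} => [//|b x IH] [|i] hi //.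
  by rewrite pc_cons mulnS add2n; exact: IH i hi.
have nk : nth false s (2 * size x) = false /\ nth false s (2 * size x).+1 = true.
  rewrite /s; elim: x {s nx} => [//|b x IH].
  by rewrite pc_cons [size _]/= mulnS add2n.
have ds : drop (2 * size x).+2 s = w.
  rewrite /s; elim: x {s nx nk} => [|b x IH]; first by rewrite /= drop0.
  by rewrite pc_cons [size _]/= mulnS add2n.
have ks : size x < size s.
  rewrite /s; elim: x {s nx nk ds} => [//|b x IH].
  by rewrite pc_cons /=; lia.
rewrite /unpair; set k := index _ _.
have -> : k = size x.
  rewrite /k; have -> : size s = size x + (size s - size x).-1.+1 by lia.
  rewrite iotaD map_cat index_cat ifN; last first.
    apply/mapP => -[i]; rewrite mem_iota => /andP[_ hi].
    by have [-> ->] := nx i hi; rewrite eqxx.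
  rewrite size_map size_iota [iota _ _.+1]/= map_cons /= add0n.
  by have [-> ->] := nk; rewrite eqxx addn0.
rewrite ds; congr pair; apply: (@eq_from_nth _ false); rewrite size_map size_iota // => i hi.
by rewrite (nth_map 0) ?size_iota // nth_iota // add0n; have [] := nx i hi.
Qed.

Lemma pt_unpair : pt unpair.
Proof. by rewrite /unpair; pt_tac. Qed.

(* Registers: the input is kept on [1], the answer of the oracle is on the last. *)
Definition reduction_cmd (K : nat) (cpre cpost : cmd) : cmd :=
  Seq (copy 0 1 2) (Seq cpre (Seq (mv 0 2) (Seq (mv 2 K) (Seq (Query K)
  (Seq (mv K 2) (Seq (mv 2 0) (Seq (Push 0 true) (Seq (Push 0 false) (Seq (mv 1 2)
  (Seq (Loop 2 (Seq (Push 0 false) (Push 0 false)) (Seq (Push 0 true) (Push 0 true))) cpost)))))))))).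

Lemma runs_doubling O l (z : store) : z 2 = l ->
  runs O (Loop 2 (Seq (Push 0 false) (Push 0 false)) (Seq (Push 0 true) (Push 0 true))) z
    (5 * size l).+1
    (upd (upd z 0 (flatten [seq [:: b; b] | b <- rev l] ++ z 0)) 2 [::]).
Proof.
elim: l z => [|b l IH] z z2.
  by apply: runs_eq (runs_loop_nil _ _ _ z2) _; store_eq.
apply: (runs_le (T := (4 + (5 * size l).+1).+1)); last by rewrite /=; lia.
apply: (runs_loop_cons (st1 := upd (upd z 2 l) 0 (b :: b :: z 0)) z2).
  case: b {z2}; apply: runs_eq; try (apply: runs_seq (runs_push _ _ _ _) _; apply: runs_push); by store_eq.
apply: runs_eq; first exact: IH.
by store_eq; rewrite rev_cons map_rcons flatten_rcons -catA.
Qed.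

(** A single query suffices: [pre] prepares it and [post] treats the answer together with the input.
    The time of [post] is polynomial in the length of the answer, whence the bound on that
    length. *)
Lemma polytime_oracle_of_pt (O : seq bool -> seq bool) (pre : seq bool -> seq bool)
    (post : seq bool * seq bool -> seq bool) : pt pre -> pt post ->
  pbd size (fun x => size (O (pre x))) ->
  polytime_oracle O (fun x => post (x, O (pre x))).
Proof.
move=> ppre ppost hO.
have ppost' : pt (fun s => post (unpair s)) by apply: pt_comp ppost pt_unpair.
have szpre := pbd_sze_bits (pbd_size_bits (pt_size ppre)).
have [c0 [T0 [q0 hT0 h0]]] := raw_of_pt ppre.
have [c2 [T2 [q2 hT2 h2]]] := raw_of_pt ppost'.
pose c0' := ren (shift_regs 0 2) c0.
(* The query register is the last tape, above every register of the two programs; registers 0 to 2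
   are taken by the driver. *)
pose K := maxn 3 (maxn (maxreg c0') (maxreg c2)).+1.
have K3 : 3 <= K by rewrite leq_maxl.
have [M0 M2] : maxreg c0' <= K /\ maxreg c2 <= K by rewrite /K; lia.
pose pc x := pair_code x (O (pre x)).
pose T x := 8 * size x + 2 + (T0 x + ((3 * size (pre x)).+1 + ((3 * size (pre x)).+1 + (1 +
  ((3 * size (O (pre x))).+1 + ((3 * size (O (pre x))).+1 + (2 + (2 + ((3 * size x).+1 +
  ((5 * size x).+1 + T2 (pc x))))))))))).
have hr : regs_le K (reduction_cmd K c0' c2).
  have r0 : regs_le K c0' by apply: regs_le_maxreg; rewrite // /c0' qfree_ren.
  have r2 : regs_le K c2 by apply: regs_le_maxreg.
  by rewrite /= r0 r2 eqxx !leqnn (ltnW (ltnW K3)) (ltnW K3).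
apply: (@polytime_oracle_of_cmd _ (reduction_cmd K c0' c2) K _ T).
- exact: hr.
- have hpc : pbd size (fun x => size (pc x)).
    apply: pbd_le (_ : pbd size (fun x => 2 * size x + 2 + size (O (pre x)))); last by pbd_tac.
    move=> x; rewrite /pc /pair_code !size_cat /=.
    have -> : size (flatten [seq [:: b; b] | b <- x]) = 2 * size x by elim: x => //= b x ->; lia.
    by lia.
  by rewrite /T; pbd_tac; apply: pbd_comp hT2 hpc.
move=> x; exists (upd (upd (input x) 0 (post (x, O (pre x)))) 1 [::]) => //.
pose S4 a b c d : store := fun i =>
  if i == 0 then a else if i == 1 then b else if i == 2 then c else if i == K then d else [::].
have S0 a b c d : S4 a b c d 0 = a by [].
have S1 a b c d : S4 a b c d 1 = b by [].
have S2 a b c d : S4 a b c d 2 = c by [].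
have [K0 K1 K2] : [/\ K <> 0, K <> 1 & K <> 2] by split; lia.
have SK a b c d : S4 a b c d K = d by rewrite /S4; repeat case: eqP => //.
have U0 a b c d e : upd (S4 a b c d) 0 e = S4 e b c d by rewrite /S4; store_eq.
have U1 a b c d e : upd (S4 a b c d) 1 e = S4 a e c d by rewrite /S4; store_eq.
have U2 a b c d e : upd (S4 a b c d) 2 e = S4 a b e d by rewrite /S4; store_eq.
have UK a b c d e : upd (S4 a b c d) K e = S4 a b c e by rewrite /S4; store_eq.
have -> : input x = S4 x [::] [::] [::] by rewrite /S4 /input; store_eq.
have rK (l : seq bool) : catrev (catrev l [::]) [::] = l by rewrite -/(rev _) revK.
apply: runs_seq; first exact: runs_copy.
rewrite S0 U1; apply: runs_seq; first apply: (runs_shift (x := x) (y := pre x)) => //.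
- by move=> st; apply: h0.
- by move=> [|[|i]] // _; rewrite /S4 /= ?if_same.
rewrite U0; apply: runs_seq; first exact: runs_mv.
rewrite S0 U2 U0 S2; apply: runs_seq; first (apply: runs_le; first apply: runs_mv).
- by apply/eqP => /esym.
- by rewrite S2 -/(rev _) size_rev.
rewrite S2 SK UK U2 rK; apply: runs_seq; first by exists 1 => //; constructor.
rewrite SK UK; apply: runs_seq; first (apply: runs_le; first apply: runs_mv).
- exact/eqP.
- by rewrite SK.
rewrite SK S2 U2 UK; apply: runs_seq; first (apply: runs_le; first apply: runs_mv) => //.
- by rewrite S2 -/(rev _) size_rev.
rewrite S2 S0 U0 U2 rK; apply: runs_seq (runs_push _ _ _ _) _.
rewrite S0 U0; apply: runs_seq (runs_push _ _ _ _) _.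
rewrite S0 U0; apply: runs_seq; first exact: runs_mv.
rewrite S1 S2 U2 U1; apply: runs_seq; first (apply: runs_le; first apply: (@runs_doubling O (rev x))) => //.
- by rewrite size_rev.
rewrite revK S0 U0 U2.
apply: runs_eq; first apply: (h2 _ (pc x)) => //.
- by move=> [|[|[|i]]] // _; rewrite /S4 /= ?if_same.
by rewrite !U0 U1 /pc pair_codeK.
Qed.

(** * Recognizing encodings *)

Ltac pt_user ::= fail.
Ltac pt_user2 ::= fail.
Ltac pt_user3 ::= fail.

Definition chunks {A : Type} (n k : nat) (s : seq A) : seq (seq A) :=
  [seq take n (drop (i * n) s) | i <- iota 0 k].

Lemma chunksK (A : Type) n (rs : seq (seq A)) t : all (fun r => size r == n) rs ->
  chunks n (size rs) (flatten rs ++ t) = rs.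
Proof.
rewrite /chunks; elim: rs => //= r rs IH /andP[/eqP sr hrs].
rewrite mul0n drop0 -catA take_size_cat //; congr (_ :: _).
rewrite -[RHS]IH // (iotaDl 1 0) -map_comp; apply: eq_map => i /=.
by rewrite add1n mulSn addnC -drop_drop drop_size_cat.
Qed.

Definition nvertices (x : seq bool) : nat := index false x.
Definition nedges (x : seq bool) : nat := index false (drop (nvertices x).+1 x).
Definition rows (x : seq bool) : seq (seq bool) :=
  chunks (nvertices x) (nedges x) (drop (nedges x).+1 (drop (nvertices x).+1 x)).

Definition row_degree (rs : seq (seq bool)) (i : nat) : nat := count (fun r => nth false r i) rs.

(** The parsers are total and return something on any string; re-encoding in the first conjunct
    rejects the strings that are no encodings. The last disjunction says that the maximum is
    attained, the maximum over no vertex being 0. *)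
Definition valid (m Delta : nat) (x : seq bool) : bool :=
  let n := nvertices x in let rs := rows x in
  [&& x == nseq n true ++ false :: nseq (nedges x) true ++ false :: flatten rs,
      all (fun r => (size r == n) && (count (fun b : bool => b) r == m)) rs,
      all (fun i => all (fun j => (i == j) || ~~ (nth [::] rs i == nth [::] rs j)) (iota 0 (nedges x)))
        (iota 0 (nedges x)),
      all (fun i => row_degree rs i <= Delta) (iota 0 n)
    & (Delta == 0) || has (fun i => row_degree rs i == Delta) (iota 0 n)].

Definition row_of (n : nat) (e : {set 'I_n}) : seq bool := [seq i \in e | i <- enum 'I_n].
Definition set_of_row (n : nat) (r : seq bool) : {set 'I_n} := [set i : 'I_n | nth false r i].

Lemma size_row n (e : {set 'I_n}) : size (row_of e) = n.
Proof. by rewrite size_map size_enum_ord. Qed.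

Lemma nth_row n (e : {set 'I_n}) (i : 'I_n) : nth false (row_of e) i = (i \in e).
Proof. by rewrite (nth_map i) ?size_enum_ord // nth_ord_enum. Qed.

Lemma row_ofK n : cancel (@row_of n) (@set_of_row n).
Proof. by move=> e; apply/setP => i; rewrite inE nth_row. Qed.

Lemma set_of_rowK n r : size r = n -> row_of (set_of_row n r) = r.
Proof.
move=> sr; apply: (@eq_from_nth _ false); rewrite size_row // => i hi.
by rewrite (nth_row _ (Ordinal hi)) inE.
Qed.

Lemma count_row n (e : {set 'I_n}) : count (fun b : bool => b) (row_of e) = #|e|.
Proof. by rewrite count_map -sum1_count -sum1_card big_enum_cond; apply: eq_bigl. Qed.

Lemma parse_encode n (s : seq {set 'I_n}) :
  [/\ nvertices (encode s) = n, nedges (encode s) = size s & rows (encode s) = map (@row_of n) s].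
Proof.
have idx a t : index false (nseq a true ++ false :: t) = a.
  by rewrite index_cat mem_nseq andbF size_nseq /= addn0.
have drp a t : drop a.+1 (nseq a true ++ false :: t) = t.
  by rewrite -cat_rcons drop_size_cat // size_rcons size_nseq.
have e1 : nvertices (encode s) = n by apply: idx.
have e2 : nedges (encode s) = size s by rewrite /nedges e1 /encode drp idx.
rewrite /rows e1 e2 /encode !drp; split=> //.
rewrite -(size_map (@row_of n)) -[flatten _]cats0 chunksK //.
by apply/allP => r /mapP[e _ ->]; rewrite size_row.
Qed.

Lemma row_degreeE n (s : seq {set 'I_n}) (i : 'I_n) : uniq s ->
  row_degree (map (@row_of n) s) i = degree [set:: s] i.
Proof.
move=> us; rewrite /degree /row_degree count_map -size_filter.
rewrite (eq_filter (a2 := fun e : {set 'I_n} => i \in e)); last by move=> e; apply: nth_row.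
rewrite -(card_uniqP (filter_uniq _ us)).
by apply: eq_card => e; rewrite !inE mem_filter andbC.
Qed.

Lemma hclass_rows m D n (s : seq {set 'I_n}) : uniq s -> hclass [set:: s] m D =
  [&& all (fun r => count (fun b : bool => b) r == m) (map (@row_of n) s),
      all (fun i => row_degree (map (@row_of n) s) i <= D) (iota 0 n)
    & (D == 0) || has (fun i => row_degree (map (@row_of n) s) i == D) (iota 0 n)].
Proof.
move=> us; rewrite /hclass andbA; congr (_ && _).
  rewrite all_map; apply/andP/allP => [[hu /andP[hmin hex]] e ee /=|h].
    rewrite count_row; have s0 : [set:: s] != set0 by apply/set0Pn; exists e; rewrite inE.
    move: hex; rewrite s0 /= => /existsP[f /andP[fE /eqP <-]].
    by move/forallP/(_ e): hu; rewrite inE ee /= => /forallP/(_ f); rewrite fE.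
  have hc e : e \in [set:: s] -> #|e| = m by rewrite inE => /h /=; rewrite count_row => /eqP.
  split; first by apply/forallP => e; apply/implyP => ee; apply/forallP => f; apply/implyP => fe; rewrite !hc.
  apply/andP; split; first by apply/forallP => e; apply/implyP => ee; rewrite hc.
  by apply/implyP => /set0Pn[e ee]; apply/existsP; exists e; rewrite ee hc ?eqxx.
apply/eqP/andP => [e|[/allP hle hD]].
  split; first by apply/allP => i; rewrite mem_iota => hi; rewrite (row_degreeE (Ordinal hi) us) -e leq_bigmax.
  case: posnP => //= D0; rewrite -e in D0 *.
  have [i0 _] : exists i0 : 'I_n, true.
    case: n s us e D0 => [|n'] s us e; last by exists ord0.
    by rewrite /max_degree big_ord0.
  have [i hi] := @eq_bigmax _ (fun i => degree [set:: s] i) (ltac:(by apply/card_gt0P; exists i0)).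
  by apply/hasP; exists (val i); rewrite ?mem_iota ?ltn_ord // row_degreeE // -hi.
apply/eqP; rewrite eqn_leq; apply/andP; split.
  by apply/bigmax_leqP => i _; rewrite -row_degreeE // hle // mem_iota ltn_ord.
case/orP: hD => [/eqP -> //|/hasP[i]]; rewrite mem_iota => hi /eqP <-.
by rewrite (row_degreeE (Ordinal hi) us) leq_bigmax.
Qed.

Lemma uniq_nth (T : eqType) (x0 : T) (s : seq T) :
  all (fun i => all (fun j => (i == j) || ~~ (nth x0 s i == nth x0 s j)) (iota 0 (size s)))
    (iota 0 (size s)) = uniq s.
Proof.
apply/allP/(uniqP x0) => [h i j|h i].
  rewrite !inE => hi hj e; apply/eqP; have := h i; rewrite mem_iota => /(_ hi)/allP/(_ j).
  by rewrite mem_iota e eqxx orbF => /(_ hj).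
rewrite mem_iota => hi; apply/allP => j; rewrite mem_iota => hj.
by case: eqP => //= ij; apply/eqP => e; apply: ij; apply: h.
Qed.

Definition edges_of (x : seq bool) : seq {set 'I_(nvertices x)} :=
  map (@set_of_row (nvertices x)) (rows x).

Lemma validP m D x : valid m D x ->
  [/\ encode (edges_of x) = x, uniq (edges_of x), hclass [set:: edges_of x] m D
    & rows x = map (@row_of _) (edges_of x)].
Proof.
move=> /and5P[/eqP e hr hu hd1 hd2].
have sk : size (rows x) = nedges x by rewrite size_map size_iota.
have eR : rows x = map (@row_of _) (edges_of x).
  rewrite -map_comp -[LHS]map_id; apply/eq_in_map => r /(allP hr)/andP[/eqP sr _] /=.
  by rewrite set_of_rowK.
have us : uniq (edges_of x).
  rewrite -(map_inj_uniq (can_inj (@row_ofK (nvertices x)))) -eR.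
  by rewrite -(uniq_nth [::]) sk.
split=> //.
  by rewrite [RHS]e /encode size_map sk; congr (_ ++ _ :: _ ++ _ :: flatten _); rewrite [RHS]eR.
rewrite hclass_rows // -eR hd1 hd2 /= andbT.
by apply: sub_all hr => r /andP[].
Qed.

(** Replaces the choice of an edge set by a test that a program can carry out, with [edges_of x] as
    the only candidate. *)
Lemma count_valid m D q x :
  count_colourings m D q x = if valid m D x then num_colourings [set:: edges_of x] q else 0.
Proof.
case: ifP => [/validP[e us hc _]|hv].
  by rewrite -[in LHS]e count_colourings_encode.
rewrite /count_colourings /count_colourings_on; case: pickP => // E /andP[hE /existsP[[s /= sz] /andP[/eqP sE /eqP ex]]].
case/negP: hv; rewrite /valid -/(nvertices x).
have [e1 e2 e3] := parse_encode s; rewrite ex in e1 e2 e3.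
have us : uniq s by apply/card_uniqP; rewrite -cardsE sE (eqP sz).
have su : size (map (@row_of _) s) = nedges x by rewrite size_map e2.
rewrite e3 -su uniq_nth (map_inj_uniq (can_inj (@row_ofK _))) us /=.
have : hclass [set:: s] m D by rewrite sE.
rewrite hclass_rows // => /and3P[h1 -> ->]; rewrite !andbT.
apply/andP; split; first by rewrite -[X in X == _]ex su e2.
apply/allP => r hr; rewrite (allP h1) // andbT; case/mapP: hr => e _ ->.
by rewrite size_row.
Qed.

Section Pt.

Context {X : Type} {cX : code X}.

Lemma pt_nvertices (x : X -> seq bool) : pt x -> pt (fun y => nvertices (x y)).
Proof. by move=> px; rewrite /nvertices; pt_tac. Qed.

Lemma pt_nedges (x : X -> seq bool) : pt x -> pt (fun y => nedges (x y)).
Proof. by move=> px; rewrite /nedges /nvertices; pt_tac. Qed.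

Lemma pt_chunks {A : Type} {cA : code A} (n k : X -> nat) (s : X -> seq A) : pt n -> pt k -> pt s ->
  pt (fun y => chunks (n y) (k y) (s y)).
Proof. by move=> pn pk ps; rewrite /chunks; pt_tac. Qed.

End Pt.

Ltac pt_user ::= first [ apply: pt_nvertices | apply: pt_nedges | apply: pt_chunks | apply: pt_eqseq ].

Lemma pt_rows {X : Type} {cX : code X} (x : X -> seq bool) : pt x -> pt (fun y => rows (x y)).
Proof. by move=> px; rewrite /rows; pt_tac. Qed.

Ltac pt_user2 ::= apply: pt_rows.

Lemma pt_valid {X : Type} {cX : code X} m D (x : X -> seq bool) : pt x ->
  pt (fun y => valid m D (x y)).
Proof. by move=> px; rewrite /valid /row_degree; pt_tac. Qed.

(** * Membership *)

Definition unary_block (q v : nat) : seq bool := [seq a == v | a <- iota 0 q].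

(** The length of a witness may depend on [size x] only. As there are at most [size x] vertices,
    their one-hot colours are padded with zeros to q times that length. *)
Definition wit (q l : nat) (cs : seq nat) : seq bool :=
  flatten [seq unary_block q v | v <- cs] ++ nseq (q * (l - size cs)) false.

Definition colours_of (q n : nat) (w : seq bool) : seq nat :=
  [seq index true b | b <- chunks q n w].

Definition bichromatic (cs : seq nat) (r : seq bool) : bool :=
  has (fun i => has (fun j => [&& nth false r i, nth false r j & nth 0 cs i != nth 0 cs j])
    (iota 0 (size r))) (iota 0 (size r)).

(** Comparing [w] with the witness rebuilt from its colours leaves exactly one witness for each
    colouring, as counting demands. *)
Definition verifier (m D q : nat) (z : seq bool) : bool :=
  let x := (unpair z).1 in let w := (unpair z).2 in
  let cs := colours_of q (nvertices x) w in
  [&& valid m D x, all (fun v => v < q) cs, w == wit q (size x) cs & all (bichromatic cs) (rows x)].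

Lemma size_unary_block q v : size (unary_block q v) = q.
Proof. by rewrite size_map size_iota. Qed.

Lemma index_unary_block q v : v < q -> index true (unary_block q v) = v.
Proof.
move=> vq; have -> : unary_block q v = map (pred1 v) (iota 0 q) by [].
have -> : index true (map (pred1 v) (iota 0 q)) = index v (iota 0 q).
  by elim: (iota 0 q) => //= a s IH; rewrite IH; case: (a == v).
by rewrite -[X in index X _](nth_iota 0 0 vq) ?index_uniq ?size_iota ?iota_uniq ?add0n.
Qed.

Lemma colours_ofK q l cs : all (fun v => v < q) cs -> colours_of q (size cs) (wit q l cs) = cs.
Proof.
move=> hc; rewrite /colours_of /wit -{1}(size_map (unary_block q)) chunksK; last first.
  by apply/allP => b /mapP[v _ ->]; rewrite size_unary_block.
rewrite -map_comp -[RHS]map_id; apply/eq_in_map => v /(allP hc).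
exact: index_unary_block.
Qed.

Lemma size_wit q l cs : size cs <= l -> size (wit q l cs) = q * l.
Proof.
move=> h; rewrite size_cat size_nseq.
have -> : size (flatten [seq unary_block q v | v <- cs]) = q * size cs.
  by elim: cs {h} => [|v cs IH]; rewrite ?muln0 //= size_cat size_unary_block IH mulnS.
by rewrite -mulnDr subnKC.
Qed.

Definition colour_seq n q (c : {ffun 'I_n -> 'I_q}) : seq nat := [seq val (c i) | i <- enum 'I_n].

Lemma size_colour_seq n q (c : {ffun 'I_n -> 'I_q}) : size (colour_seq c) = n.
Proof. by rewrite size_map size_enum_ord. Qed.

Lemma nth_colour_seq n q (c : {ffun 'I_n -> 'I_q}) (i : 'I_n) : nth 0 (colour_seq c) i = c i.
Proof. by rewrite (nth_map i) ?size_enum_ord // nth_ord_enum. Qed.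

Lemma colour_seq_inj n q : injective (@colour_seq n q).
Proof.
move=> c d e; apply/ffunP => i; apply: val_inj.
by rewrite /= -!nth_colour_seq e.
Qed.

Lemma colour_seq_lt n q (c : {ffun 'I_n -> 'I_q}) : all (fun v => v < q) (colour_seq c).
Proof. by apply/allP => v /mapP[i _ ->]; apply: ltn_ord. Qed.

Lemma colour_seq_onto n q (cs : seq nat) : size cs = n -> all (fun v => v < q) cs ->
  exists c : {ffun 'I_n -> 'I_q}, colour_seq c = cs.
Proof.
move=> sc hc; have lt (i : 'I_n) : nth 0 cs i < q.
  by apply: (allP hc); rewrite mem_nth // sc.
exists [ffun i => Ordinal (lt i)]; apply: (@eq_from_nth _ 0); rewrite size_colour_seq // => i hi.
by rewrite (nth_colour_seq _ (Ordinal hi)) ffunE.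
Qed.

Lemma bichromatic_row n q (c : {ffun 'I_n -> 'I_q}) (e : {set 'I_n}) :
  bichromatic (colour_seq c) (row_of e) = ~~ monochromatic c e.
Proof.
rewrite /bichromatic size_row; apply/hasP/idP.
  move=> [i]; rewrite mem_iota => hi /hasP[j]; rewrite mem_iota => hj /and3P[].
  rewrite (nth_row _ (Ordinal hi)) (nth_row _ (Ordinal hj)).
  rewrite (nth_colour_seq _ (Ordinal hi)) (nth_colour_seq _ (Ordinal hj)) => ie je ne.
  apply/negP => /forallP/(_ (Ordinal hi)); rewrite ie => /forallP/(_ (Ordinal hj)).
  by rewrite je => /eqP e2; rewrite e2 eqxx in ne.
rewrite /monochromatic negb_forall => /existsP[u]; rewrite negb_imply => /andP[ue].
rewrite negb_forall => /existsP[v]; rewrite negb_imply => /andP[ve ne].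
exists (val u); first by rewrite mem_iota ltn_ord.
apply/hasP; exists (val v); first by rewrite mem_iota ltn_ord.
by rewrite !nth_row !nth_colour_seq ue ve ne.
Qed.

Section Pt.

Context {X : Type} {cX : code X}.

Lemma pt_index_true (s : X -> seq bool) : pt s -> pt (fun x => index true (s x)).
Proof.
move=> ps; apply: (pt_ext (f := fun x => index false [seq ~~ b | b <- s x])); last by pt_tac.
by move=> x; elim: (s x) => //= -[] s' ->.
Qed.

Lemma pt_wit q (l : X -> nat) (cs : X -> seq nat) : pt l -> pt cs ->
  pt (fun x => wit q (l x) (cs x)).
Proof. by move=> pl pc; rewrite /wit /unary_block; pt_tac. Qed.

Lemma pt_bichromatic (cs : X -> seq nat) (r : X -> seq bool) : pt cs -> pt r ->
  pt (fun x => bichromatic (cs x) (r x)).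
Proof. by move=> pc pr; rewrite /bichromatic; pt_tac. Qed.

End Pt.

Ltac pt_user3 ::= first
  [ apply: pt_valid | apply: pt_index_true | apply: pt_wit | apply: pt_bichromatic ].

Lemma pt_colours_of {X : Type} {cX : code X} q (n : X -> nat) (w : X -> seq bool) : pt n -> pt w ->
  pt (fun x => colours_of q (n x) (w x)).
Proof. by move=> pn pw; rewrite /colours_of; pt_tac. Qed.

Lemma pt_verifier m D q : pt (verifier m D q).
Proof.
have pu := pt_unpair.
have pc : pt (fun z => colours_of q (nvertices (unpair z).1) (unpair z).2).
  by apply: pt_colours_of; pt_tac.
by rewrite /verifier; pt_tac; exact: (pt_comp pc (pt_fst pt_id)).
Qed.

Lemma sharpP_count m D q : sharpP (count_colourings m D q).
Proof.
exists (q%:P * 'X)%R, (verifier m D q); split.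
  apply: polytime_of_pt; apply: pt_cons; last exact: pt_const.
  exact: pt_verifier.
move=> x; have -> : ((q%:P * 'X).[size x] = q * size x)%R by rewrite hornerM hornerC hornerX.
rewrite count_valid; case: ifP => hv; last first.
  apply/esym/eqP; rewrite cards_eq0; apply/eqP/setP => w; rewrite !inE.
  by rewrite /verifier pair_codeK hv.
have [ex us hc eR] := validP hv; set n := nvertices x.
have nx : n <= size x by apply: index_size.
have sw (c : {ffun 'I_n -> 'I_q}) : size (wit q (size x) (colour_seq c)) == q * size x.
  by rewrite size_wit // size_colour_seq.
pose W (c : {ffun 'I_n -> 'I_q}) : (q * size x).-tuple bool := Tuple (sw c).
have Winj : injective W.
  move=> c d /(congr1 val) /= e; apply: colour_seq_inj.
  rewrite -(colours_ofK (size x) (colour_seq_lt c)) -(colours_ofK (size x) (colour_seq_lt d)).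
  by rewrite e !size_colour_seq.
have bi (c : {ffun 'I_n -> 'I_q}) :
    all (bichromatic (colour_seq c)) (rows x) = colouring [set:: edges_of x] c.
  rewrite eR all_map; apply/allP/forallP => [h e|h e ee].
    by apply/implyP; rewrite inE => /h /=; rewrite bichromatic_row.
  by rewrite /= bichromatic_row; have := h e; rewrite inE ee.
rewrite /num_colourings -(card_imset _ Winj); apply: eq_card => w; rewrite !inE.
rewrite /verifier pair_codeK hv /= -/n; apply/imsetP/and3P.
  move=> [c]; rewrite inE => hcc ->; rewrite /= -[n in colours_of _ n](size_colour_seq c).
  by rewrite colours_ofK ?colour_seq_lt // eqxx bi.
move=> [h1 /eqP h2 h3].
have [|c cE] := @colour_seq_onto n q (colours_of q n w) _ h1; first by rewrite !size_map size_iota.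
exists c; first by rewrite inE -bi cE.
by apply: val_inj; rewrite /= cE.
Qed.

Import GRing.Theory.

(** * Hypergraphs built one edge at a time *)

(* An edge, with the number of the vertices that are created with it. *)
Definition op := (seq nat * nat)%type.

(** A chain of [r] edges: each contains the current open vertex and [w] new ones, the first of which
    is the next open vertex. *)
Fixpoint path_ops (w r v n : nat) : seq op :=
  if r is r'.+1 then (v :: iota n w, w) :: path_ops w r' n (n + w) else [::].

Definition path_end (w r v n : nat) : nat := if r is r'.+1 then n + r' * w else v.

Lemma path_endS w r v n : path_end w r n (n + w) = path_end w r.+1 v n.
Proof. by case: r => [|r] /=; rewrite ?addn0 // mulSn addnA. Qed.

Lemma path_end_lt w r v n : 0 < w -> v < n -> path_end w r v n < n + r * w.
Proof. by case: r => [|r] /=; [lia | rewrite mulSn; lia]. Qed.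

(** * Summing out the vertices edge by edge *)

Section Eval.

Variables (R : comNzRingType) (q : nat) (i0 : 'I_q).

Local Open Scope ring_scope.

Fixpoint sumc (k : nat) (F : seq 'I_q -> R) : R :=
  if k is k'.+1 then \sum_(a < q) sumc k' (fun d => F (a :: d)) else F [::].

Lemma sumcS k F : sumc k.+1 F = \sum_a sumc k (fun d => F (a :: d)).
Proof. by []. Qed.

Lemma eq_sumc k F G : (forall d, size d = k -> F d = G d) -> sumc k F = sumc k G.
Proof.
elim: k F G => [|k IH] F G h /=; first exact: h.
by apply: eq_bigr => a _; apply: IH => d hd; apply: h; rewrite /= hd.
Qed.

Lemma sumc_cat k1 k2 F : sumc (k1 + k2) F = sumc k1 (fun c => sumc k2 (fun d => F (c ++ d))).
Proof. by elim: k1 F => [|k1 IH] F //=; apply: eq_bigr => a _; rewrite IH. Qed.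

Lemma sumc_mull k x F : sumc k (fun d => x * F d) = x * sumc k F.
Proof.
elim: k F => [|k IH] F //=; rewrite big_distrr /=.
by apply: eq_bigr => a _; rewrite IH.
Qed.

Lemma sumc_mulr k x F : sumc k (fun d => F d * x) = sumc k F * x.
Proof. by rewrite mulrC -sumc_mull; apply: eq_sumc => d _; rewrite mulrC. Qed.

Lemma sumc_const k x : sumc k (fun=> x) = (q ^ k)%:R * x.
Proof.
elim: k => [|k IH] /=; first by rewrite mul1r.
by rewrite (eq_bigr _ (fun a _ => IH)) sumr_const card_ord expnS natrM -mulrA [RHS]mulr_natl.
Qed.

Lemma sumc_sub k F G : sumc k (fun d => F d - G d) = sumc k F - sumc k G.
Proof.
elim: k F G => [|k IH] F G //=; rewrite -sumrB.
by apply: eq_bigr => a _; rewrite IH.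
Qed.

Lemma sum_pick (F : 'I_q -> R) a : \sum_b (a == b)%:R * F b = F a.
Proof.
rewrite (bigD1 a) //= eqxx mul1r big1 ?addr0 // => b.
by rewrite eq_sym => /negPf ->; rewrite mul0r.
Qed.

Lemma sumc_all k (a : 'I_q) : sumc k (fun d => (all (pred1 a) d)%:R) = 1.
Proof.
elim: k => [|k IH] //=; rewrite -[RHS](sum_pick (fun=> 1) a); apply: eq_bigr => b _.
rewrite eq_sym; case: eqP => _ /=; first by rewrite IH mul1r.
by rewrite sumc_const mulr0 mul0r.
Qed.

Definition nae (c : seq 'I_q) (e : seq nat) : bool := ~~ constant [seq nth i0 c v | v <- e].

(** A partition function with the not-all-equal constraint on edges. The colours of new vertices are
    summed as soon as they are created, given the colours [c] of the older ones, so that gadgets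
    become products of small matrices. *)
Fixpoint evalops (ops : seq op) (F : seq 'I_q -> R) (c : seq 'I_q) : R :=
  if ops is (e, k) :: ops' then
    sumc k (fun d => (nae (c ++ d) e)%:R * evalops ops' F (c ++ d))
  else F c.

Lemma evalops_cat ops1 ops2 F c : evalops (ops1 ++ ops2) F c = evalops ops1 (evalops ops2 F) c.
Proof.
elim: ops1 c => [|[e k] ops IH] c //=.
by apply: eq_sumc => d _; rewrite IH.
Qed.

(** Among the q^k extensions only the constant [x] can complete a monochromatic edge, and only if
    [l] is already constant of that colour. *)
Lemma sumc_nae k x l : sumc k (fun d => (~~ constant (x :: l ++ d))%:R)
  = (q ^ k)%:R - (all (pred1 x) l)%:R.
Proof.
transitivity (sumc k (fun d => 1 - (all (pred1 x) l)%:R * (all (pred1 x) d)%:R)).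
  apply: eq_sumc => d _; rewrite /= all_cat.
  by do 2 case: all; rewrite /= ?mul1r ?mul0r ?subr0 ?subrr.
by rewrite sumc_sub sumc_mull sumc_const sumc_all !mulr1.
Qed.

Lemma nth_cat_old (c d : seq 'I_q) v : (v < size c)%N -> nth i0 (c ++ d) v = nth i0 c v.
Proof. by move=> h; rewrite nth_cat h. Qed.

Lemma map_nth_new (c d : seq 'I_q) : [seq nth i0 (c ++ d) v | v <- iota (size c) (size d)] = d.
Proof.
apply: (@eq_from_nth _ i0); rewrite size_map size_iota // => i hi.
by rewrite (nth_map 0%N) ?size_iota // nth_iota // nth_cat ltnNge leq_addr /= addKn.
Qed.

Section Gadgets.

Variable w0 : nat.
Notation w := w0.+2.

Definition Mk (a b : 'I_q) : R := (q ^ w0.+1)%:R - (a == b)%:R.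
Definition Nk (a b e : 'I_q) : R := (q ^ w0)%:R - ((a == b) && (a == e))%:R.

Fixpoint Mp (r : nat) (a b : 'I_q) : R :=
  if r is r'.+1 then \sum_x Mk a x * Mp r' x b else (a == b)%:R.

(** Only the first two created vertices remain visible to [F]; summing out the other [w0] leaves the
    kernel [Nk]. *)
Lemma eval_unit1 a F c (G : 'I_q -> 'I_q -> R) : (a < size c)%N ->
  (forall d, size d = w -> F (c ++ d) = G (nth i0 (c ++ d) (size c)) (nth i0 (c ++ d) (size c).+1)) ->
  evalops [:: (a :: iota (size c) w, w)] F c = \sum_b \sum_e Nk (nth i0 c a) b e * G b e.
Proof.
move=> ha h; rewrite [evalops _ _ _](_ : _ = sumc (2 + w0) (fun d =>
    (nae (c ++ d) (a :: iota (size c) w))%:R * F (c ++ d))) // sumc_cat.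
rewrite [LHS]/=; apply: eq_bigr => b _; apply: eq_bigr => e _.
have -> : Nk (nth i0 c a) b e = sumc w0 (fun d => (~~ constant (nth i0 c a :: [:: b; e] ++ d))%:R).
  by rewrite sumc_nae /Nk /= andbT !(eq_sym (nth i0 c a)).
rewrite -sumc_mulr; apply: eq_sumc => d hd.
rewrite h; last by rewrite /= hd.
rewrite !nth_cat ltnn subnn ltnNge leqnSn /= subSnn /=; congr (_%:R * _).
rewrite /nae map_cons nth_cat_old //.
by have := map_nth_new c (b :: e :: d); rewrite [size (_ :: _)]/= hd => ->.
Qed.

Lemma eval_unit2 a z F c (G : 'I_q -> R) : (a < size c)%N -> (z < size c)%N ->
  (forall d, size d = w0.+1 -> F (c ++ d) = G (nth i0 (c ++ d) (size c))) ->
  evalops [:: (a :: z :: iota (size c) w0.+1, w0.+1)] F c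
    = \sum_b Nk (nth i0 c a) (nth i0 c z) b * G b.
Proof.
move=> ha hz h; rewrite [evalops _ _ _](_ : _ = sumc w0.+1 (fun d =>
    (nae (c ++ d) (a :: z :: iota (size c) w0.+1))%:R * F (c ++ d))) // sumcS.
apply: eq_bigr => b _.
have -> : Nk (nth i0 c a) (nth i0 c z) b
    = sumc w0 (fun d => (~~ constant (nth i0 c a :: [:: nth i0 c z; b] ++ d))%:R).
  by rewrite sumc_nae /Nk /= andbT !(eq_sym (nth i0 c a)).
rewrite -sumc_mulr; apply: eq_sumc => d hd.
rewrite h; last by rewrite /= hd.
rewrite !nth_cat ltnn subnn /=; congr (_%:R * _).
rewrite /nae map_cons map_cons !nth_cat_old //.
by have := map_nth_new c (b :: d); rewrite [size (_ :: _)]/= hd => ->.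
Qed.

Lemma eval_link v F c (G : 'I_q -> R) : (v < size c)%N ->
  (forall d, size d = w -> F (c ++ d) = G (nth i0 (c ++ d) (size c))) ->
  evalops [:: (v :: iota (size c) w, w)] F c = \sum_b Mk (nth i0 c v) b * G b.
Proof.
move=> hv h; rewrite [evalops _ _ _](_ : _ = sumc w (fun d =>
    (nae (c ++ d) (v :: iota (size c) w))%:R * F (c ++ d))) // sumcS.
apply: eq_bigr => b _.
have -> : Mk (nth i0 c v) b = sumc w0.+1 (fun d => (~~ constant (nth i0 c v :: [:: b] ++ d))%:R).
  by rewrite sumc_nae /Mk /= andbT eq_sym.
rewrite -sumc_mulr; apply: eq_sumc => d hd.
rewrite h; last by rewrite /= hd.
rewrite !nth_cat ltnn subnn /=; congr (_%:R * _).
rewrite /nae map_cons nth_cat_old //.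
by have := map_nth_new c (b :: d); rewrite [size (_ :: _)]/= hd => ->.
Qed.

Lemma eval_path r v F c (G : 'I_q -> R) : (v < size c)%N ->
  (forall d, size d = (r * w)%N -> F (c ++ d) = G (nth i0 (c ++ d) (path_end w r v (size c)))) ->
  evalops (path_ops w r v (size c)) F c = \sum_b Mp r (nth i0 c v) b * G b.
Proof.
elim: r v F c => [|r IH] v F c hv h.
  by rewrite sum_pick -[in LHS](cats0 c) /= h // cats0.
rewrite [path_ops _ _ _ _]/= -cat1s evalops_cat.
rewrite (eval_link (G := fun x => \sum_b Mp r x b * G b)) //.
  transitivity (\sum_x \sum_b Mk (nth i0 c v) x * (Mp r x b * G b)).
    by apply: eq_bigr => x _; rewrite big_distrr.
  rewrite exchange_big; apply: eq_bigr => b _ /=; rewrite big_distrl /=.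
  by apply: eq_bigr => x _; rewrite mulrA.
move=> d hd; have -> : (size c + w = size (c ++ d))%N by rewrite size_cat hd.
rewrite IH //; first by rewrite size_cat hd -[X in (X < _)%N]addn0 ltn_add2l.
move=> d' hd'; rewrite -catA h ?size_cat ?hd ?hd' ?mulSn //.
by rewrite (path_endS w r v).
Qed.

End Gadgets.

End Eval.

(* The gadget of the spin edge [uv]: the handles [h_u] and [h_v] are prolonged
   by paths of length [r], and the new legs are joined by a path of length [s]. *)
Section Step.

Variables (w r s : nat).

Definition step_out (n : nat) : nat * nat :=
  let n1 := n + r * w in let n2 := n1 + w in let n3 := n2 + r * w in
  let n4 := n3 + s * w in let n5 := n4 + r * w in let n6 := n5 + w.-1 in
  (path_end w r n1 n2, path_end w r n5 n6).

Definition step_size : nat := r * w + w + r * w + s * w + r * w + w.-1 + r * w.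

Definition step_handles (hs : seq nat) (uv : nat * nat) (n : nat) : seq nat :=
  set_nth 0 (set_nth 0 hs uv.1 (step_out n).1) uv.2 (step_out n).2.

(** The handle of the second endpoint is looked up after that of the first has been replaced, so
    that a spin edge with equal endpoints also works. *)
Definition step_ops (hs : seq nat) (uv : nat * nat) (n : nat) : seq op :=
  let n1 := n + r * w in let n2 := n1 + w in let n3 := n2 + r * w in
  let n4 := n3 + s * w in let n5 := n4 + r * w in let n6 := n5 + w.-1 in
  let hu := nth 0 hs uv.1 in
  let hv := nth 0 (set_nth 0 hs uv.1 (step_out n).1) uv.2 in
  path_ops w r hu n
  ++ [:: (path_end w r hu n :: iota n1 w, w)]
  ++ path_ops w r n1 n2
  ++ path_ops w s n1.+1 n3
  ++ path_ops w r hv n4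
  ++ [:: (path_end w r hv n4 :: path_end w s n1.+1 n3 :: iota n5 w.-1, w.-1)]
  ++ path_ops w r n5 n6.

Fixpoint graph_ops (E : seq (nat * nat)) (hs : seq nat) (n : nat) : seq op :=
  if E is uv :: E' then
    step_ops hs uv n ++ graph_ops E' (step_handles hs uv n) (n + step_size)
  else [::].

End Step.

Section Sums.

Variables (R : comNzRingType) (T : finType).
Local Open Scope ring_scope.

Lemma sum_assoc (m : T -> R) (N p : T -> T -> R) (g : T -> R) :
  \sum_a m a * (\sum_b N a b * (\sum_b' p b b' * g b'))
  = \sum_b' (\sum_a m a * (\sum_b N a b * p b b')) * g b'.
Proof.
rewrite [RHS](eq_bigr (fun b' => \sum_a m a * (\sum_b N a b * p b b') * g b')); last first.
  by move=> b' _; rewrite big_distrl.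
rewrite [RHS]exchange_big; apply: eq_bigr => a _ /=.
rewrite [RHS](eq_bigr (fun b' => m a * (\sum_b N a b * p b b' * g b'))); last first.
  by move=> b' _; rewrite -mulrA big_distrl.
rewrite -[RHS]big_distrr [in RHS]exchange_big /=; congr (_ * _); apply: eq_bigr => b _.
by rewrite big_distrr; apply: eq_bigr => b' _; rewrite /= mulrA.
Qed.

Lemma sum_assoc2 (m : T -> R) (N : T -> T -> T -> R) (p s g : T -> T -> R) :
  \sum_a m a * (\sum_b \sum_e N a b e * (\sum_b' p b b' * (\sum_z s e z * g z b')))
  = \sum_b' \sum_z (\sum_a m a * (\sum_b \sum_e N a b e * (p b b' * s e z))) * g z b'.
Proof.
pose H b e := \sum_b' \sum_z p b b' * s e z * g z b'.
transitivity (\sum_a m a * (\sum_b \sum_e N a b e * H b e)).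
  apply: eq_bigr => a _; congr (_ * _); apply: eq_bigr => b _; apply: eq_bigr => e _.
  congr (_ * _); apply: eq_bigr => b' _; rewrite big_distrr.
  by apply: eq_bigr => z _; rewrite /= mulrA.
rewrite [RHS]pair_big [RHS](eq_bigr (fun y => \sum_a m a * (\sum_x N a x.1 x.2 * (p x.1 y.1 * s x.2 y.2)) * g y.2 y.1)).
  rewrite [RHS]exchange_big; apply: eq_bigr => a _ /=.
  rewrite [RHS](eq_bigr (fun y => m a * (\sum_x N a x.1 x.2 * (p x.1 y.1 * s x.2 y.2) * g y.2 y.1))); last first.
    by move=> y _; rewrite -mulrA big_distrl.
  rewrite -[RHS]big_distrr [in LHS]pair_big [in RHS]exchange_big /=; congr (_ * _); apply: eq_bigr => x _.
  rewrite /H pair_big big_distrr; apply: eq_bigr => y _.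
  by rewrite /= mulrA.
move=> y _; rewrite big_distrl; apply: eq_bigr => a _.
by rewrite pair_big.
Qed.

End Sums.

Section EvalStep.

Variables (R : comNzRingType) (q : nat) (i0 : 'I_q) (w0 r s : nat).
Notation w := w0.+2.

Local Open Scope ring_scope.

Notation Mp := (Mp R w0).
Notation Nk := (Nk R w0).

Definition T1 (x b' z : 'I_q) : R :=
  \sum_a Mp r x a * (\sum_b \sum_e Nk a b e * (Mp r b b' * Mp s e z)).
Definition T2 (y z b' : 'I_q) : R :=
  \sum_a Mp r y a * (\sum_b Nk a z b * Mp r b b').

Variables (U : R) (Ek : 'I_q -> 'I_q -> R).

(** The demand on a gadget: both colours pass unchanged to the new handles, and only a scalar and
    the coupling [Ek] are left behind. *)
Hypothesis gadget : forall x y b1 b2,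
  \sum_z T1 x b1 z * T2 y z b2 = U * ((x == b1)%:R * ((y == b2)%:R * Ek x y)).

Lemma eval_step hs uv F c (G : seq 'I_q -> R) :
  all (fun h => h < size c)%N hs -> (uv.1 < size hs)%N -> (uv.2 < size hs)%N ->
  (forall d, size d = step_size w r s ->
     F (c ++ d) = G [seq nth i0 (c ++ d) v | v <- step_handles w r s hs uv (size c)]) ->
  evalops i0 (step_ops w r s hs uv (size c)) F c
    = U * (Ek (nth i0 c (nth 0%N hs uv.1)) (nth i0 c (nth 0%N hs uv.2))
           * G [seq nth i0 c v | v <- hs]).
Proof.
case: uv => u v /= hhs hu hv; set t := [seq nth i0 c v | v <- hs].
have st : size t = size hs by rewrite size_map.
have hul : (nth 0%N hs u < size c)%N by apply: all_nthP hhs u hu.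
have hvl0 : (nth 0%N hs v < size c)%N by apply: all_nthP hhs v hv.
rewrite /step_ops /step_handles /step_out; cbn [fst snd]; change w.-1 with w0.+1.
move en: (size c) => n; rewrite en in hul hvl0.
move e1: (n + r * w)%N => n1; move e2: (n1 + w)%N => n2; move e3: (n2 + r * w)%N => n3.
move e4: (n3 + s * w)%N => n4; move e5: (n4 + r * w)%N => n5; move e6: (n5 + w0.+1)%N => n6.
move eo1: (path_end w r n1 n2) => o1; move eo2: (path_end w r n5 n6) => o2.
have o1l : (o1 < n3)%N by rewrite -eo1 -e3; apply: path_end_lt; lia.
move eh: (nth 0%N (set_nth 0%N hs u o1) v) => h_v hF.
have hvl : (h_v < n3)%N by rewrite -eh nth_set_nth /=; case: eqP => _; lia.
(* The colour of the second handle after the first has been replaced by one of colour [b1]; it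
   depends on [b1] when the endpoints coincide. *)
pose tau b1 := nth i0 (set_nth i0 t u b1) v.
pose G4 b1 b2' := G (set_nth i0 (set_nth i0 t u b1) v b2').
pose G3 z b1 := \sum_a2 Mp r (tau b1) a2 * (\sum_b2 Nk a2 z b2 * (\sum_b2' Mp r b2 b2' * G4 b1 b2')).
transitivity (\sum_a Mp r (nth i0 c (nth 0%N hs u)) a * (\sum_b \sum_e Nk a b e *
   (\sum_b1 Mp r b b1 * (\sum_z Mp s e z * G3 z b1)))).
  rewrite evalops_cat -{1}en.
  rewrite (eval_path (G := fun a => \sum_b \sum_e Nk a b e *
   (\sum_b1 Mp r b b1 * (\sum_z Mp s e z * G3 z b1)))) ?en // => d1 hd1.
  set c1 := c ++ d1; have s1 : size c1 = n1 by rewrite size_cat hd1 en.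
  rewrite evalops_cat -{1 2}s1.
  rewrite (eval_unit1 (G := fun b e => \sum_b1 Mp r b b1 * (\sum_z Mp s e z * G3 z b1))) //.
    by rewrite s1 -e1; apply: path_end_lt.
  move=> d2 hd2; rewrite s1; set c2 := c1 ++ d2.
  have s2 : size c2 = n2 by rewrite size_cat hd2 s1.
  rewrite evalops_cat -{1}s2 (eval_path (G := fun b1 => \sum_z Mp s (nth i0 c2 n1.+1) z * G3 z b1)) //.
    by rewrite s2 -e2; lia.
  move=> d3 hd3; rewrite s2 eo1; set c3 := c2 ++ d3.
  have s3 : size c3 = n3 by rewrite size_cat hd3 s2.
  have -> : nth i0 c2 n1.+1 = nth i0 c3 n1.+1 by rewrite [RHS]nth_cat_old // s2 -e2; lia.
  rewrite evalops_cat -{1}s3 (eval_path (G := fun z => G3 z (nth i0 c3 o1))) //.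
    by rewrite s3 -e3 -e2; lia.
  move=> d4 hd4; rewrite s3; set c4 := c3 ++ d4.
  have s4 : size c4 = n4 by rewrite size_cat hd4 s3.
  have -> : nth i0 c3 o1 = nth i0 c4 o1 by rewrite [RHS]nth_cat_old // s3.
  have c4E : forall x, (x < n)%N -> nth i0 c4 x = nth i0 c x.
    move=> x hx; rewrite /c4 /c3 /c2 /c1 !nth_cat_old // ?size_cat ?hd1 ?hd2 ?hd3 ?en; lia.
  have tE : t = [seq nth i0 c4 x | x <- hs].
    by apply/eq_in_map => x hx; rewrite c4E // -en; apply: (allP hhs).
  have htau : tau (nth i0 c4 o1) = nth i0 c4 h_v.
    rewrite /tau -eh !nth_set_nth /=; case: eqP => // _.
    by rewrite tE (nth_map 0%N).
  rewrite evalops_cat -{1}s4 (eval_path (G := fun a2 => \sum_b2 Nk a2 (nth i0 c4 (path_end w s n1.+1 n3)) b2 *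
     (\sum_b2' Mp r b2 b2' * G4 (nth i0 c4 o1) b2'))); first by rewrite /G3 htau.
    by rewrite s4 -e4; lia.
  move=> d5 hd5; rewrite s4; set c5 := c4 ++ d5.
  have s5 : size c5 = n5 by rewrite size_cat hd5 s4.
  have zl : (path_end w s n1.+1 n3 < n4)%N by rewrite -e4; apply: path_end_lt; rewrite // -e3 -e2; lia.
  have -> : nth i0 c4 (path_end w s n1.+1 n3) = nth i0 c5 (path_end w s n1.+1 n3).
    by rewrite [RHS]nth_cat_old // s4.
  rewrite evalops_cat -{1}s5.
  rewrite (eval_unit2 (G := fun b2 => \sum_b2' Mp r b2 b2' * G4 (nth i0 c4 o1) b2')) //.
  - by rewrite s5 -e5; apply: path_end_lt; rewrite // -e4; lia.
  - by rewrite s5 -e5; lia.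
  move=> d6 hd6; rewrite s5; set c6 := c5 ++ d6.
  have s6 : size c6 = n6 by rewrite size_cat hd6 s5.
  rewrite -[X in path_ops _ _ _ X]s6 (eval_path (G := fun b2' => G4 (nth i0 c4 o1) b2')) //.
    by rewrite s6 -e6; lia.
  move=> d7 hd7; rewrite s6 eo2.
  have E : c6 ++ d7 = c ++ (d1 ++ d2 ++ d3 ++ d4 ++ d5 ++ d6 ++ d7) by rewrite /c6 /c5 /c4 /c3 /c2 /c1 -!catA.
  rewrite [in F _]E hF; last by rewrite !size_cat hd1 hd2 hd3 hd4 hd5 hd6 hd7 /step_size; lia.
  rewrite -E /G4; congr (G _).
  have h4 x : (x < n4)%N -> nth i0 (c6 ++ d7) x = nth i0 c4 x.
    have -> : c6 ++ d7 = c4 ++ (d5 ++ d6 ++ d7) by rewrite /c6 /c5 -!catA.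
    by move=> hx; rewrite [LHS]nth_cat_old ?s4.
  have o1E : nth i0 (c6 ++ d7) o1 = nth i0 c4 o1 by rewrite h4 // -e4; lia.
  apply: (@eq_from_nth _ i0); first by rewrite !size_map !size_set_nth size_map; lia.
  move=> x hx; rewrite (nth_map 0%N) //; last by rewrite size_map in hx.
  rewrite !nth_set_nth /= !nth_set_nth /=; case: eqP => // xv; case: eqP => // xu.
  have xs : (x < size hs)%N.
    by move: hx; rewrite size_map !size_set_nth; move/eqP: xv; move/eqP: xu; lia.
  rewrite (nth_map 0%N) // h4 ?c4E //; last by have := all_nthP 0%N hhs x xs; lia.
  by have := all_nthP 0%N hhs x xs; lia.
set x := nth i0 c (nth 0%N hs u); set y := nth i0 c (nth 0%N hs v).
transitivity (\sum_b1 \sum_z T1 x b1 z * (\sum_b2 T2 (tau b1) z b2 * G4 b1 b2)).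
  rewrite sum_assoc2; apply: eq_bigr => b1 _; apply: eq_bigr => z _.
  by congr (_ * _); apply: sum_assoc.
transitivity (\sum_b1 \sum_b2 U * ((x == b1)%:R * ((tau b1 == b2)%:R * Ek x (tau b1))) * G4 b1 b2).
  apply: eq_bigr => b1 _.
  transitivity (\sum_z \sum_b2 T1 x b1 z * (T2 (tau b1) z b2 * G4 b1 b2)).
    by apply: eq_bigr => z _; rewrite big_distrr.
  rewrite exchange_big /=; apply: eq_bigr => b2 _; rewrite -gadget big_distrl /=.
  by apply: eq_bigr => z _; rewrite mulrA.
have tx : nth i0 t u = x by rewrite (nth_map 0%N).
have ty : nth i0 t v = y by rewrite (nth_map 0%N).
have tx' : set_nth i0 t u x = t.
  apply: (@eq_from_nth _ i0) => [|k _]; first by rewrite size_set_nth st; lia.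
  by rewrite nth_set_nth /=; case: eqP => // ->.
rewrite (bigD1 x) //= [X in _ + X]big1 ?addr0; last first.
  move=> b1 /negPf b1x; rewrite big1 // => b2 _.
  by rewrite eq_sym b1x mul0r mulr0 mul0r.
have tauE : tau x = y by rewrite /tau tx'.
rewrite (bigD1 y) //= [X in _ + X]big1 ?addr0; last first.
  move=> b2 /negPf b2y; rewrite tauE eq_sym b2y.
  by rewrite mul0r mulr0 mulr0 mul0r.
rewrite tauE !eqxx !mul1r /G4 tx' -mulrA; congr (U * (_ * G _)).
apply: (@eq_from_nth _ i0) => [|k _]; first by rewrite size_set_nth st; lia.
by rewrite nth_set_nth /=; case: eqP => // ->.
Qed.

End EvalStep.

Lemma step_out_lt w r s n : 1 < w ->
  (step_out w r s n).1 < n + step_size w r s /\ (step_out w r s n).2 < n + step_size w r s.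
Proof.
move=> w1; rewrite /step_out /step_size /=; case: r => [|r] /=.
  by rewrite !mul0n; lia.
by rewrite !mulSn; nia.
Qed.

Lemma size_step_handles w r s hs uv n : uv.1 < size hs -> uv.2 < size hs ->
  size (step_handles w r s hs uv n) = size hs.
Proof. by move=> h1 h2; rewrite /step_handles !size_set_nth; lia. Qed.

Lemma step_handles_lt w r s hs uv n : 1 < w -> uv.1 < size hs -> uv.2 < size hs ->
  all (fun h => h < n) hs ->
  all (fun h => h < n + step_size w r s) (step_handles w r s hs uv n).
Proof.
move=> w1 h1 h2 hh; have [o1 o2] := step_out_lt r s n w1.
apply/(all_nthP 0) => i; rewrite size_step_handles // => hi.
rewrite /step_handles !nth_set_nth /= !nth_set_nth /=; case: eqP => // _; case: eqP => // _.
by have := all_nthP 0 hh i hi; lia.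
Qed.

(** * Powers of the path matrix and the coupling for many colours *)

Section Kernel.

Variables (R : comNzRingType) (q w0 : nat).
Notation w := w0.+2.
Local Open Scope ring_scope.

Definition Lr : R := (q ^ w)%:R - 1.

(** The coefficient of the all-ones matrix in the r-th power, that is (L^r - (-1)^r)/q; the
    recursion avoids a division, as q may have no inverse in [R]. *)
Fixpoint kap (r : nat) : R :=
  if r is r'.+1 then (q ^ w0.+1)%:R * (-1) ^+ r' + kap r' * Lr else 0.

Lemma q_kap r : q%:R * kap r = Lr ^+ r - (-1) ^+ r.
Proof.
elim: r => [|r IH] /=; first by rewrite mulr0 !expr0 subrr.
have e : q%:R * (q ^ w0.+1)%:R = (q ^ w)%:R :> R by rewrite -natrM -expnS.
by rewrite !exprS mulrDr !mulrA e IH /Lr; ring.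
Qed.

Lemma sum_delta (F : 'I_q -> R) b : \sum_x F x * (x == b)%:R = F b.
Proof.
rewrite -[RHS](sum_pick F); apply: eq_bigr => x _.
by rewrite mulrC eq_sym.
Qed.

Lemma sum_eq1 (b : 'I_q) : \sum_x ((b == x)%:R : R) = 1.
Proof. by rewrite -[RHS](sum_pick (fun=> 1) b); apply: eq_bigr => x _; rewrite mulr1. Qed.

Lemma sum_Mk (a : 'I_q) : \sum_x Mk R w0 a x = Lr.
Proof. by rewrite /Mk sumrB sumr_const card_ord sum_eq1 -mulrnA -expnSr. Qed.

Lemma Mp_E r (a b : 'I_q) : Mp R w0 r a b = (-1) ^+ r * (a == b)%:R + kap r.
Proof.
elim: r a b => [|r IH] a b /=; first by rewrite mul1r addr0.
transitivity (\sum_x (Mk R w0 a x * (-1) ^+ r * (x == b)%:R + Mk R w0 a x * kap r)).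
  by apply: eq_bigr => x _; rewrite IH mulrDr mulrA.
rewrite big_split /= sum_delta -big_distrl /= sum_Mk /Mk exprS; ring.
Qed.

Lemma Mp_sym r (a b : 'I_q) : Mp R w0 r a b = Mp R w0 r b a.
Proof. by rewrite !Mp_E eq_sym. Qed.

Lemma Mp_add r1 r2 (a b : 'I_q) : Mp R w0 (r1 + r2) a b = \sum_x Mp R w0 r1 a x * Mp R w0 r2 x b.
Proof.
elim: r1 a => [|r1 IH] a /=; first by rewrite sum_pick.
transitivity (\sum_y \sum_x Mk R w0 a y * (Mp R w0 r1 y x * Mp R w0 r2 x b)).
  by apply: eq_bigr => y _; rewrite IH big_distrr.
rewrite exchange_big; apply: eq_bigr => x _ /=; rewrite big_distrl.
by apply: eq_bigr => y _; rewrite /= mulrA.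
Qed.

(* When [1 + q * kap K = 0] a path of length [K] is the projection killing the
   constant vector, hence the constant part of the units. *)
Lemma gadget_projection K : ~~ odd K -> q%:R * kap K = -1 ->
  forall x y b1 b2 : 'I_q, \sum_z T1 R w0 0 K x b1 z * T2 R w0 0 y z b2
    = 1 * ((x == b1)%:R * ((y == b2)%:R * ((x == y)%:R + kap K))).
Proof.
move=> eK hK x y b1 b2.
have mp (e z : 'I_q) : Mp R w0 K e z = (e == z)%:R + kap K.
  by rewrite Mp_E -signr_odd (negPf eK) mul1r.
have mp0 (z : 'I_q) : \sum_e Mp R w0 K e z = 0.
  rewrite (eq_bigr _ (fun e _ => mp e z)) big_split /= sumr_const card_ord -mulr_natl hK.
  rewrite (eq_bigr (fun x => (z == x)%:R)) ?sum_eq1 ?subrr // => x0 _.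
  by rewrite eq_sym.
(* The constant q^w0 of [Nk] meets [mp0] and vanishes; minus the equality is what remains of the
   edge. *)
have t1 z : T1 R w0 0 K x b1 z = - ((x == b1)%:R * Mp R w0 K x z).
  rewrite /T1 sum_pick.
  transitivity (\sum_e Nk R w0 x b1 e * Mp R w0 K e z).
    rewrite exchange_big; apply: eq_bigr => e _ /=.
    rewrite -(sum_delta (fun b => Nk R w0 x b e * Mp R w0 K e z)); apply: eq_bigr => b _.
    by rewrite mulrA mulrAC.
  transitivity (\sum_e ((q ^ w0)%:R * Mp R w0 K e z - (x == e)%:R * ((x == b1)%:R * Mp R w0 K e z))).
    apply: eq_bigr => e _; rewrite /Nk -mulnb natrM; ring.
  by rewrite sumrB -big_distrr /= mp0 mulr0 sum_pick sub0r.
have t2 z : T2 R w0 0 y z b2 = (q ^ w0)%:R - (y == z)%:R * (y == b2)%:R.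
  by rewrite /T2 sum_pick /= sum_delta /Nk -mulnb natrM.
(* The other end of the path disposes in the same way of the constant of the second edge, and the
   two minus signs cancel. *)
transitivity (\sum_z (- (x == b1)%:R * (q ^ w0)%:R * Mp R w0 K z x
   + (y == z)%:R * ((x == b1)%:R * (y == b2)%:R * Mp R w0 K x z))).
  by apply: eq_bigr => z _; rewrite t1 t2 (Mp_sym _ z x); ring.
rewrite big_split /= -big_distrr /= mp0 mulr0 add0r sum_pick mp; ring.
Qed.

End Kernel.

(* For two colours and even [h], a unit whose three legs are paths of length [h]
   is a multiple of the equality of its legs. *)
Section TwoColours.

Variables (R : comNzRingType) (w0 h i : nat).
Local Open Scope ring_scope.

Notation c := (@kap R 2 w0 h).
Notation Mp := (@Mp R 2 w0).
Notation Nk := (@Nk R 2 w0).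

Hypotheses (eh : ~~ odd h) (hc : (2 ^ w0)%:R * (1 + 2%:R * c) ^+ 2 = c * (1 + c)).

(** With legs I + cJ, a triple of colours that are not all equal gets (1 + 2c)(2^w0 (1 + 2c)^2 - c(1
    + c)), which [hc] makes 0; an equal triple gets (1 + 2c)^3 2^w0 - (1 + c)^3 - c^3, which then is
    -(1 + 2c). *)
Lemma unit_equality x b t :
  \sum_a Mp h x a * (\sum_b' \sum_e Nk a b' e * (Mp h b' b * Mp h e t))
  = - (1 + 2%:R * c) * ((x == b) && (x == t))%:R.
Proof.
have mp (a a' : 'I_2) : Mp h a a' = (a == a')%:R + c.
  by rewrite Mp_E -signr_odd (negPf eh) mul1r.
pose al : R := (2 ^ w0)%:R.
have e1 : al * (1 + 2%:R * c) ^+ 3 = (1 + 2%:R * c) * (c * (1 + c)).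
  by rewrite -hc /al; ring.
have cases (y : 'I_2) : y = ord0 \/ y = ord_max.
  by case: y => -[|[|//]] hy; [left | right]; apply: val_inj.
have o01 : ((ord0 : 'I_2) == ord_max) = false by [].
have o10 : ((ord_max : 'I_2) == ord0) = false by [].
have sum2 (F : 'I_2 -> R) : \sum_y F y = F ord0 + F ord_max.
  by rewrite big_ord_recl big_ord1; congr (_ + F _); apply: val_inj.
(* In each of the eight cases the two sides differ by exactly the relation [e1], so that [ring] can
   conclude. *)
have eq_by (u v : R) : u = v + (al * (1 + 2%:R * c) ^+ 3 - (1 + 2%:R * c) * (c * (1 + c))) -> u = v.
  by move=> ->; rewrite e1 subrr addr0.
rewrite !sum2 /Nk -/al !mp.
by case: (cases x) => ->; case: (cases b) => ->; case: (cases t) => ->;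
  apply: eq_by; rewrite !eqxx ?o01 ?o10 /=; ring.
Qed.

(** The two ends of the path of length h + i + h serve as the third legs of the two units. Both
    units then collapse to multiples of equality, and a wire of length i is left between the two
    colours. *)
Lemma gadget_two_colours : forall x y b1 b2,
  \sum_z T1 R w0 h (h + i + h) x b1 z * T2 R w0 h y z b2
    = (1 + 2%:R * c) ^+ 2 * ((x == b1)%:R * ((y == b2)%:R * Mp i x y)).
Proof.
move=> x y b1 b2; set lam := 1 + _.
have t1 z : T1 R w0 h (h + i + h) x b1 z = - lam * (x == b1)%:R * Mp (i + h) x z.
  transitivity (\sum_t (\sum_a Mp h x a * (\sum_b' \sum_e Nk a b' e * (Mp h b' b1 * Mp h e t)))
      * Mp (i + h) t z).
    rewrite /T1.
    transitivity (\sum_a \sum_t (Mp h x a * (\sum_b' \sum_e Nk a b' e * (Mp h b' b1 * Mp h e t))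
       * Mp (i + h) t z)).
      apply: eq_bigr => a _.
      transitivity (\sum_t Mp h x a * ((\sum_b' \sum_e Nk a b' e * (Mp h b' b1 * Mp h e t)) * Mp (i + h) t z)).
        rewrite -big_distrr /=; congr (_ * _).
        rewrite pair_big (eq_bigr (fun p => \sum_t Nk a p.1 p.2 * (Mp h p.1 b1 * Mp h p.2 t) * Mp (i + h) t z)).
          rewrite exchange_big; apply: eq_bigr => t _ /=.
          by rewrite pair_big big_distrl.
        move=> p _; rewrite -addnA Mp_add 2!big_distrr /=.
        by apply: eq_bigr => t _; rewrite !mulrA.
      by apply: eq_bigr => t _; rewrite mulrA.
    rewrite exchange_big; apply: eq_bigr => t _ /=.
    by rewrite big_distrl.
  rewrite (eq_bigr (fun t => (x == t)%:R * (- lam * (x == b1)%:R * Mp (i + h) t z))).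
    by rewrite sum_pick.
  by move=> t _; rewrite unit_equality -mulnb natrM -/lam; ring.
have t2 t : \sum_z Mp h t z * T2 R w0 h y z b2 = - lam * ((y == t) && (y == b2))%:R.
  rewrite /lam -unit_equality /T2.
  transitivity (\sum_z \sum_a Mp h y a * (\sum_b Mp h t z * (Nk a z b * Mp h b b2))).
    apply: eq_bigr => z _; rewrite big_distrr; apply: eq_bigr => a _ /=.
    by rewrite -big_distrr /=; ring.
  rewrite exchange_big; apply: eq_bigr => a _ /=.
  rewrite -big_distrr /=; congr (_ * _); apply: eq_bigr => z _; apply: eq_bigr => b _.
  by rewrite (@Mp_sym R 2 w0 h z t); ring.
transitivity (\sum_t \sum_z (- lam * (x == b1)%:R * Mp i x t) * (Mp h t z * T2 R w0 h y z b2)).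
  rewrite exchange_big; apply: eq_bigr => z _ /=; rewrite t1 Mp_add.
  move: (T2 _ _ _ _ _ _) => tt2; rewrite big_distrr big_distrl /=; apply: eq_bigr => t _; ring.
rewrite (eq_bigr (fun t => (y == t)%:R * (lam ^+ 2 * ((x == b1)%:R * ((y == b2)%:R * Mp i x t))))).
  by rewrite sum_pick.
move=> t _; rewrite -big_distrr /= t2 -mulnb natrM; ring.
Qed.

End TwoColours.

Fixpoint pad_ops (w D v n : nat) : seq op :=
  if D is D'.+1 then (v :: iota n w, w) :: pad_ops w D' v (n + w) else [::].

(** The initial vertices are the spins 0, ..., nv - 1, each its own first handle, and the centre
    [nv]. *)
Definition hyper_ops (w r s D : nat) (E : seq (nat * nat)) (nv : nat) : seq op :=
  graph_ops w r s E (iota 0 nv) nv.+1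
  ++ pad_ops w D nv (nv.+1 + size E * step_size w r s).

Definition created (ops : seq op) : nat := sumn (map snd ops).

Fixpoint in_range (n : nat) (ops : seq op) : bool :=
  if ops is (e, k) :: ops' then all (fun v => v < n + k) e && in_range (n + k) ops' else true.

Lemma in_range_cat n ops1 ops2 :
  in_range n (ops1 ++ ops2) = in_range n ops1 && in_range (n + created ops1) ops2.
Proof.
elim: ops1 n => [|[e k] ops IH] n /=; first by rewrite addn0.
by rewrite IH andbA addnA.
Qed.

Lemma created_cat ops1 ops2 : created (ops1 ++ ops2) = created ops1 + created ops2.
Proof. by rewrite /created map_cat sumn_cat. Qed.

Lemma created_path w r v n : created (path_ops w r v n) = r * w.
Proof. by elim: r v n => //= r IH v n; rewrite /created /= -/(created _) IH mulSn. Qed.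

Lemma created_step w r s hs uv n : created (step_ops w r s hs uv n) = step_size w r s.
Proof.
rewrite /step_ops !created_cat !created_path /created /= /step_size; lia.
Qed.

Lemma created_graph w r s E hs n :
  created (graph_ops w r s E hs n) = size E * step_size w r s.
Proof.
by elim: E hs n => //= uv E IH hs n; rewrite created_cat created_step IH mulSn.
Qed.

Lemma created_pad w D v n : created (pad_ops w D v n) = D * w.
Proof. by elim: D n => //= D IH n; rewrite /created /= -/(created _) IH mulSn. Qed.

(** * Evaluation of the whole hypergraph *)

Section EvalGraph.

Variables (R : comNzRingType) (q : nat) (i0 : 'I_q) (w0 r s : nat).
Notation w := w0.+2.
Local Open Scope ring_scope.

Section Graph.

Variables (U : R) (Ek : 'I_q -> 'I_q -> R).

Hypothesis gadget : forall x y b1 b2,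
  \sum_z T1 R w0 r s x b1 z * T2 R w0 r y z b2 = U * ((x == b1)%:R * ((y == b2)%:R * Ek x y)).

Lemma eval_graph E hs c :
  all (fun h => h < size c)%N hs ->
  all (fun uv => (uv.1 < size hs) && (uv.2 < size hs))%N E ->
  evalops i0 (graph_ops w r s E hs (size c)) (fun=> 1) c
    = U ^+ size E * \prod_(uv <- E) Ek (nth i0 c (nth 0%N hs uv.1)) (nth i0 c (nth 0%N hs uv.2)).
Proof.
elim: E hs c => [|uv E IH] hs c hhs; first by rewrite big_nil mulr1.
rewrite [graph_ops _ _ _ _ _ _]/= => /andP[/andP[hu hv] hE].
rewrite evalops_cat.
rewrite (eval_step gadget (G := fun t => U ^+ size E * \prod_(uv <- E) Ek (nth i0 t uv.1) (nth i0 t uv.2))) //.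
  rewrite big_cons exprS -!mulrA; congr (U * _); rewrite mulrCA; congr (_ * (_ * _)).
  rewrite big_seq [RHS]big_seq; apply: eq_bigr => xy /(allP hE)/andP[h1 h2].
  by rewrite !(nth_map 0%N).
move=> d hd; have -> : (size c + step_size w r s = size (c ++ d))%N by rewrite size_cat hd.
have ss : size (step_handles w r s hs uv (size c)) = size hs by rewrite size_step_handles.
rewrite IH ?ss //; last by rewrite size_cat hd; apply: step_handles_lt.
congr (_ * _); rewrite big_seq [RHS]big_seq; apply: eq_bigr => xy /(allP hE)/andP[h1 h2].
by rewrite !(nth_map 0%N) ?ss.
Qed.

End Graph.

Lemma eval_pad D v c : (v < size c)%N ->
  evalops i0 (pad_ops w D v (size c)) (fun=> 1) c = (Lr R q w0) ^+ D.
Proof.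
elim: D c => [|D IH] c hv //.
have -> : evalops i0 (pad_ops w D.+1 v (size c)) (fun=> 1) c = sumc (R := R) w (fun d =>
    (nae i0 (c ++ d) (v :: iota (size c) w))%:R
    * evalops i0 (pad_ops w D v (size c + w)) (fun=> 1) (c ++ d)) by [].
transitivity (sumc (R := R) w (fun d : seq 'I_q => (~~ constant (nth i0 c v :: [::] ++ d))%:R * Lr R q w0 ^+ D)).
  apply: eq_sumc => d hd.
  have -> : (size c + w = size (c ++ d))%N by rewrite size_cat hd.
  rewrite IH; last by rewrite size_cat ltn_addr.
  rewrite /nae map_cons nth_cat_old //; congr ((~~ constant (_ :: _))%:R * _).
  by have := map_nth_new i0 c d; rewrite hd.
by rewrite sumc_mulr sumc_nae /= exprS.
Qed.

Lemma nae_old c d e : all (fun v => v < size c)%N e -> nae i0 (c ++ d) e = nae i0 c e.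
Proof.
move=> he; rewrite /nae; congr (~~ constant _); apply/eq_in_map => v hv.
by rewrite nth_cat_old //; apply: (allP he).
Qed.

Lemma eval_factor ops F c e : all (fun v => v < size c)%N e ->
  (nae i0 c e)%:R * evalops i0 ops F c = evalops i0 ops (fun c => (nae i0 c e)%:R * F c) c :> R.
Proof.
elim: ops c => [|[e' k'] ops IH] c he //=.
rewrite -sumc_mull; apply: eq_sumc => d _; rewrite mulrCA -IH ?(nae_old _ he) //.
by apply: sub_all he => v; rewrite size_cat => hv; apply: ltn_addr.
Qed.

(** The factor of an edge concerns only existing vertices and passes through all later sums by
    [eval_factor]; the nested local sums thus merge into one sum over the colours of all the
    vertices. *)
Lemma sumc_evalops ops F n : in_range n ops ->
  sumc n (evalops i0 ops F)
  = sumc (n + created ops) (fun c => (all (nae i0 c) (map fst ops))%:R * F c) :> R.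
Proof.
elim: ops n F => [|[e k] ops IH] n F /=.
  by rewrite addn0 => _; apply: eq_sumc => c _; rewrite mul1r.
case/andP=> he hops; rewrite /created /= -/(created ops) addnA.
rewrite -(sumc_cat n k (fun c => (nae i0 c e)%:R * evalops i0 ops F c)).
transitivity (sumc (n + k) (evalops i0 ops (fun c => (nae i0 c e)%:R * F c))).
  by apply: eq_sumc => c hc; apply: eval_factor; rewrite hc.
rewrite IH //; apply: eq_sumc => c _; rewrite mulrA -natrM mulnb.
by rewrite andbC.
Qed.

End EvalGraph.

Lemma sumc_tuple (R : comNzRingType) q n (F : seq 'I_q -> R) :
  (sumc n F = \sum_(t : n.-tuple 'I_q) F t)%R.
Proof.
elim: n F => [|n IH] F /=.
  rewrite (big_pred1 [tuple]) // => t; apply/esym/eqP; exact: tuple0.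
rewrite (eq_bigr _ (fun a _ => IH _)) pair_big /=.
rewrite (reindex (fun p : 'I_q * n.-tuple 'I_q => cons_tuple p.1 p.2)) //=.
exists (fun t : n.+1.-tuple 'I_q => (thead t, behead_tuple t)) => [[a t] _|t _] /=.
  by congr pair; apply: val_inj.
by apply: val_inj; rewrite /= [in RHS](tuple_eta t).
Qed.

Lemma sumc_ffun (R : comNzRingType) q n (F : seq 'I_q -> R) :
  (sumc n F = \sum_(f : {ffun 'I_n -> 'I_q}) F (codom f))%R.
Proof.
rewrite sumc_tuple (reindex (fun f : {ffun 'I_n -> 'I_q} => [tuple f i | i < n])) /=.
  by apply: eq_bigr => f _; congr F.
exists (fun t : n.-tuple 'I_q => [ffun i => tnth t i]) => [f _|t _].
  by apply/ffunP => i; rewrite ffunE tnth_mktuple.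
by apply: eq_from_tnth => i; rewrite tnth_mktuple ffunE.
Qed.

(** * Counting modulo a number *)

Lemma Zp_eqmod P a b : 1 < P -> (a%:R = b%:R :> 'Z_P)%R -> a = b %[mod P].
Proof. by move=> hP /(congr1 (fun x : 'Z_P => x : nat)); rewrite !val_Zp_nat. Qed.

Lemma all_iota_lt n k : all (fun v => v < n + k) (iota n k).
Proof. by apply/allP => v; rewrite mem_iota => /andP[]. Qed.

Lemma in_range_path w r v n : 0 < w -> v < n -> in_range n (path_ops w r v n).
Proof.
move=> w0; elim: r v n => //= r IH v n hv.
by rewrite all_iota_lt ltn_addr // IH //; lia.
Qed.

Lemma in_range1 n e k : in_range n [:: (e, k)] = all (fun v => v < n + k) e.
Proof. by rewrite /= andbT. Qed.

Lemma created1 e k : created [:: (e, k)] = k.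
Proof. exact: addn0. Qed.

Lemma in_range_step w r s hs uv n : 1 < w -> all (fun h => h < n) hs ->
  uv.1 < size hs -> uv.2 < size hs -> in_range n (step_ops w r s hs uv n).
Proof.
move=> w1 hh hu hv; have w0 : 0 < w by lia.
have hul : nth 0 hs uv.1 < n := all_nthP 0 hh _ hu.
have hvl0 : nth 0 hs uv.2 < n := all_nthP 0 hh _ hv.
rewrite /step_ops /step_out; cbn [fst snd].
rewrite !in_range_cat !created_path !created1 !in_range1 [all _ (_ :: _)]/= [all _ (_ :: _ :: _)]/= !all_iota_lt.
move e1: (n + r * w) => n1; move e2: (n1 + w) => n2; move e3: (n2 + r * w) => n3.
move e4: (n3 + s * w) => n4; move e5: (n4 + r * w) => n5.
have a1 : path_end w r (nth 0 hs uv.1) n < n1 by rewrite -e1; apply: path_end_lt.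
have o1 : path_end w r n1 n2 < n3 by rewrite -e3; apply: path_end_lt; lia.
have hvl : nth 0 (set_nth 0 hs uv.1 (path_end w r n1 n2)) uv.2 < n4.
  by rewrite nth_set_nth /=; case: eqP => _; lia.
move: (nth 0 (set_nth _ _ _ _) _) hvl => h_v hvl.
have a2 : path_end w r h_v n4 < n5 by rewrite -e5; apply: path_end_lt.
have z1 : path_end w s n1.+1 n3 < n4 by rewrite -e4; apply: path_end_lt; lia.
by rewrite !in_range_path ?andbT //; lia.
Qed.

Lemma in_range_graph w r s E hs n : 1 < w -> all (fun h => h < n) hs ->
  all (fun uv => (uv.1 < size hs) && (uv.2 < size hs)) E ->
  in_range n (graph_ops w r s E hs n).
Proof.
move=> w1; elim: E hs n => //= uv E IH hs n hh /andP[/andP[hu hv] hE].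
rewrite in_range_cat in_range_step //= created_step; apply: IH.
  exact: step_handles_lt.
by rewrite size_step_handles.
Qed.

Lemma in_range_pad w D v n : v < n -> in_range n (pad_ops w D v n).
Proof.
elim: D n => //= D IH n hv; rewrite all_iota_lt ltn_addr //= IH //.
by rewrite ltn_addr.
Qed.

Definition spins_in (nv : nat) (E : seq (nat * nat)) : bool :=
  all (fun uv => (uv.1 < nv) && (uv.2 < nv)) E.

Lemma in_range_hyper w r s D E nv : 1 < w -> spins_in nv E ->
  in_range nv.+1 (hyper_ops w r s D E nv).
Proof.
move=> w1 hE; rewrite in_range_cat created_graph in_range_pad ?andbT.
  apply: in_range_graph => //; last by rewrite size_iota.
  by apply/allP => v; rewrite mem_iota; lia.
by rewrite ltn_addr.
Qed.

Definition mono {q} (i0 : 'I_q) (E : seq (nat * nat)) (t : seq 'I_q) : nat :=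
  count (fun uv => nth i0 t uv.1 == nth i0 t uv.2) E.

Definition ncol {q} (i0 : 'I_q) (n : nat) (es : seq (seq nat)) : nat :=
  #|[set f : {ffun 'I_n -> 'I_q} | all (nae i0 (codom f)) es]|.

Definition nmono {q} (i0 : 'I_q) (nv : nat) (E : seq (nat * nat)) (t : nat) : nat :=
  #|[set f : {ffun 'I_nv -> 'I_q} | mono i0 E (codom f) == t]|.

Lemma nmono_le q (i0 : 'I_q) nv E t : nmono i0 nv E t <= q ^ nv.
Proof.
apply: leq_trans (max_card _) _.
by rewrite card_ffun !card_ord.
Qed.

Section Count.

Variables (q : nat) (i0 : 'I_q) (w0 : nat).
Notation w := w0.+2.

Lemma ncol_sumc (R : comNzRingType) n es :
  ((ncol i0 n es)%:R = sumc n (fun c => (all (nae i0 c) es)%:R) :> R)%R.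
Proof.
rewrite sumc_ffun /ncol -sum1dep_card natr_sum big_mkcond /=.
by apply: eq_bigr => f _; case: ifP.
Qed.

Lemma ncol_evalops (R : comNzRingType) n ops : in_range n ops ->
  ((ncol i0 (n + created ops) (map fst ops))%:R = sumc n (evalops i0 ops (fun=> 1)) :> R)%R.
Proof.
move=> h; rewrite sumc_evalops // ncol_sumc; apply: eq_sumc => c _.
by rewrite mulr1.
Qed.

Lemma evalops_const (R : comNzRingType) ops F c (x : R) :
  (forall d, size d = created ops -> F (c ++ d) = x) ->
  evalops i0 ops F c = (evalops i0 ops (fun=> 1) c * x)%R.
Proof.
elim: ops c => [|[e k] ops IH] c h /=; first by rewrite mul1r -(h [::]) ?cats0.
rewrite -sumc_mulr; apply: eq_sumc => d hd; rewrite -mulrA; congr (_ * _)%R.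
apply: IH => d' hd'; rewrite -catA h // size_cat hd hd'.
by rewrite /created /= addnC.
Qed.

Definition main_edges r s E nv := map fst (graph_ops w r s E (iota 0 nv) nv.+1).
Definition main_size r s (E : seq (nat * nat)) nv := nv.+1 + size E * step_size w r s.
Definition all_edges r s D E nv := map fst (hyper_ops w r s D E nv).
Definition all_size r s D (E : seq (nat * nat)) nv := main_size r s E nv + D * w.

(** Whatever the colour of the centre, each of its edges leaves L = q^w - 1 ways to colour its new
    vertices, so the centre can be divided out of the count. *)
Lemma ncol_pad r s D E nv : 0 < q -> spins_in nv E ->
  ncol i0 (all_size r s D E nv) (all_edges r s D E nv)
  = ncol i0 (main_size r s E nv) (main_edges r s E nv) * (q ^ w - 1) ^ D.
Proof.
(* [Lr] contains a subtraction, hence the detour through [int]. *)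
move=> q0 hE; apply/eqP; rewrite -(Num.Theory.eqr_nat int); apply/eqP.
have L1 : (Lr int q w0 = (q ^ w - 1)%:R)%R.
  by rewrite natrB // expn_gt0 q0.
rewrite natrM natrX -L1.
have hg : in_range nv.+1 (graph_ops w r s E (iota 0 nv) nv.+1).
  apply: in_range_graph => //; last by rewrite size_iota.
  by apply/allP => v; rewrite mem_iota; lia.
have := @ncol_evalops int nv.+1 (hyper_ops w r s D E nv).
rewrite in_range_hyper // {1}/hyper_ops created_cat created_graph created_pad addnA => /(_ isT) ->.
have := @ncol_evalops int nv.+1 _ hg; rewrite created_graph => ->.
rewrite -sumc_mulr; apply: eq_sumc => c hc.
rewrite evalops_cat; apply: evalops_const => d; rewrite created_graph => hd.
have -> : nv.+1 + size E * step_size w r s = size (c ++ d) by rewrite size_cat hc hd.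
by apply: eval_pad; rewrite size_cat hc ltn_addr.
Qed.

(* The legs of the gadgets act on the colours of the endpoints of a spin edge by
   [es] when these are equal and by [ed] when they differ. *)
Lemma ncol_main (R : comNzRingType) r s (U es ed : R) E nv :
  (forall x y b1 b2 : 'I_q, \sum_z T1 R w0 r s x b1 z * T2 R w0 r y z b2
     = U * ((x == b1)%:R * ((y == b2)%:R * (if x == y then es else ed))))%R ->
  spins_in nv E ->
  ((ncol i0 (main_size r s E nv) (main_edges r s E nv))%:R
   = q%:R * (U ^+ size E * \sum_(f : {ffun 'I_nv -> 'I_q})
       es ^+ mono i0 E (codom f) * ed ^+ (size E - mono i0 E (codom f))) :> R)%R.
Proof.
move=> gadget hE.
have hh : all (fun h => h < nv.+1) (iota 0 nv) by apply/allP => v; rewrite mem_iota; lia.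
have hE' : all (fun uv => (uv.1 < size (iota 0 nv)) && (uv.2 < size (iota 0 nv))) E.
  by rewrite size_iota.
have hg := in_range_graph r s (n := nv.+1) (isT : 1 < w) hh hE'.
have := @ncol_evalops R nv.+1 _ hg; rewrite created_graph => ->.
pose W (t : seq 'I_q) : R := (U ^+ size E * (es ^+ mono i0 E t * ed ^+ (size E - mono i0 E t)))%R.
rewrite -addn1 (eq_sumc (G := fun c => W (take nv c))); last first.
  move=> c hc; have {1}-> : nv + 1 = size c by rewrite hc.
  rewrite (eval_graph i0 gadget) ?hc ?addn1 //; congr (_ * _)%R.
  set t := take nv c; have tE v : v < nv -> nth i0 c (nth 0 (iota 0 nv) v) = nth i0 t v.
    by move=> hv; rewrite nth_iota // nth_take.
  transitivity (\prod_(uv <- E) (if nth i0 t uv.1 == nth i0 t uv.2 then es else ed))%R.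
    by rewrite big_seq [RHS]big_seq; apply: eq_bigr => uv /(allP hE)/andP[h1 h2]; rewrite !tE.
  rewrite /mono; elim: {hE hE' hg W} E => [|uv E IH]; first by rewrite big_nil mul1r.
  rewrite big_cons IH /=; have := count_size (fun uv => nth i0 t uv.1 == nth i0 t uv.2) E.
  case: eqP => _ /= hc'; first by rewrite add1n subSS exprS mulrA.
  by rewrite add0n subSn // exprS mulrCA.
(* The centre lies in no edge of the main part, so its colour is free and gives the factor q. *)
rewrite sumc_cat (eq_sumc (G := fun c => q%:R * W c)%R); last first.
  move=> c hc; rewrite (eq_sumc (G := fun=> W c)); last by move=> d _; rewrite take_size_cat.
  by rewrite sumc_const expn1.
by rewrite sumc_mull; congr (_ * _)%R; rewrite sumc_mull sumc_ffun.
Qed.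

End Count.

Section Digit.

Variables (q : nat) (i0 : 'I_q) (nv : nat) (E : seq (nat * nat)) (t : nat).

Notation mf f := (mono i0 E (codom (f : {ffun 'I_nv -> 'I_q}))).

Hypothesis min_mono : forall f : {ffun 'I_nv -> 'I_q}, t <= mf f.

(** Configurations above the minimum are multiples of B^(t+1); at the minimum the cofactor matters
    only modulo B, where it is 1. *)
Lemma sum_digit B (c : {ffun 'I_nv -> 'I_q} -> nat) : (forall f, c f = 1 %[mod B]) ->
  \sum_f B ^ mf f * c f = nmono i0 nv E t * B ^ t %[mod B ^ t.+1].
Proof.
move=> hc; rewrite /nmono -sum1dep_card big_distrl /= [in RHS]big_mkcond /=.
apply: (big_ind2 (fun x y => x = y %[mod B ^ t.+1])) => // [x1 x2 y1 y2 h1 h2|f _].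
  by rewrite -modnDm h1 h2 modnDm.
case: eqP => [->|ne]; first by rewrite expnS [_ * c f]mulnC -!muln_modl hc.
have lt : t < mf f by have := min_mono f; lia.
by rewrite -(subnK lt) expnD mulnAC modnMl mod0n.
Qed.

End Digit.

Lemma mono_dup q (i0 : 'I_q) j E t : mono i0 (flatten (nseq j E)) t = j * mono i0 E t.
Proof. by elim: j => //= j IH; rewrite /mono count_cat -/(mono _ _ _) mulSn -IH. Qed.

Lemma size_dup (T : Type) j (E : seq T) : size (flatten (nseq j E)) = j * size E.
Proof. by elim: j => //= j IH; rewrite size_cat IH mulSn. Qed.

Lemma spins_in_dup nv j E : spins_in nv E -> spins_in nv (flatten (nseq j E)).
Proof. by move=> h; elim: j => //= j IH; rewrite /spins_in all_cat -!/(spins_in _ _) h. Qed.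

Lemma digit_value N B t : N < B -> (N * B ^ t) %% B ^ t.+1 = N * B ^ t.
Proof.
move=> h; rewrite modn_small // expnS ltn_pmul2r // expn_gt0.
by case: B h.
Qed.

(** ** At least three colours *)

Section ManyColours.

Variables (q : nat) (i0 : 'I_q) (w0 : nat).
Hypothesis q3 : 2 < q.

(** Even, so that the signs of the weights cancel; and (q - 1)^2 > q for q > 2, so that [many_base]
    exceeds q^(nv+1) and the wanted number fits into one digit. *)
Definition copies (nv : nat) : nat := 2 * nv.+1.
Definition many_base (nv : nat) : nat := (q - 1) ^ copies nv.
(* [(q - 1) ^ many_len nv t] is the modulus [many_base nv ^ t.+1]. *)
Definition many_len (nv t : nat) : nat := copies nv * t.+1.

Lemma many_base_gt nv : q * q ^ nv < many_base nv.
Proof.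
rewrite -expnS /many_base /copies expnM ltn_exp2r //.
have -> : (q - 1) ^ 2 = (q - 1) * (q - 1) by [].
have [p ->] : exists p, q = p.+3 by exists (q - 3); lia.
by rewrite subn1 /=; nia.
Qed.

Lemma many_colours nv E t : spins_in nv E ->
  (forall f : {ffun 'I_nv -> 'I_q}, t <= mono i0 E (codom f)) ->
  let E' := flatten (nseq (copies nv) E) in
  (q ^ size E' * ncol i0 (main_size w0 0 (many_len nv t) E' nv)
                         (main_edges w0 0 (many_len nv t) E' nv)) %% many_base nv ^ t.+1
  = q * nmono i0 nv E t * many_base nv ^ t.
Proof.
move=> hE min E'; set B := many_base nv; set K := many_len nv t.
have qN : q * nmono i0 nv E t < B.
  by apply: leq_ltn_trans (many_base_gt nv); rewrite leq_mul2l nmono_le orbT.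
have B1 : 1 < B.
  by apply: leq_ltn_trans (many_base_gt nv); rewrite -expnS; apply: leq_trans (leq_pexp2l _ (_ : 1 <= nv.+1)); lia.
set P := B ^ t.+1.
have P1 : 1 < P by rewrite /P -{1}(exp1n t.+1) ltn_exp2r.
pose R : comNzRingType := 'Z_P.
have eK : ~~ odd K by rewrite /K /many_len /copies !oddM.
have q1 : ((q - 1)%:R = q%:R - 1 :> R)%R by rewrite natrB //; lia.
(* L = q^w - 1 is a multiple of q - 1, and (q - 1)^K is the modulus. *)
have L0 : (Lr R q w0 ^+ K = 0)%R.
  rewrite /Lr natrX subrX1 -q1 exprMn_comm; last exact: mulrC.
  rewrite -natrX /K /many_len expnM -/(many_base nv) -/B -/P.
  by rewrite pchar_Zp // mul0r.
have hk : (q%:R * kap R q w0 K = -1)%R.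
  by rewrite q_kap L0 -signr_odd (negPf eK) expr0 sub0r.
have gad : forall x y b1 b2 : 'I_q, (\sum_z T1 R w0 0 K x b1 z * T2 R w0 0 y z b2
    = 1 * ((x == b1)%:R * ((y == b2)%:R * (if x == y then 1 + kap R q w0 K else kap R q w0 K))))%R.
  move=> x y b1 b2; rewrite gadget_projection //.
  by case: (x == y); rewrite ?add0r.
have hE' : spins_in nv E' by apply: spins_in_dup.
have main := ncol_main i0 gad hE'.
have sE' : size E' = copies nv * size E by rewrite size_dup.
have sgn n : ((-1) ^+ (copies nv * n) = 1 :> R)%R.
  by rewrite -signr_odd /copies !oddM.
have cong : (q ^ size E' * ncol i0 (main_size w0 0 K E' nv) (main_edges w0 0 K E' nv)
    = q * \sum_(f : {ffun 'I_nv -> 'I_q}) B ^ mono i0 E (codom f) * 1 %[mod P]).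
  apply: Zp_eqmod => //; rewrite !natrM main expr1n mul1r mulrCA; congr (_ * _)%R.
  rewrite natr_sum big_distrr /=; apply: eq_bigr => f _.
  have le : mono i0 E' (codom f) <= size E' by apply: count_size.
  (* One factor q for each edge turns the weights 1 + kap and kap into q - 1 and -1. *)
  rewrite -{1}(subnKC le) natrX exprD mulrACA -!exprMn mulrDr mulr1 hk -q1.
  rewrite mono_dup sE' -mulnBr sgn mulr1 muln1 natrX exprM.
  by rewrite /B /many_base natrX.
rewrite cong -modnMmr (sum_digit min) // modnMmr mulnA digit_value //.
Qed.

End ManyColours.

(** ** Two colours *)

Section TwoColours.

Variables (i0 : 'I_2) (w0 : nat).

Notation L := (2 ^ w0.+2 - 1).

(** Odd, so that equal colours get kap - 1 = B and unequal ones kap = B + 1, where B is [two_base];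
    long enough for B to exceed 2 * 2^nv. *)
Definition two_wire (nv : nat) : nat := (2 * nv).+3.
Definition two_base (nv : nat) : nat := (L ^ two_wire nv) %/ 2.
(** Even, as the legs of a unit must be, and so large that the modulus exceeds the whole weighted
    sum. *)
Definition two_half (nv ne : nat) : nat := 2 * (nv + two_wire nv * ne + 2).
(** For c = kap h one has 2c + 1 = L^h, and 2^w0 (2c + 1)^2 - c(c + 1), which must vanish for
    [unit_equality], is (L (2c + 1)^2 + 1)/4. *)
Definition two_modulus (nv ne : nat) : nat := (L ^ (2 * two_half nv ne).+1 + 1) %/ 4.

Lemma L_ge3 : 3 <= L.
Proof. by have := @leq_pexp2l 2 2 w0.+2 isT isT; lia. Qed.

Lemma odd_L : odd L.
Proof. by rewrite oddB ?expn_gt0 // oddX /=. Qed.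

Lemma two_baseE nv : (two_base nv).*2.+1 = L ^ two_wire nv.
Proof.
have := odd_double_half (L ^ two_wire nv); rewrite oddX odd_L orbT.
by rewrite /two_base divn2 add1n.
Qed.

(** L is -1 modulo 4, and so are its odd powers. *)
Lemma two_modulusE nv ne : 4 * two_modulus nv ne = L ^ (2 * two_half nv ne).+1 + 1.
Proof.
rewrite mulnC divnK // expnS expnM -[L in L * _](_ : 4 * (2 ^ w0 - 1) + 3 = _); last first.
  by rewrite !expnS; have := expn_gt0 2 w0; lia.
have e : L ^ 2 = 1 %[mod 4].
  have [k ->] : exists k, L = k.*2.+1 by exists L./2; rewrite -[LHS]odd_double_half odd_L.
  have -> : k.*2.+1 ^ 2 = (k * k.+1) * 4 + 1 by rewrite -mulnn -muln2; nia.
  by rewrite modnMDl.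
have e' n : (L ^ 2) ^ n = 1 %[mod 4] by rewrite -modnXm e modnXm exp1n.
by rewrite /dvdn -modnDml -modnMm e' modnMm muln1 modnDml -addnA (mulnC 4) modnMDl.
Qed.

(** The value of kap comes from [q_kap] by cancelling 2, which is possible in [int] but perhaps not
    modulo P. *)
Lemma kap_int (R : comNzRingType) r : kap R 2 w0 r = ((kap int 2 w0 r)%:~R)%R.
Proof.
elim: r => [|r IH] //=; rewrite IH rmorphD !rmorphM /= rmorphXn rmorphN1.
by rewrite !rmorph_nat /Lr rmorphB /= rmorph_nat rmorph1.
Qed.

Lemma kap_nat (R : comNzRingType) r a : (2 * a + 1 = L ^ r + (odd r).*2) ->
  kap R 2 w0 r = (a%:R)%R.
Proof.
move=> h; rewrite kap_int; suff -> : (kap int 2 w0 r = a%:R)%R by rewrite rmorph_nat.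
have L1 : (Lr int 2 w0 = L%:R)%R by rewrite natrB ?expn_gt0.
have := q_kap int 2 w0 r; rewrite L1 -natrX -signr_odd !natz => e.
move: h e; move: (L ^ r) (kap _ _ _ _) => x y.
by case: (odd r); rewrite ?expr1 ?expr0; lia.
Qed.

Lemma two_base_gt nv : 2 * 2 ^ nv < two_base nv.
Proof.
have h3 : 3 ^ two_wire nv <= L ^ two_wire nv by rewrite leq_exp2r ?L_ge3.
have : 3 ^ two_wire nv = 27 * 9 ^ nv by rewrite /two_wire !expnS expnM -[3 ^ 2]/9; lia.
have : 2 ^ nv <= 9 ^ nv by case: (nv) => // n; rewrite leq_exp2r.
have := expn_gt0 2 nv; have := two_baseE nv; lia.
Qed.

Lemma two_modulus_gt nv ne : 2 * 2 ^ nv * (two_base nv).+1 ^ ne < two_modulus nv ne.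
Proof.
have L3 := L_ge3; have L0 : 0 < L by lia.
have h1 : (two_base nv).+1 <= L ^ two_wire nv by have := two_baseE nv; lia.
have h2 : 2 * 2 ^ nv <= L ^ nv.+1 by rewrite -expnS leq_exp2r; lia.
have h3 : 2 * 2 ^ nv * (two_base nv).+1 ^ ne <= L ^ (nv.+1 + two_wire nv * ne).
  rewrite expnD expnM leq_mul //; case: (ne) => // n; by rewrite leq_exp2r.
apply: leq_ltn_trans h3 _.
have h4 : L ^ (nv.+1 + two_wire nv * ne) * 9 <= L ^ (2 * two_half nv ne).+1.
  have : 9 <= L ^ 2 by rewrite -[9]/(3 ^ 2) leq_exp2r.
  have : L ^ (nv.+1 + two_wire nv * ne + 2) <= L ^ (2 * two_half nv ne).+1.
    by rewrite leq_pexp2l // /two_half; lia.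
  by rewrite expnD; nia.
have h5 : 0 < L ^ (nv.+1 + two_wire nv * ne) by rewrite expn_gt0 L0.
by have := two_modulusE nv ne; lia.
Qed.

Lemma two_colours nv E t : spins_in nv E -> ~~ odd (size E) ->
  (forall f : {ffun 'I_nv -> 'I_2}, t <= mono i0 E (codom f)) ->
  let ne := size E in let h := two_half nv ne in
  let s := h + two_wire nv + h in
  ((L ^ ne * ncol i0 (main_size w0 h s E nv) (main_edges w0 h s E nv))
     %% two_modulus nv ne) %% two_base nv ^ t.+1
  = 2 * nmono i0 nv E t * two_base nv ^ t.
Proof.
move=> hE even min ne h s; set B := two_base nv; set P := two_modulus nv ne.
have P1 : 1 < P.
  by apply: leq_ltn_trans (two_modulus_gt nv ne); rewrite muln_gt0 !expn_gt0 /=; lia.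
pose R : comNzRingType := 'Z_P.
have eh : ~~ odd h by rewrite /h /two_half oddM.
have oi : odd (two_wire nv) by rewrite /two_wire /= oddM.
have oL : odd (L ^ h) by rewrite oddX odd_L orbT.
set c := (L ^ h) %/ 2; have cE : 2 * c + 1 = L ^ h.
  by have := odd_double_half (L ^ h); rewrite oL /c divn2; lia.
have kc : (kap R 2 w0 h = c%:R)%R by apply: kap_nat; rewrite cE (negPf eh) addn0.
have kB : (kap R 2 w0 (two_wire nv) = B.+1%:R)%R.
  by apply: kap_nat; rewrite oi -two_baseE; lia.
have Lh : 4 * P = L * (2 * c + 1) ^ 2 + 1.
  by rewrite /P two_modulusE expnS (mulnC 2) expnM -/h cE.
have lamE : (1 + 2%:R * c%:R = (2 * c + 1)%:R :> R)%R by rewrite natrD natrM addrC.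
have hc : ((2 ^ w0)%:R * (1 + 2%:R * kap R 2 w0 h) ^+ 2 = kap R 2 w0 h * (1 + kap R 2 w0 h))%R.
  have e : 2 ^ w0 * (2 * c + 1) ^ 2 = c * c.+1 + P.
    move: Lh; rewrite !expnS expn0; have := expn_gt0 2 w0; move: (2 ^ w0) => x; nia.
  rewrite kc lamE; have -> : (1 + c%:R = c.+1%:R :> R)%R by rewrite -natr1 addrC.
  by rewrite -natrX -!natrM e natrD pchar_Zp // addr0.
have gad : forall x y b1 b2 : 'I_2, (\sum_z T1 R w0 h s x b1 z * T2 R w0 h y z b2
    = (1 + 2%:R * kap R 2 w0 h) ^+ 2
      * ((x == b1)%:R * ((y == b2)%:R * (if x == y then B%:R else B.+1%:R))))%R.
  move=> x y b1 b2; rewrite gadget_two_colours // Mp_E kB -signr_odd oi expr1 -natr1.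
  by congr (_ * (_ * (_ * _)))%R; case: (x == y) => /=; ring.
have main := ncol_main i0 gad hE.
have sgn : ((-1) ^+ ne = 1 :> R)%R by rewrite -signr_odd (negPf even).
(* This is [Lh] modulo P. A factor L for each edge thus turns the scalars of the gadgets into signs,
   and the number of edges is even. *)
have Llam : (L%:R * (1 + 2%:R * kap R 2 w0 h) ^+ 2 = -1 :> R)%R.
  rewrite kc lamE -natrX -natrM; apply/eqP; rewrite -addr_eq0 natr1 -addn1 -Lh.
  by rewrite natrM pchar_Zp // mulr0.
set S := \sum_(f : {ffun 'I_nv -> 'I_2}) B ^ mono i0 E (codom f) * B.+1 ^ (ne - mono i0 E (codom f)).
have cong : L ^ ne * ncol i0 (main_size w0 h s E nv) (main_edges w0 h s E nv) = 2 * S %[mod P].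
  apply: Zp_eqmod => //; rewrite !natrM main natrX mulrCA; congr (_ * _)%R.
  rewrite mulrA -exprMn Llam sgn mul1r natr_sum; apply: eq_bigr => f _.
  by rewrite natrM !natrX.
(* P has no relation to powers of B, so the sum itself must be recovered, as an integer, before its
   digits can be read. *)
have SP : 2 * S < P.
  apply: leq_ltn_trans (two_modulus_gt nv ne); rewrite -mulnA leq_mul2l /=.
  apply: (@leq_trans (\sum_(f : {ffun 'I_nv -> 'I_2}) B.+1 ^ ne)); last first.
    by rewrite sum_nat_const card_ffun !card_ord.
  apply: leq_sum => f _; have le : mono i0 E (codom f) <= ne by apply: count_size.
  rewrite -[X in _ <= _ ^ X](subnKC le) expnD leq_mul2r; apply/orP; right.
  by case: (mono _ _ _) => // n; rewrite leq_exp2r.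
have qN : 2 * nmono i0 nv E t < B.
  by apply: leq_ltn_trans (two_base_gt nv); rewrite leq_mul2l nmono_le orbT.
rewrite cong (modn_small SP) -modnMmr (sum_digit min); last first.
  (* B + 1 is 1 modulo B, so edges with unequal ends leave the digit alone. *)
  by move=> f; rewrite -modnXm -addn1 modnDl modnXm exp1n.
by rewrite modnMmr mulnA digit_value.
Qed.

End TwoColours.

(** ** The class of the hypergraph *)

Definition old (o : op) : seq nat := take (size o.1 - o.2) o.1.
Definition olds (ops : seq op) : seq nat := flatten (map old ops).

(** Every edge creates at least one vertex and lists the created ones last. The degree of a vertex
    is then its multiplicity in [olds], plus one if an edge created it. *)
Fixpoint ops_wf (m n : nat) (ops : seq op) : bool :=
  if ops is o :: ops' then
    [&& 0 < o.2, o.1 == old o ++ iota n o.2, all (fun v => v < n) (old o), uniq (old o),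
        size o.1 == m & ops_wf m (n + o.2) ops']
  else true.

Lemma olds_cat ops1 ops2 : olds (ops1 ++ ops2) = olds ops1 ++ olds ops2.
Proof. by rewrite /olds map_cat flatten_cat. Qed.

Lemma old_cat l n k : old (l ++ iota n k, k) = l.
Proof. by rewrite /old /= size_cat size_iota addnK take_size_cat. Qed.

Lemma olds_cons l n k ops : olds ((l ++ iota n k, k) :: ops) = l ++ olds ops.
Proof. by rewrite /olds /= old_cat. Qed.

Lemma ops_wf_cat m n ops1 ops2 :
  ops_wf m n (ops1 ++ ops2) = ops_wf m n ops1 && ops_wf m (n + created ops1) ops2.
Proof.
elim: ops1 n => [|o ops IH] n /=; first by rewrite addn0.
by rewrite IH !andbA addnA.
Qed.

Lemma ops_wf_cons m n l k ops : ops_wf m n ((l ++ iota n k, k) :: ops) =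
  [&& 0 < k, all (fun v => v < n) l, uniq l, size l + k == m & ops_wf m (n + k) ops].
Proof. by rewrite /= old_cat eqxx size_cat size_iota. Qed.

Section Gadget.

Variable w : nat.
Hypothesis w1 : 1 < w.

Lemma wf_path r v n : v < n -> ops_wf w.+1 n (path_ops w r v n).
Proof.
elim: r v n => [//|r IH] v n hv.
rewrite [path_ops _ _ _ _]/= -[v :: _]/([:: v] ++ iota n w) ops_wf_cons [size _]/= add1n eqxx.
by rewrite IH ?[all _ _]/= ?hv //=; lia.
Qed.

(** An accounting of uses: being open is the right to occur once more as an old vertex. A path
    spends the right of [v], grants one to each vertex that it creates, and keeps that of its
    end. *)
Lemma count_path x r v n : v < n ->
  count_mem x (olds (path_ops w r v n)) + (path_end w r v n == x)
  <= (v == x) + ((n <= x) && (x < n + r * w)).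
Proof.
elim: r v n => [|r IH] v n hv; first by rewrite /= leq_addr.
rewrite [path_ops _ _ _ _]/= -[v :: _]/([:: v] ++ iota n w) olds_cons count_cat.
rewrite -(path_endS w r v n); have := IH n (n + w) (_ : n < n + w).
move=> /(_ ltac:(lia)); rewrite /= mulSn.
lia.
Qed.

Lemma count_set_nth x hs u o : u < size hs ->
  count_mem x (set_nth 0 hs u o) + (nth 0 hs u == x) = count_mem x hs + (o == x).
Proof.
elim: hs u => [|h hs IH] [|u] //= hu; first by lia.
by rewrite -addnA IH // addnA.
Qed.

Variables (r s : nat).

(** Handles are the rights that are carried along: a gadget spends those of its two endpoints and
    returns two fresh ones, so every vertex of the graph part is old at most once. *)
Lemma step_wf hs uv n : all (fun h => h < n) hs -> uv.1 < size hs -> uv.2 < size hs ->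
  ops_wf w.+1 n (step_ops w r s hs uv n) /\
  forall x, count_mem x (olds (step_ops w r s hs uv n)) + count_mem x (step_handles w r s hs uv n)
    <= count_mem x hs + ((n <= x) && (x < n + step_size w r s)).
Proof.
move=> hh hu hv.
have hul : nth 0 hs uv.1 < n := all_nthP 0 hh _ hu.
have hvl0 : nth 0 hs uv.2 < n := all_nthP 0 hh _ hv.
have ss : size (set_nth 0 hs uv.1 (step_out w r s n).1) = size hs by rewrite size_set_nth; lia.
move: ss; rewrite /step_ops /step_handles /step_out /step_size; cbn [fst snd].
move e1: (n + r * w) => n1; move e2: (n1 + w) => n2; move e3: (n2 + r * w) => n3.
move e4: (n3 + s * w) => n4; move e5: (n4 + r * w) => n5; move e6: (n5 + w.-1) => n6 ss.
set hu' := nth 0 hs uv.1; set o1 := path_end w r n1 n2; set o2 := path_end w r n5 n6.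
set hs1 := set_nth 0 hs uv.1 o1; set hv' := nth 0 hs1 uv.2.
set a := path_end w r hu' n; set z := path_end w s n1.+1 n3; set a2 := path_end w r hv' n4.
have l01 : n <= n1 by rewrite -e1 leq_addr.
have l12 : n1.+1 < n2 by rewrite -e2; move: w1; clear; lia.
have l23 : n2 <= n3 by rewrite -e3 leq_addr.
have l34 : n3 <= n4 by rewrite -e4 leq_addr.
have l45 : n4 <= n5 by rewrite -e5 leq_addr.
have l56 : n5 < n6 by rewrite -e6; move: w1; clear; lia.
have al : a < n1 by rewrite -e1; apply: path_end_lt; rewrite // ltnW.
have o1l : o1 < n3 by rewrite -e3; apply: path_end_lt; lia.
have o1n : o1 = n1 \/ n2 <= o1 by rewrite /o1; case: (r) => [|r'] /=; [left | right; lia].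
have zl : z < n4 by rewrite -e4; apply: path_end_lt; lia.
have zn : z = n1.+1 \/ n3 <= z by rewrite /z; case: (s) => [|s'] /=; [left | right; lia].
have hvE : hv' = o1 \/ hv' < n.
  by rewrite /hv' nth_set_nth /=; case: eqP => _; [left | right].
have hvl : hv' < n3 by lia.
have a2l : a2 < n5 by rewrite -e5; apply: path_end_lt; lia.
have a2n : a2 = hv' \/ n4 <= a2 by rewrite /a2; case: (r) => [|r'] /=; [left | right; lia].
split.
  rewrite !ops_wf_cat !created_path !created1 e1 e2 e3 e4 e5 e6.
  rewrite -[a :: iota n1 w]/([:: a] ++ iota n1 w) -[a2 :: _ :: iota _ _]/([:: a2; z] ++ iota n5 w.-1).
  rewrite !ops_wf_cons !wf_path //=; try lia.
  by rewrite inE; lia.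
move=> x.
rewrite -[a :: iota n1 w]/([:: a] ++ iota n1 w) -[a2 :: _ :: iota _ _]/([:: a2; z] ++ iota n5 w.-1).
rewrite !olds_cat !olds_cons !count_cat /=.
have cA := count_path x r (hul : hu' < n).
have cB := count_path x r (ltnW l12 : n1 < n2).
have cC := count_path x s (leq_trans l12 l23 : n1.+1 < n3).
have cD := count_path x r (leq_trans hvl l34 : hv' < n4).
have cF := count_path x r (l56 : n5 < n6).
have h1 := count_set_nth x o1 hu; rewrite -/hs1 in h1.
have hv1 : uv.2 < size hs1 by rewrite ss.
have h2 := count_set_nth x o2 hv1.
have u1 : (n1 == x) + (n1.+1 == x) <= (n1 <= x) && (x < n2).
  move: l12; clear; case: eqP => [<-|_]; last by case: eqP => [<-|_] //; lia.
  by rewrite leqnn (gtn_eqF (ltnSn _)) => /ltnW ->.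
have u2 : (n5 == x) <= (n5 <= x) && (x < n6).
  by move: l56; clear; case: eqP => [<-|_] // ->; rewrite leqnn.
have iv b c d : b <= c -> c <= d -> ((b <= x) && (x < c)) + ((c <= x) && (x < d)) = (b <= x) && (x < d).
  by clear; case: (leqP b x); case: (leqP c x); case: (ltnP x d); lia.
have -> : n + (r * w + w + r * w + s * w + r * w + w.-1 + r * w) = n6 + r * w.
  by move: e1 e2 e3 e4 e5 e6; clear; lia.
have i1 := iv n n1 n2 l01 (ltnW (ltnW l12)).
have l02 := leq_trans l01 (ltnW (ltnW l12)); have i2 := iv n n2 n3 l02 l23.
have l03 := leq_trans l02 l23; have i3 := iv n n3 n4 l03 l34.
have l04 := leq_trans l03 l34; have i4 := iv n n4 n5 l04 l45.
have l05 := leq_trans l04 l45; have i5 := iv n n5 n6 l05 (ltnW l56).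
have i6 := iv n n6 (n6 + r * w) (leq_trans l05 (ltnW l56)) (leq_addr _ _).
rewrite -/hu' -/hv' -/a -/o1 -/z -/a2 -/o2 in cA cB cC cD cF h1 h2 *.
rewrite e1 e3 e4 e5 in cA cB cC cD cF.
move: cA cB cC cD cF h1 h2 u1 u2 i1 i2 i3 i4 i5 i6; clear.
do 20 ?[move: (nat_of_bool _) => ?]; do 8 ?[move: (count_mem _ _) => ?].
by move=> *; lia.
Qed.

Lemma graph_wf E hs n : all (fun h => h < n) hs ->
  all (fun uv => (uv.1 < size hs) && (uv.2 < size hs)) E ->
  ops_wf w.+1 n (graph_ops w r s E hs n) /\
  forall x, count_mem x (olds (graph_ops w r s E hs n))
    <= count_mem x hs + ((n <= x) && (x < n + size E * step_size w r s)).
Proof.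
elim: E hs n => [|uv E IH] hs n hh; first by move=> _; split=> // x.
rewrite [all _ _]/= => /andP[/andP[hu hv] hE]; have [h1 h2] := step_wf hh hu hv.
have hh' := step_handles_lt r s w1 hu hv hh.
have ss := size_step_handles w r s n hu hv.
have [|g1 g2] := IH _ _ hh'; first by rewrite ss.
rewrite [graph_ops _ _ _ _ _ _]/=; split; first by rewrite ops_wf_cat h1 created_step.
move=> x; rewrite olds_cat count_cat; have := h2 x; have := g2 x.
have : ((n <= x) && (x < n + step_size w r s)) + ((n + step_size w r s <= x) &&
    (x < n + step_size w r s + size E * step_size w r s))
    = (n <= x) && (x < n + size (uv :: E) * step_size w r s).
  rewrite [size _]/= mulSn addnA.
  move ea: (n + step_size w r s) => a; move eb: (a + size E * step_size w r s) => b.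
  have na : n <= a by rewrite -ea leq_addr.
  have ab : a <= b by rewrite -eb leq_addr.
  move: na ab; clear.
  by case: (leqP n x); case: (leqP a x); case: (ltnP x b); lia.
do 6 ?[move: (nat_of_bool _) => ?]; do 8 ?[move: (count_mem _ _) => ?].
by clear; lia.
Qed.

Lemma wf_pad D v n : v < n -> ops_wf w.+1 n (pad_ops w D v n) /\ olds (pad_ops w D v n) = nseq D v.
Proof.
elim: D n => [|D IH] n hv //; rewrite [pad_ops _ _ _ _]/= -[v :: _]/([:: v] ++ iota n w).
have [|h1 h2] := IH (n + w); first by rewrite ltn_addr.
rewrite ops_wf_cons olds_cons h1 h2 /= hv add1n eqxx; split=> //; by move: w1; clear; lia.
Qed.

Lemma hyper_wf D E nv : spins_in nv E ->
  [/\ ops_wf w.+1 nv.+1 (hyper_ops w r s D E nv),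
      count_mem nv (olds (hyper_ops w r s D E nv)) = D
    & forall x, x != nv -> count_mem x (olds (hyper_ops w r s D E nv)) <= 1].
Proof.
move=> hE; have hh : all (fun h => h < nv.+1) (iota 0 nv) by apply/allP => v; rewrite mem_iota; lia.
have hE' : all (fun uv => (uv.1 < size (iota 0 nv)) && (uv.2 < size (iota 0 nv))) E.
  by rewrite size_iota.
have [g1 g2] := graph_wf hh hE'.
have [|p1 p2] := @wf_pad D nv (nv.+1 + size E * step_size w r s); first by rewrite ltn_addr.
rewrite /hyper_ops ops_wf_cat g1 created_graph p1 olds_cat p2; split=> // [|x nx].
  rewrite count_cat count_nseq /= eqxx mul1n; have := g2 nv.
  by rewrite ltnn addn0 (count_uniq_mem _ (iota_uniq 0 nv)) mem_iota ltnn andbF leqn0 => /eqP ->.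
rewrite count_cat count_nseq /= (eq_sym nv) (negPf nx) mul0n addn0.
apply: leq_trans (g2 x) _; rewrite (count_uniq_mem _ (iota_uniq 0 nv)) mem_iota.
by case: (leqP nv.+1 x); case: (ltnP x nv); case: (ltnP x _); lia.
Qed.

End Gadget.

Definition vset (n : nat) (e : seq nat) : {set 'I_n} := [set i : 'I_n | val i \in e].

Section Structure.

Variable m : nat.

Lemma wf_edges n ops : ops_wf m n ops ->
  all (fun e => [&& size e == m, uniq e & all (fun v => v < n + created ops) e]) (map fst ops).
Proof.
elim: ops n => [|[e k] ops IH] n //= /and5P[k0 /eqP eE ho uo /andP[se hops]].
rewrite se /=; have := IH _ hops; rewrite /created /= -/(created ops) addnA => ->.
rewrite andbT; move: eE ho uo; move: (old _) => l /= -> ho uo; apply/andP; split.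
  rewrite cat_uniq uo iota_uniq andbT /=; apply/hasPn => v; rewrite mem_iota => /andP[nv _].
  by apply/negP => /(allP ho); rewrite /=; lia.
rewrite all_cat; apply/andP; split; apply/allP => v.
  by move=> /(allP ho) /=; lia.
by rewrite mem_iota; lia.
Qed.

Lemma wf_count n ops x : ops_wf m n ops ->
  count (fun e => x \in e) (map fst ops)
  = count_mem x (olds ops) + ((n <= x) && (x < n + created ops)).
Proof.
elim: ops n => [|[e k] ops IH] n; first by move=> _ /=; rewrite addn0 ltnNge andbN.
move=> hw; have /= /andP[/and3P[_ ue _] _] := wf_edges hw.
move: hw => /= /and5P[k0 /eqP eE ho uo /andP[se hops]].
rewrite (IH _ hops) /olds /= count_cat -/(olds ops) /created /= -/(created ops).
rewrite -(count_uniq_mem x ue) {1}eE count_cat (count_uniq_mem x (iota_uniq n k)) mem_iota addnA.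
rewrite -!addnA; congr (_ + _); rewrite addnCA; congr (_ + _).
by case: (leqP n x); case: (leqP (n + k) x); case: (ltnP x _) => //=; lia.
Qed.

(** A later edge contains a vertex of its own creation, whose number is too large to occur in an
    earlier edge. *)
Lemma wf_uniq n N ops : ops_wf m n ops -> n + created ops <= N -> uniq (map (vset N) (map fst ops)).
Proof.
elim: ops n => [|[e k] ops IH] n //= /and5P[k0 /eqP eE ho uo /andP[se hops]].
rewrite /created /= -/(created ops) addnA => hN; rewrite (IH _ hops hN) andbT.
have el : all (fun v => v < n + k) e.
  have : ops_wf m n [:: (e, k)] by rewrite /= k0 ho uo se -eE eqxx.
  by move=> /wf_edges /=; rewrite /created /= addn0 => /andP[/and3P[_ _]].
have new e' : e' \in map fst ops -> exists2 v, v \in e' & n + k <= v < N.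
  move: (n + k) hops hN; clear IH; elim: ops => [|[e1 k1] ops IH] a //= /and5P[k10 /eqP e1E _ _ /andP[_ h]].
  rewrite /created /= -/(created ops) addnA inE => haN /orP[/eqP ->|/(IH _ h haN)[v vi hv]].
    exists a; last by lia.
    by rewrite e1E mem_cat mem_iota; lia.
  by exists v => //; lia.
apply/mapP => -[e' /new[v ve' /andP[hv vN]] /setP/(_ (Ordinal vN))].
by rewrite !inE /= ve' => /(allP el); lia.
Qed.

End Structure.

Lemma degree_seq n (s : seq {set 'I_n}) v : uniq s ->
  degree [set:: s] v = count (fun e : {set 'I_n} => v \in e) s.
Proof.
move=> us; rewrite /degree -size_filter -(card_uniqP (filter_uniq _ us)).
by apply: eq_card => e; rewrite !inE mem_filter andbC.
Qed.

(** A vertex other than [v0] has degree at most 2, one for its creation and one as an old vertex,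
    and 2 <= D; only [v0] reaches [D] for certain. *)
Lemma hclass_ops m D n0 ops (N := n0 + created ops) v0 :
  1 < D -> ops_wf m n0 ops -> v0 < n0 -> count_mem v0 (olds ops) = D ->
  (forall x, x != v0 -> count_mem x (olds ops) <= 1) -> 0 < size ops ->
  uniq (map (vset N) (map fst ops)) /\ hclass [set:: map (vset N) (map fst ops)] m D.
Proof.
move=> D1 hw v0n c0 c1 so; set s := map (vset N) _.
have us : uniq s by apply: wf_uniq hw (leqnn _).
split=> //; have he := wf_edges hw.
have cardE e : e \in s -> #|e| = m.
  move=> /mapP[l hl ->]; have /and3P[/eqP <- ul /allP hlN] := allP he _ hl.
  rewrite cardE -(size_map val); apply/perm_size/uniq_perm => //.
    by rewrite (map_inj_uniq val_inj) enum_uniq.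
  move=> x; apply/mapP/idP => [[i]|xl]; first by rewrite mem_enum inE => il ->.
  by exists (Ordinal (hlN _ xl)); rewrite ?mem_enum ?inE.
have degE (v : 'I_N) : degree [set:: s] v = count_mem (val v) (olds ops) + ((n0 <= v) && (v < N)).
  rewrite degree_seq // -(wf_count v hw) /s count_map; apply: eq_count => e.
  by rewrite /= inE.
apply/and3P; split.
- apply/forallP => e; apply/implyP; rewrite inE => /cardE ->.
  by apply/forallP => f; apply/implyP; rewrite inE => /cardE ->.
- apply/andP; split; first by apply/forallP => e; apply/implyP; rewrite inE => /cardE ->.
  apply/implyP => _; case es : s => [|e s']; first by move: so; rewrite -(size_map fst) -(size_map (vset N)) -/s es.
  have ein : e \in s by rewrite es inE eqxx.
  by apply/existsP; exists e; rewrite -es inE ein (cardE _ ein) eqxx.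
rewrite eqn_leq; apply/andP; split.
  apply/bigmax_leqP => v _; rewrite degE.
  have [e|nv] := eqVneq (val v) v0; first by rewrite -[nat_of_ord v]/(val v) e c0; lia.
  by apply: leq_trans (leq_add (c1 _ nv) (leq_b1 _)) _.
have v0N : v0 < N by rewrite ltn_addr.
rewrite /max_degree; apply: (@leq_trans (degree [set:: s] (Ordinal v0N))); last exact: leq_bigmax.
by rewrite degE /= c0 leq_addr.
Qed.

Lemma num_colourings_ncol q (i0 : 'I_q) N (es : seq (seq nat)) :
  all (fun e => all (fun v => v < N) e && (0 < size e)) es ->
  num_colourings [set:: map (vset N) es] q = ncol i0 N es.
Proof.
move=> he; rewrite /num_colourings /ncol; apply: eq_card => f; rewrite !inE.
have nthE v (hv : v < N) : nth i0 (codom f) v = f (Ordinal hv).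
  rewrite /codom /image_mem (nth_map (Ordinal hv)) ?size_enum_ord //.
  by congr (f _); apply: val_inj => /=; rewrite nth_enum_ord.
have nthE' (y : 'I_N) : nth i0 (codom f) (val y) = f y.
  by rewrite (nthE _ (ltn_ord y)); congr (f _); apply: val_inj.
rewrite /colouring; apply/forallP/allP => [h e ee|h e].
  have := h (vset N e); rewrite inE map_f //= /nae; apply: contra => hc.
  apply/forallP => u; apply/implyP; rewrite inE => ue.
  apply/forallP => v; apply/implyP; rewrite inE => ve.
  have := he; move=> /allP/(_ e ee)/andP[_ _].
  move: hc; case: e {ee} ue ve => // x e ue ve /= /allP hc.
  have eqx (y : 'I_N) : val y \in x :: e -> f y = nth i0 (codom f) x.
    rewrite inE => /orP[/eqP <-|ye]; first by rewrite nthE'.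
    have := hc (nth i0 (codom f) (val y)); rewrite map_f // => /(_ isT)/eqP <-.
    by rewrite nthE'.
  by rewrite (eqx u) // (eqx v).
apply/implyP; rewrite inE => /mapP[l hl ->]; have := h l hl; rewrite /nae; apply: contra => hm.
have /andP[/allP lN _] := allP he l hl.
case: l hl hm lN => // x l hl hm lN /=; apply/allP => _ /mapP[y yl ->] /=.
have xN : x < N by apply: lN; rewrite mem_head.
have yN : y < N by apply: lN; rewrite inE yl orbT.
rewrite !nthE; move/forallP: hm => /(_ (Ordinal yN)); rewrite inE inE /= yl orbT /=.
by move=> /forallP/(_ (Ordinal xN)); rewrite inE mem_head.
Qed.

(** * Circuits of NAND gates as spin systems *)

(* Wire 0 carries [false] and wire 1 carries [true]. *)
Definition ev (ws : seq bool) (gs : seq (nat * nat)) : seq bool :=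
  foldl (fun ws g => rcons ws (~~ (nth false ws g.1 && nth false ws g.2))) ws gs.

Fixpoint gates_wf (n : nat) (gs : seq (nat * nat)) : bool :=
  if gs is g :: gs' then [&& g.1 < n, g.2 < n & gates_wf n.+1 gs'] else true.

Lemma nth_ev ws gs i : i < size ws -> nth false (ev ws gs) i = nth false ws i.
Proof.
elim: gs ws => //= g gs IH ws hi; rewrite IH ?size_rcons; last by lia.
by rewrite nth_rcons hi.
Qed.

Lemma nth_ev_gate ws gs j : gates_wf (size ws) gs -> j < size gs ->
  nth false (ev ws gs) (size ws + j)
  = ~~ (nth false (ev ws gs) (nth (0, 0) gs j).1 && nth false (ev ws gs) (nth (0, 0) gs j).2).
Proof.
elim: gs ws j => // g gs IH ws [|j] /= /and3P[g1 g2 hw] hj.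
  by rewrite addn0 !nth_ev ?size_rcons; try lia; rewrite !nth_rcons ltnn eqxx g1 g2.
have := IH (rcons ws (~~ (nth false ws g.1 && nth false ws g.2))) j.
by rewrite size_rcons addSnnS; apply.
Qed.

Lemma gates_wf_nth n gs j : gates_wf n gs -> j < size gs ->
  (nth (0, 0) gs j).1 < n + j /\ (nth (0, 0) gs j).2 < n + j.
Proof.
elim: gs n j => // g gs IH n [|j] /= /and3P[g1 g2 hw] hj; first by rewrite addn0.
by have := IH _ _ hw hj; rewrite addSnnS.
Qed.

(** Gates read earlier wires only, so their equations determine every value; a minimal configuration
    can thus be recovered from its input bits. *)
Lemma ev_unique ws gs (X : nat -> bool) : gates_wf (size ws) gs ->
  (forall i, i < size ws -> X i = nth false ws i) ->
  (forall j, j < size gs -> X (size ws + j) = ~~ (X (nth (0, 0) gs j).1 && X (nth (0, 0) gs j).2)) ->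
  forall i, i < size ws + size gs -> X i = nth false (ev ws gs) i.
Proof.
move=> hw h0 hg i; elim/ltn_ind: i => i IH hi.
have [iw|iw] := ltnP i (size ws); first by rewrite h0 // nth_ev.
have ij : i = size ws + (i - size ws) by rewrite subnKC.
have hj : i - size ws < size gs by lia.
rewrite ij hg // nth_ev_gate //; have [h1 h2] := gates_wf_nth hw hj.
by rewrite !IH //; lia.
Qed.

(** ** The spin graph of a circuit *)

(* The vertices are the [q - 2] apices, then the wires. *)
Definition apex_pairs (q nv : nat) : seq (nat * nat) :=
  [seq (a, a.+1 + i) | a <- iota 0 (q - 2), i <- iota 0 (nv - a.+1)].

(* In two colours, at least three of these nine edges are monochromatic, and
   exactly three when [c] is the negation of the majority of [a], [b] and [f]. *)
Definition gate_edges (f a b c : nat) : seq (nat * nat) :=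
  [:: (a, b); (a, f); (b, f); (a, c); (a, c); (b, c); (b, c); (c, f); (c, f)].

Definition circuit_edges (p k : nat) (gs : seq (nat * nat)) : seq (nat * nat) :=
  flatten [seq gate_edges p (p + (nth (0, 0) gs j).1) (p + (nth (0, 0) gs j).2) (p + (k.+2 + j))
          | j <- iota 0 (size gs)].

(** One violated apex pair costs 3 * size gs + 1, more than the 3 per gate of a correct evaluation,
    so minimal configurations keep the apices apart. The two single edges make wire 1 and the output
    differ from wire 0, which carries false. *)
Definition half_edges (q k : nat) (gs : seq (nat * nat)) (out : nat) : seq (nat * nat) :=
  let p := q - 2 in
  flatten (nseq (3 * size gs).+1 (apex_pairs q (p + (k.+2 + size gs))))
  ++ [:: (p, p.+1); (p, p + out)] ++ circuit_edges p k gs.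

(* Doubled, to have an even number of edges. *)
Definition spin_edges (q k : nat) (gs : seq (nat * nat)) (out : nat) : seq (nat * nat) :=
  half_edges q k gs out ++ half_edges q k gs out.

Definition nsat (k : nat) (gs : seq (nat * nat)) (out : nat) : nat :=
  #|[set w : k.-tuple bool | nth false (ev (false :: true :: w) gs) out]|.

Section Ground.

Variables (q : nat) (i0 : 'I_q) (k : nat) (gs : seq (nat * nat)) (out : nat).
Hypotheses (q2 : 1 < q) (hw : gates_wf k.+2 gs) (hout : out < k.+2 + size gs).

Notation p := (q - 2).
Notation nv := (p + (k.+2 + size gs)).
Notation G := (size gs).

Section Colouring.

Variable t : seq 'I_q.
Notation col v := (nth i0 t v).
Definition wbit (i : nat) : bool := col (p + i) != col p.

Definition proper_apices : bool := all (fun e => col e.1 != col e.2) (apex_pairs q nv).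

Definition nbad_gate (j : nat) : nat :=
  mono i0 (gate_edges p (p + (nth (0, 0) gs j).1) (p + (nth (0, 0) gs j).2) (p + (k.+2 + j))) t.

Lemma mono_cat E1 E2 : mono i0 (E1 ++ E2) t = mono i0 E1 t + mono i0 E2 t.
Proof. exact: count_cat. Qed.

Lemma mono_nseq n E : mono i0 (flatten (nseq n E)) t = n * mono i0 E t.
Proof. by elim: n => //= n IH; rewrite mulSn -IH -mono_cat. Qed.

Lemma mono_half : mono i0 (half_edges q k gs out) t
  = (3 * G).+1 * mono i0 (apex_pairs q nv) t
    + ((col p == col p.+1) + (col p == col (p + out)) + \sum_(j < G) nbad_gate j).
Proof.
rewrite /half_edges mono_cat mono_nseq; congr (_ + _); rewrite mono_cat.
rewrite [mono i0 [:: _; _] t]/= addn0; congr (_ + _); rewrite -(big_mkord predT nbad_gate).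
rewrite /circuit_edges /index_iota subn0; elim: (iota _ _) => [|j s IH]; first by rewrite big_nil.
by rewrite big_cons /= -IH /nbad_gate /mono -count_cat.
Qed.

Lemma apex_neq a v : proper_apices -> a < p -> a < v < nv -> col a != col v.
Proof.
move=> /allP h ha hv; apply: (h (a, v)); apply/allpairsPdep; exists a, (v - a.+1).
by rewrite !mem_iota; split; [lia | lia | congr pair; lia].
Qed.

(** Pigeonhole: three different colours on wires, besides the q - 2 of the apices, would make q +
    1. *)
Lemma two_colours_left u v : proper_apices -> u < k.+2 + G -> v < k.+2 + G ->
  (col (p + u) == col (p + v)) = (wbit u == wbit v).
Proof.
move=> hp hu hv; rewrite /wbit; case: (eqVneq (col (p + u)) (col p)) => [->|nu].
  by rewrite eq_sym; case: eqP.
case: (eqVneq (col (p + v)) (col p)) => [->|nv0]; first by rewrite (negPf nu).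
rewrite eqxx; apply/negPn/negP => nuv.
pose L := [:: col p, col (p + u), col (p + v) & [seq col a | a <- iota 0 p]].
have uL : uniq L.
  rewrite /L /= !inE ![col p == _]eq_sym (negPf nu) (negPf nv0) (negPf nuv) /=.
  have out_of v' : p <= v' -> v' < nv -> col v' \notin [seq col a | a <- iota 0 p].
    move=> h1 h2; apply/mapP => -[a]; rewrite mem_iota => ha e.
    have := @apex_neq a v' hp; rewrite e eqxx => h; suff : false by []; apply: h; lia.
  rewrite !out_of //=; try lia.
  rewrite map_inj_in_uniq ?iota_uniq // => a b; rewrite !mem_iota => ha hb e.
  have [ab|ba|//] := ltngtP a b.
    by have := @apex_neq a b hp; rewrite e eqxx => h; suff : false by []; apply: h; lia.
  by have := @apex_neq b a hp; rewrite e eqxx => h; suff : false by []; apply: h; lia.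
have := card_uniqP uL; have := max_card (mem L); rewrite card_ord => h1 h2.
by move: h1; rewrite h2 /= size_map size_iota; lia.
Qed.

(** The majority of two bits and false is their conjunction, so [gate_edges] with wire 0 as its
    first vertex enforces NAND. *)
Lemma nbad_gateE j : proper_apices -> j < G ->
  3 <= nbad_gate j /\ (nbad_gate j == 3) =
    (wbit (k.+2 + j) == ~~ (wbit (nth (0, 0) gs j).1 && wbit (nth (0, 0) gs j).2)).
Proof.
move=> hp hj; have [h1 h2] := gates_wf_nth hw hj.
rewrite /nbad_gate /mono /= -[in X in (_ == nth i0 t X)](addn0 p).
set a := (nth _ _ _).1 in h1 *; set b := (nth _ _ _).2 in h2 *; set c := k.+2 + j.
have e0 u : u < k.+2 + G -> (col (p + u) == col p) = (wbit u == false).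
  by move=> _; rewrite /wbit; case: eqP.
rewrite !addn0 !two_colours_left ?e0 //; try (by rewrite /c; lia).
Qed.

Lemma mono_half_min : 3 * G <= mono i0 (half_edges q k gs out) t /\
  (mono i0 (half_edges q k gs out) t == 3 * G) =
    [&& proper_apices, wbit 1, wbit out &
     [forall j : 'I_G, wbit (k.+2 + j) == ~~ (wbit (nth (0, 0) gs j).1 && wbit (nth (0, 0) gs j).2)]].
Proof.
rewrite mono_half; case hp: proper_apices => /=; last first.
  have m0 : 0 < mono i0 (apex_pairs q nv) t.
    rewrite /mono -has_count; move/negbT: hp; rewrite /proper_apices -has_predC.
    by apply: sub_has => e /=; rewrite negbK.
  by split; [nia | apply/negP => /eqP; nia].
have -> : mono i0 (apex_pairs q nv) t = 0.
  apply/eqP; rewrite -leqn0 leqNgt /mono -has_count -all_predC.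
  by apply: sub_all hp => e.
rewrite muln0 add0n.
have sum3 : 3 * G = \sum_(j < G) 3 by rewrite sum_nat_const card_ord mulnC.
have le3 : 3 * G <= \sum_(j < G) nbad_gate j.
  by rewrite sum3; apply: leq_sum => j _; have [] := nbad_gateE hp (ltn_ord j).
split; first by apply: leq_trans le3 _; rewrite leq_addl.
have -> : wbit 1 = ~~ (col p == col p.+1) by rewrite /wbit addn1 eq_sym.
have -> : wbit out = ~~ (col p == col (p + out)) by rewrite /wbit eq_sym.
have -> : [forall j : 'I_G, wbit (k.+2 + j) == ~~ (wbit (nth (0, 0) gs j).1 && wbit (nth (0, 0) gs j).2)]
    = (\sum_(j < G) nbad_gate j == 3 * G).
  rewrite eq_sym sum3.
  have := @leqif_sum _ predT (fun j : 'I_G => 3 == nbad_gate j) (fun=> 3) (fun j : 'I_G => nbad_gate j).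
  move=> H; rewrite (H _).2; last first.
    by move=> j _; split=> //; have [] := nbad_gateE hp (ltn_ord j).
  apply/forallP/forallP => h j; have [_ e] := nbad_gateE hp (ltn_ord j).
    by rewrite eq_sym e; apply: h.
  by rewrite -e eq_sym; apply: h.
move: le3; set S := \sum_(_ < _) _ => le3.
by case: (_ == col p.+1); case: (_ == col (p + out)) => /=; rewrite ?add0n //; apply/negP => /eqP; lia.
Qed.

End Colouring.

Lemma spin_min t : 6 * G <= mono i0 (spin_edges q k gs out) t.
Proof. by rewrite mono_cat; have [] := mono_half_min t; lia. Qed.

Lemma mono_spinE t :
  (mono i0 (spin_edges q k gs out) t == 6 * G) = (mono i0 (half_edges q k gs out) t == 3 * G).
Proof. by rewrite mono_cat; apply/eqP/eqP; lia. Qed.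

Definition wire (w : seq bool) (v : nat) : nat :=
  if v < p then v else if nth false (ev (false :: true :: w) gs) (v - p) then p.+1 else p.

(** The standard configuration of an input, with apex a coloured a and the truth values coloured q -
    2 and q - 1, followed by a permutation of the colours. *)
Definition paint (sw : {perm 'I_q} * k.-tuple bool) : {ffun 'I_nv -> 'I_q} :=
  [ffun v : 'I_nv => sw.1 (insubd i0 (wire sw.2 v))].

Lemma wire_lt w v : wire w v < q.
Proof. by rewrite /wire; case: (v < p) / ltnP => hv; last case: ifP => _; lia. Qed.

Lemma nth_codom_ord (f : {ffun 'I_nv -> 'I_q}) v (hv : v < nv) :
  nth i0 (codom f) v = f (Ordinal hv).
Proof.
rewrite /codom /image_mem (nth_map (Ordinal hv)) ?size_enum_ord //.
by congr (f _); apply: val_inj => /=; rewrite nth_enum_ord.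
Qed.

Lemma paintE sw v : v < nv -> nth i0 (codom (paint sw)) v = sw.1 (insubd i0 (wire sw.2 v)).
Proof. by move=> hv; rewrite nth_codom_ord ffunE. Qed.

Lemma paint_eq sw u v : u < nv -> v < nv ->
  (nth i0 (codom (paint sw)) u == nth i0 (codom (paint sw)) v) = (wire sw.2 u == wire sw.2 v).
Proof.
move=> hu hv; rewrite !paintE // (inj_eq perm_inj) -val_eqE /= !val_insubd.
by rewrite !wire_lt.
Qed.

Lemma wire_wire w u : wire w (p + u) = if nth false (ev (false :: true :: w) gs) u then p.+1 else p.
Proof. by rewrite /wire ltnNge leq_addr /= addKn. Qed.

Lemma wbit_paint sw u : u < k.+2 + G ->
  wbit (codom (paint sw)) u = nth false (ev (false :: true :: sw.2) gs) u.
Proof.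
move=> hu; have e0 : nth i0 (codom (paint sw)) p = nth i0 (codom (paint sw)) (p + 0).
  by rewrite addn0.
rewrite /wbit e0 paint_eq; try lia.
rewrite !wire_wire [in X in _ != X]nth_ev //=.
by case: ifP => _; rewrite ?eqxx //; apply/eqP; lia.
Qed.

Lemma size_input (w : k.-tuple bool) : size (false :: true :: w) = k.+2.
Proof. by rewrite /= size_tuple. Qed.

Lemma paint_ground (sw : {perm 'I_q} * k.-tuple bool) : nth false (ev (false :: true :: sw.2) gs) out ->
  mono i0 (half_edges q k gs out) (codom (paint sw)) == 3 * G.
Proof.
move=> ho; have [_ ->] := mono_half_min (codom (paint sw)); apply/and4P; split.
- apply/allP => e /allpairsPdep[a [i [ha hi ->]]] /=.
  move: ha hi; rewrite !mem_iota => ha hi; rewrite paint_eq; try lia.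
  rewrite {1}/wire; have -> : a < p by lia.
  rewrite /wire; case: ltnP => hv; first by apply/eqP; lia.
  by case: ifP => _; apply/eqP; lia.
- by rewrite wbit_paint // nth_ev.
- by rewrite wbit_paint.
apply/forallP => j; have hw' : gates_wf (size (false :: true :: sw.2)) gs by rewrite size_input.
have [h1 h2] := gates_wf_nth hw (ltn_ord j); have hj := ltn_ord j.
have := nth_ev_gate hw' (ltn_ord j); rewrite size_input => e.
by rewrite !wbit_paint ?e //; lia.
Qed.

Lemma ground_paint (f : {ffun 'I_nv -> 'I_q}) : mono i0 (half_edges q k gs out) (codom f) == 3 * G ->
  exists2 sw : {perm 'I_q} * k.-tuple bool, f = paint sw & nth false (ev (false :: true :: sw.2) gs) out.
Proof.
have [_ ->] := mono_half_min (codom f) => /and4P[hp h1 ho /forallP hg].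
set t := codom f in hp h1 ho hg.
(* The first q vertices, namely the apices and wires 0 and 1, show each colour once; they define the
   permutation. *)
have inj : injective (fun i : 'I_q => nth i0 t i).
  have wlog_lt (i j : 'I_q) : i < j -> nth i0 t i != nth i0 t j.
    move=> ij; have hj := ltn_ord j; have [ip|pi] := ltnP i p.
      by apply: apex_neq => //; lia.
    have -> : nat_of_ord i = p by lia.
    have -> : nat_of_ord j = p + 1 by lia.
    by rewrite eq_sym.
  move=> i j e; apply: val_inj; have [ij|ji|//] := ltngtP i j.
    by have := wlog_lt i j ij; rewrite e eqxx.
  by have := wlog_lt j i ji; rewrite e eqxx.
pose w := [tuple wbit t (i.+2) | i < k].
have wE u : u < k.+2 + G -> wbit t u = nth false (ev (false :: true :: w) gs) u.
  rewrite -(size_input w); apply: ev_unique; rewrite ?size_input //.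
    move=> [|[|i]] hi /=; [by rewrite /wbit addn0 eqxx | exact: h1 |].
    by rewrite (nth_map (Ordinal (hi : i < k))) ?size_enum_ord // nth_enum_ord.
  by move=> j hj; exact: (eqP (hg (Ordinal hj))).
exists (perm inj, w); last by rewrite -wE.
apply/ffunP => v; rewrite ffunE permE val_insubd wire_lt /= /wire.
have -> : f v = nth i0 t v by rewrite nth_codom_ord; congr (f _); apply: val_inj.
case: ltnP => // hv; have hv' := ltn_ord v.
have vE : nat_of_ord v = p + (v - p) by rewrite subnKC.
rewrite [in LHS]vE -wE; last by lia.
case: ifP => wv; last by apply/eqP; move/negbT: wv; rewrite negbK.
have -> : p.+1 = p + 1 by rewrite addn1.
by apply/eqP; rewrite two_colours_left ?wv ?h1 //; lia.
Qed.

(** All q colours occur on the apices and wires 0 and 1, so the permutation can be read off;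
    comparing with wire 0 gives back the input bits. *)
Lemma paint_inj : injective paint.
Proof.
move=> [s w] [s' w'] e.
have wE u : u < k.+2 + G ->
    nth false (ev (false :: true :: w) gs) u = nth false (ev (false :: true :: w') gs) u.
  by move=> hu; rewrite -(wbit_paint (s, w) hu) -(wbit_paint (s', w') hu) e.
have -> : w = w'.
  apply: val_inj; apply: (@eq_from_nth _ false); rewrite !size_tuple // => i hi.
  by have := wE i.+2; rewrite !nth_ev ?size_input //=; apply; lia.
congr pair; apply/permP => i; have hi := ltn_ord i.
have colE v : v < nv -> s (insubd i0 (wire w v)) = s' (insubd i0 (wire w' v)).
  by move=> hv; rewrite -(paintE (s, w) hv) -(paintE (s', w') hv) e.
have [ip|pi] := ltnP i p.
  have := colE i; rewrite /wire ip !valKd; apply; lia.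
have iE : nat_of_ord i = p + (i - p) by rewrite subnKC.
have := colE i; rewrite iE !wire_wire !nth_ev ?size_input //=; try lia.
have ii (b : seq bool) : (if nth false [:: false, true & b] (i - p) then p.+1 else p) = i.
  have [e0|e0] : i - p = 0 \/ i - p = 1 by lia.
    by rewrite e0 /=; lia.
  by rewrite e0 /=; lia.
rewrite !ii; rewrite !valKd; apply; lia.
Qed.

Lemma nmono_spin : nmono i0 nv (spin_edges q k gs out) (6 * G) = q`! * nsat k gs out.
Proof.
pose S := setX [set: {perm 'I_q}] [set w : k.-tuple bool | nth false (ev (false :: true :: w) gs) out].
have -> : q`! * nsat k gs out = #|S| by rewrite cardsX cardsT card_Sn.
rewrite -(card_imset _ paint_inj); apply: eq_card => f; rewrite inE mono_spinE.
apply/idP/imsetP => [/ground_paint[sw -> h]|[sw]].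
  by exists sw; rewrite // !inE.
by rewrite !inE /= => h ->; apply: paint_ground.
Qed.

Lemma spin_edges_in : spins_in nv (spin_edges q k gs out).
Proof.
suff h : spins_in nv (half_edges q k gs out) by rewrite /spins_in all_cat -!/(spins_in _ _) h.
rewrite /spins_in /half_edges all_cat; apply/andP; split.
  apply/allP => e /flattenP[l]; rewrite mem_nseq => /andP[_ /eqP ->].
  by move=> /allpairsPdep[a [i [ha hi ->]]] /=; move: ha hi; rewrite !mem_iota; lia.
rewrite all_cat /=; apply/andP; split; first by lia.
apply/allP => e /flattenP[l /mapP[j]]; rewrite mem_iota => /= hj ->.
have [h1 h2] := gates_wf_nth hw hj.
by rewrite !inE => /or4P[/eqP->|/eqP->|/eqP->|/or4P[/eqP->|/eqP->|/eqP->|/or3P[/eqP->|/eqP->|/eqP->]]] /=; lia.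
Qed.

Lemma odd_spin_edges : ~~ odd (size (spin_edges q k gs out)).
Proof. by rewrite size_cat addnn odd_double. Qed.

End Ground.

(** * Circuits for bounded computations *)

Fixpoint gall (P : nat -> nat * nat -> bool) (n : nat) (gs : seq (nat * nat)) : bool :=
  if gs is g :: gs' then P n g && gall P n.+1 gs' else true.

Lemma gall_cat P n gs1 gs2 : gall P n (gs1 ++ gs2) = gall P n gs1 && gall P (n + size gs1) gs2.
Proof. by elim: gs1 n => [|g gs IH] n /=; rewrite ?addn0 // IH andbA addSnnS. Qed.

Lemma size_blocks D m (h : nat -> seq (nat * nat)) : (forall i, size (h i) = D) ->
  size (flatten [seq h i | i <- iota 0 m]) = m * D.
Proof.
by move=> hD; elim: m 0 => //= m IH a; rewrite size_cat hD IH mulSn.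
Qed.

Lemma gall_blocks P n D m (h : nat -> seq (nat * nat)) : (forall i, size (h i) = D) ->
  gall P n (flatten [seq h i | i <- iota 0 m]) = all (fun i => gall P (n + i * D) (h i)) (iota 0 m).
Proof.
move=> hD; elim: m => // m IH; rewrite -[m.+1]addn1 iotaD map_cat flatten_cat gall_cat IH.
by rewrite all_cat (size_blocks _ hD) /= cats0 andbT.
Qed.

Definition wf_gate (n : nat) (g : nat * nat) : bool := (g.1 < n) && (g.2 < n).

Lemma gates_wfE n gs : gates_wf n gs = gall wf_gate n gs.
Proof. by elim: gs n => //= g gs IH n; rewrite IH andbA. Qed.

Definition sat_gate (X : nat -> bool) (n : nat) (g : nat * nat) : bool :=
  X n == ~~ (X g.1 && X g.2).

Lemma sat_ev ws gs : gates_wf (size ws) gs ->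
  gall (sat_gate (nth false (ev ws gs))) (size ws) gs.
Proof.
elim: gs ws => // g gs IH ws /= /and3P[g1 g2 hw]; apply/andP; split; last first.
  by have := IH (rcons ws (~~ (nth false ws g.1 && nth false ws g.2))); rewrite size_rcons; apply.
rewrite /sat_gate !nth_ev ?size_rcons; try lia.
by rewrite !nth_rcons ltnn eqxx g1 g2.
Qed.

(** ** Circuits computing fixed functions *)

(** Exponential in [k], which is harmless: the number of inputs depends on the simulated machine
    only. *)
Fixpoint csize (k : nat) : nat := if k is k'.+1 then (csize k').*2 + 4 else 0.

(** With no input left, the truth value read as a number is itself the constant wire 0 or 1. *)
Definition cout (k : nat) (f : seq bool -> bool) (n : nat) : nat :=
  if k is _.+1 then n + (csize k).-1 else f [::].

(* [if x then f (true :: _) else f (false :: _)], where [x] is the first input *)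
Fixpoint emit (k : nat) (f : seq bool -> bool) (ins : seq nat) (n : nat) : seq (nat * nat) :=
  if k is k'.+1 then
    let f1 := fun s => f (true :: s) in let f0 := fun s => f (false :: s) in
    let x := head 0 ins in let n0 := n + csize k' in let m := n0 + csize k' in
    emit k' f1 (behead ins) n ++ emit k' f0 (behead ins) n0 ++
    [:: (x, x); (x, cout k' f1 n); (m, cout k' f0 n0); (m.+1, m.+2)]
  else [::].

Lemma size_emit k f ins n : size (emit k f ins n) = csize k.
Proof. by elim: k f ins n => //= k IH f ins n; rewrite !size_cat !IH /=; lia. Qed.

Lemma cout_lt k f n : 1 < n -> cout k f n < n + csize k.
Proof. by case: k => [|k] hn /=; [case: (f _); lia | lia]. Qed.

Lemma emit_wf k f ins n : 1 < n -> all (fun i => i < n) ins -> gall wf_gate n (emit k f ins n).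
Proof.
elim: k f ins n => //= k IH f ins n hn hi.
have hb : all (fun i => i < n) (behead ins) by case: ins hi => //= a s /andP[].
have hx : head 0 ins < n by case: {hb} ins hi => [|a s /andP[]] //=; lia.
rewrite !gall_cat !size_emit IH //; rewrite IH; [|lia|by apply: sub_all hb => i /=; lia].
have h1 := cout_lt k (fun s => f (true :: s)) hn.
have h0 := @cout_lt k (fun s => f (false :: s)) (n + csize k).
by rewrite /wf_gate /=; lia.
Qed.

Lemma emit_sat (X : nat -> bool) k f ins n : X 0 = false -> X 1 -> size ins = k ->
  gall (sat_gate X) n (emit k f ins n) -> X (cout k f n) = f [seq X i | i <- ins].
Proof.
move=> x0 x1; elim: k f ins n => [f [|//] n _ _|k IH f [//|x ins] n [sz]] /=.
  by case: (f _).
rewrite !gall_cat !size_emit => /and3P[h1 h0] /=; rewrite /sat_gate /= => /and5P[].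
rewrite (IH _ _ _ sz h1) (IH _ _ _ sz h0).
move em: (n + csize k + csize k) => m.
have -> : n + ((csize k).*2 + 4).-1 = m.+3 by lia.
by move=> /eqP e1 /eqP e2 /eqP e3 /eqP e4 _; rewrite e4 e3 e2 e1; case: (X x); case: (f _); case: (f _).
Qed.

Definition vec (k w : nat) (F : seq bool -> seq bool) (ins : seq nat) (n : nat) : seq (nat * nat) :=
  flatten [seq emit k (fun s => nth false (F s) l) ins (n + l * csize k) | l <- iota 0 w].

Definition vouts (k w n : nat) : seq nat := [seq n + l * csize k + (csize k).-1 | l <- iota 0 w].

Lemma size_vec k w F ins n : size (vec k w F ins n) = w * csize k.
Proof. by apply: size_blocks => l; apply: size_emit. Qed.

Lemma size_vouts k w n : size (vouts k w n) = w.
Proof. by rewrite size_map size_iota. Qed.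

Lemma vouts_lt k w n : 0 < k -> all (fun i => i < n + w * csize k) (vouts k w n).
Proof.
case: k => // k _; rewrite all_map; apply/allP => l; rewrite mem_iota /=; nia.
Qed.

Lemma vec_wf k w F ins n : 1 < n -> all (fun i => i < n) ins -> gall wf_gate n (vec k w F ins n).
Proof.
move=> hn hi; rewrite /vec (@gall_blocks _ _ (csize k)); last by move=> l; apply: size_emit.
apply/allP => l _; apply: emit_wf; first lia.
by apply: sub_all hi => i /=; lia.
Qed.

Lemma vec_sat (X : nat -> bool) k w F ins n : X 0 = false -> X 1 -> size ins = k -> 0 < k ->
  size (F [seq X i | i <- ins]) = w ->
  gall (sat_gate X) n (vec k w F ins n) ->
  [seq X i | i <- vouts k w n] = F [seq X i | i <- ins].
Proof.
move=> x0 x1 sz k0 sF; rewrite /vec (@gall_blocks _ _ (csize k)); last by move=> l; apply: size_emit.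
move=> /allP h; apply: (@eq_from_nth _ false); rewrite size_map size_vouts ?sF // => l hl.
rewrite (nth_map 0) ?size_vouts // (nth_map 0) ?size_iota // nth_iota // add0n.
have := emit_sat x0 x1 sz (h l _); rewrite mem_iota => /(_ hl) <-.
by case: k k0 {sz h} => //.
Qed.

(** The list is fixed, so the program is obtained by unrolling, and the dependence of [h] on its
    second argument is arbitrary. *)
Lemma pt_map_const {X A B : Type} {cX : code X} {cB : code B} (h : X -> A -> B) (s : seq A) :
  (forall a, pt (fun x => h x a)) -> pt (fun x => [seq h x a | a <- s]).
Proof. by move=> ph; elim: s => [|a s IH]; [exact: pt_const | exact: (pt_cons (ph a) IH)]. Qed.

Section Pt.

Context {X : Type} {cX : code X}.

Lemma pt_emit k f (ins : X -> seq nat) (n : X -> nat) : pt ins -> pt n ->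
  pt (fun x => emit k f (ins x) (n x)).
Proof.
elim: k f ins n => [|k IH] f ins n pi pn; first by pt_tac.
have pout k' f' (n' : X -> nat) : pt n' -> pt (fun x => cout k' f' (n' x)).
  by move=> pn'; case: k' => [|k']; rewrite /cout; pt_tac.
rewrite /=; apply: pt_cat; first by apply: IH; pt_tac.
apply: pt_cat; first by apply: IH; pt_tac.
apply: pt_cons; first by pt_tac.
apply: pt_cons; first by (apply: pt_pair; [pt_tac | apply: pout]).
by apply: pt_cons; [apply: pt_pair; [pt_tac | apply: pout; pt_tac] | pt_tac].
Qed.

Lemma pt_vec k w F (ins : X -> seq nat) (n : X -> nat) : pt ins -> pt n ->
  pt (fun x => vec k w F (ins x) (n x)).
Proof.
move=> pi pn; apply: pt_flatten; apply: pt_map_const => l.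
by apply: pt_emit => //; pt_tac.
Qed.

Lemma pt_vouts k w (n : X -> nat) : pt n -> pt (fun x => vouts k w (n x)).
Proof. by move=> pn; apply: pt_map_const => l; pt_tac. Qed.

End Pt.

Definition onehot {A : finType} (a : A) : seq bool := [seq a' == a | a' <- enum A].
Definition unhot {A : finType} (a0 : A) (s : seq bool) : A := nth a0 (enum A) (index true s).

Lemma onehotK (A : finType) (a0 a : A) : unhot a0 (onehot a) = a.
Proof.
rewrite /unhot /onehot; have : a \in enum A by rewrite mem_enum.
elim: (enum A) => //= b s IH; rewrite inE; case: (eqVneq b a) => [-> //|ba].
by rewrite ?eqxx /= => h; rewrite IH.
Qed.

Lemma size_onehot (A : finType) (a : A) : size (onehot a) = #|A|.
Proof. by rewrite size_map cardE. Qed.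

Lemma read_move (G : finType) e (a : symbol G) (t : tape G) :
  read (move_head e (write a t))
  = if e is Some d then if d then nth None (behead t.2) 0 else nth None t.1 0 else a.
Proof. by case: e => [[]|]; rewrite /read //= -nth0. Qed.

Lemma nth_move (G : finType) (d : bool) e (a : symbol G) (t : tape G) i :
  let far (t : tape G) j := nth None (if d then behead t.2 else t.1) j in
  far (move_head e (write a t)) i
  = if e is Some b then if b == d then far t i.+1 else if i == 0 then a else far t i.-1 else far t i.
Proof. by case: e d => [[]|] []; case: i => [|i] //=; rewrite nth_behead. Qed.

(** ** Simulation of a machine, seen from its heads *)

Section Simulation.

Variable M : machine.
Hypothesis nq : forall s : states M, ~~ querying s.

Notation K := (ntapes M).

(* The cells of all the tapes at the same distance from their heads are grouped. *)
Definition cell : finType := {ffun 'I_K.+1 -> symbol (aux M)}.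
Definition core : finType := (states M * cell)%type.

Definition act (a : core) : states M * {ffun 'I_K.+1 -> symbol (aux M) * option bool} :=
  if halting a.1 then (a.1, [ffun r => (a.2 r, None)]) else trans a.1 a.2.

(** In the frame of the heads it is the tapes that shift, so every cell obeys a local rule in its
    neighbours and the core, and the circuit encodes no head position. *)
Definition next_core (a : core) (l r : cell) : core :=
  ((act a).1, [ffun j => match ((act a).2 j).2 with
                         | None => ((act a).2 j).1
                         | Some d => if d then r j else l j
                         end]).

(* [d] is the side; [o], [c] and [n] are the cells from the head outwards. *)
Definition next_cell (d first : bool) (a : core) (o c n : cell) : cell :=
  [ffun j => match ((act a).2 j).2 with
             | None => c j
             | Some e => if e == d then n j else if first then ((act a).2 j).1 else o j
             end].

Definition core_of (c : config M) : core := (c.1, [ffun r => read (c.2 r)]).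
Definition cell_of (d : bool) (c : config M) (i : nat) : cell :=
  [ffun r => nth None (if d then behead (c.2 r).2 else (c.2 r).1) i].

Lemma core_step O c :
  core_of (step O c) = next_core (core_of c) (cell_of false c 0) (cell_of true c 0).
Proof.
rewrite /step /next_core /act [core_of c]/=; case: ifP => hc /=; rewrite ?(negPf (nq _)).
  by congr pair; apply/ffunP => r; rewrite !ffunE.
case e: (trans _ _) => [s w]; congr pair; apply/ffunP => r; rewrite !ffunE.
exact: read_move.
Qed.

Lemma cell_step O d c i :
  cell_of d (step O c) i
  = next_cell d (i == 0) (core_of c) (cell_of d c i.-1) (cell_of d c i) (cell_of d c i.+1).
Proof.
apply/ffunP => r; rewrite /step /next_cell /act [core_of c]/=; case: ifP => hc /=.
  by rewrite !ffunE.
rewrite !ffunE (negPf (nq _)); case e: (trans _ _) => [s w].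
exact: nth_move.
Qed.

Definition core0 : core := (start M, [ffun=> None]).
Definition cell0 : cell := [ffun=> None].

(** All the functions of the circuit get this many inputs, filled up by repetition or zeros, so that
    every output takes the same number of gates. *)
Definition arity : nat := #|core| + (#|cell| + (#|cell| + #|cell|)).
Definition code4 (a : core) (x y z : cell) : seq bool :=
  onehot a ++ onehot x ++ onehot y ++ onehot z.

Definition decode4 (s : seq bool) : core * cell * cell * cell :=
  let u x := unhot cell0 (take #|cell| x) in
  let s1 := drop #|core| s in let s2 := drop #|cell| s1 in let s3 := drop #|cell| s2 in
  (unhot core0 (take #|core| s), u s1, u s2, u s3).

Lemma decode4K a x y z : decode4 (code4 a x y z) = (a, x, y, z).
Proof.
rewrite /decode4 /code4; do 3 rewrite ?take_size_cat ?drop_size_cat ?size_onehot //.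
by rewrite take_oversize ?size_onehot // !onehotK.
Qed.

Definition core_fun (s : seq bool) : seq bool :=
  let: (a, l, r, _) := decode4 s in onehot (next_core a l r).
Definition cell_fun (d first : bool) (s : seq bool) : seq bool :=
  let: (a, o, c, n) := decode4 s in onehot (next_cell d first a o c n).
Definition core_init (s : seq bool) : seq bool :=
  onehot ((start M, [ffun r => if r == ord0 then bit (nth false s 0) else None]) : core).
(* The second input tells whether the cell contains a bit. *)
Definition cell_init (s : seq bool) : seq bool :=
  onehot ([ffun r => if (r == ord0) && nth false s 1 then bit (nth false s 0) else None] : cell).
Definition accept_fun (s : seq bool) : bool :=
  let: (a, _, _, _) := decode4 s in a.2 ord0 == bit true.

Notation csz := (csize arity).
Notation asz := (#|core| * csz).
Notation bsz := (#|cell| * csz).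

Definition block N (F : nat -> seq bool -> seq bool) (ins : nat -> seq nat) (b : nat) :=
  flatten [seq vec arity #|cell| (F i) (ins i) (b + i * bsz) | i <- iota 0 N].

Definition layer N FA insA FL insL FR insR b : seq (nat * nat) :=
  vec arity #|core| FA insA b ++ block N FL insL (b + asz) ++ block N FR insR (b + asz + N * bsz).

Definition lsize N : nat := asz + (N * bsz).*2.
Definition core_wires (b : nat) : seq nat := vouts arity #|core| b.
Definition cell_wires (d : bool) N (b i : nat) : seq nat :=
  vouts arity #|cell| (b + asz + d * (N * bsz) + i * bsz).

Lemma arity_gt0 : 0 < arity.
Proof. by rewrite addn_gt0; apply/orP; left; apply/card_gt0P; exists core0. Qed.

Lemma size_layer N FA insA FL insL FR insR b : size (layer N FA insA FL insL FR insR b) = lsize N.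
Proof.
rewrite !size_cat size_vec /block !(@size_blocks bsz) ?addnn // => i; exact: size_vec.
Qed.

Lemma layer_wf N FA insA FL insL FR insR b : 1 < b -> all (fun v => v < b) insA ->
  (forall i, i < N -> all (fun v => v < b) (insL i)) ->
  (forall i, i < N -> all (fun v => v < b) (insR i)) ->
  gall wf_gate b (layer N FA insA FL insL FR insR b).
Proof.
move=> b1 hA hL hR; rewrite !gall_cat size_vec vec_wf //= /block.
have sb F (ins : nat -> seq nat) c i : size (vec arity #|cell| (F i) (ins i) (c + i * bsz)) = bsz.
  exact: size_vec.
rewrite !(size_blocks _ (sb _ _ _)) !(gall_blocks _ _ _ (sb _ _ _)).
apply/andP; split; apply/allP => i; rewrite mem_iota => /= hi; apply: vec_wf; try lia.
  by apply: sub_all (hL i hi) => v /=; lia.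
by apply: sub_all (hR i hi) => v /=; lia.
Qed.

Lemma layer_sat X N FA insA FL insL FR insR b : X 0 = false -> X 1 ->
  size insA = arity -> (forall i, i < N -> size (insL i) = arity) ->
  (forall i, i < N -> size (insR i) = arity) ->
  (forall s, size (FA s) = #|core|) -> (forall i s, size (FL i s) = #|cell|) ->
  (forall i s, size (FR i s) = #|cell|) ->
  gall (sat_gate X) b (layer N FA insA FL insL FR insR b) ->
  map X (core_wires b) = FA (map X insA)
  /\ forall d i, i < N ->
    map X (cell_wires d N b i) = (if d then FR i else FL i) (map X ((if d then insR else insL) i)).
Proof.
move=> x0 x1 sA sL sR fA fL fR; rewrite !gall_cat size_vec => /and3P[h1 h2 h3].
have sb F (ins : nat -> seq nat) c i : size (vec arity #|cell| (F i) (ins i) (c + i * bsz)) = bsz.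
  exact: size_vec.
split; first exact: (vec_sat x0 x1 sA arity_gt0 (fA _) h1).
move: h2 h3; rewrite /block !(size_blocks _ (sb _ _ _)) !(gall_blocks _ _ _ (sb _ _ _)).
move=> /allP h2 /allP h3 d i hi.
have hi' : i \in iota 0 N by rewrite mem_iota.
case: d; rewrite /cell_wires ?mul0n ?mul1n ?addn0.
  exact: (vec_sat x0 x1 (sR i hi) arity_gt0 (fR i _) (h3 i hi')).
exact: (vec_sat x0 x1 (sL i hi) arity_gt0 (fL i _) (h2 i hi')).
Qed.

Lemma core_wires_lt N b : all (fun v => v < b + lsize N) (core_wires b).
Proof.
apply: sub_all (vouts_lt _ _ arity_gt0) => v hv; apply: leq_trans hv _.
by rewrite leq_add2l leq_addr.
Qed.

Lemma cell_wires_lt d N b i : i < N -> all (fun v => v < b + lsize N) (cell_wires d N b i).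
Proof.
move=> hi; apply: sub_all (vouts_lt _ _ arity_gt0) => v hv; apply: leq_trans hv _.
rewrite /lsize; move: bsz asz => B A; have : i * B + B <= N * B by rewrite -mulSnr leq_mul2r hi orbT.
by case: d; rewrite ?mul0n ?mul1n; lia.
Qed.

(* The last cell has no outer neighbour: at time [t] the simulation is only
   correct at distances [i] such that [i + t < N]. *)
Definition outer N i : nat := if i.+1 < N then i.+1 else i.

Definition cell_ins d N b i : seq nat :=
  core_wires b ++ cell_wires d N b i.-1 ++ cell_wires d N b i ++ cell_wires d N b (outer N i).
Definition core_ins N b : seq nat :=
  core_wires b ++ cell_wires false N b 0 ++ cell_wires true N b 0 ++ cell_wires true N b 0.

Definition step_layer N b : seq (nat * nat) :=
  layer N core_fun (core_ins N b) (fun i => cell_fun false (i == 0)) (cell_ins false N b)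
    (fun i => cell_fun true (i == 0)) (cell_ins true N b) (b + lsize N).

(** The head starts on symbol 0, so the right cell at distance i starts with symbol i + 1; the
    boolean is used as one of the constant wires 0 and 1. Taking [arity] entries of a padded list
    gives every function its full number of inputs. *)
Definition init_layer N (zw : seq nat) b : seq (nat * nat) :=
  layer N core_init (take arity (nth 0 zw 0 :: nseq arity 0))
    (fun=> cell_init) (fun=> nseq arity 0)
    (fun=> cell_init)
    (fun i => take arity [:: nth 0 zw i.+1, nat_of_bool (i.+1 < size zw) & nseq arity 0]) b.

Definition machine_gates N T zw b : seq (nat * nat) :=
  init_layer N zw b ++ flatten [seq step_layer N (b + t * lsize N) | t <- iota 0 T]
  ++ emit arity accept_fun
       (take arity (core_wires (b + T * lsize N) ++ nseq arity 0)) (b + T.+1 * lsize N).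

Definition machine_out N T b : nat := cout arity accept_fun (b + T.+1 * lsize N).

Lemma size_core_ins N b : size (core_ins N b) = arity.
Proof. by rewrite !size_cat !size_vouts. Qed.

Lemma size_cell_ins d N b i : size (cell_ins d N b i) = arity.
Proof. by rewrite !size_cat !size_vouts. Qed.

Lemma size_init_layer N zw b : size (init_layer N zw b) = lsize N.
Proof. exact: size_layer. Qed.

Lemma size_machine_gates N T zw b :
  size (machine_gates N T zw b) = T.+1 * lsize N + csz.
Proof.
rewrite 2!size_cat size_init_layer size_emit (@size_blocks (lsize N)) ?addnA //.
by move=> t; apply: size_layer.
Qed.

Lemma machine_gates_wf N T zw b : 0 < N -> 1 < b -> all (fun v => v < b) zw ->
  gall wf_gate b (machine_gates N T zw b).
Proof.
move=> N0 b1 hz; have hn i : nth 0 zw i < b.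
  by have [hi|hi] := ltnP i (size zw); [apply: (allP hz); rewrite mem_nth | rewrite nth_default //; lia].
have ht s : all (fun v => v < b) s -> all (fun v => v < b) (take arity s).
  by move=> /allP h; apply/allP => v /mem_take; apply: h.
have h0 : all (fun v => v < b) (nseq arity 0) by apply/allP => v; rewrite mem_nseq => /andP[_ /eqP ->]; lia.
have ss t : size (step_layer N (b + t * lsize N)) = lsize N by apply: size_layer.
rewrite 2!gall_cat size_init_layer (size_blocks _ ss) (gall_blocks _ _ _ ss); apply/and3P; split.
- apply: layer_wf => // [|i hi]; apply: ht => /=; rewrite ?hn //=.
  by rewrite h0 andbT; case: (i.+1 < size zw); lia.
- apply/allP => t _; have -> : b + lsize N + t * lsize N = b + t * lsize N + lsize N by lia.
  have : 1 < b + t * lsize N by apply: leq_trans b1 _; rewrite leq_addr.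
  move: (b + t * lsize N) => c c1; have c2 : 1 < c + lsize N by lia.
  apply: layer_wf => // [|i hi|i hi]; rewrite !all_cat core_wires_lt !cell_wires_lt ?andbT //; try lia;
    by rewrite /outer; case: ifP.
rewrite mulSn addnA; apply: emit_wf; first lia.
apply/allP => v /mem_take; rewrite mem_cat => /orP[h|]; last by rewrite mem_nseq => /andP[_ /eqP ->]; lia.
by have := allP (core_wires_lt N (b + T * lsize N)) _ h => /=; lia.
Qed.

Lemma machine_gates_sat X N T zw b (O : seq bool -> seq bool) z : X 0 = false -> X 1 -> T < N -> 0 < size z ->
  map X zw = z -> gall (sat_gate X) b (machine_gates N T zw b) ->
  X (machine_out N T b) = ((core_of (iter T (step O) (init M z))).2 ord0 == bit true).
Proof.
move=> x0 x1 TN z0 hz.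
have ss t : size (step_layer N (b + t * lsize N)) = lsize N by apply: size_layer.
have st (s : seq nat) : arity <= size s -> size (take arity s) = arity.
  by move=> h; rewrite size_takel.
rewrite 2!gall_cat size_init_layer (size_blocks _ ss) (gall_blocks _ _ _ ss) => /and3P[h1 h2 h3].
pose inv t := map X (core_wires (b + t * lsize N)) = onehot (core_of (iter t (step O) (init M z)))
  /\ forall d i, i + t < N ->
    map X (cell_wires d N (b + t * lsize N) i) = onehot (cell_of d (iter t (step O) (init M z)) i).
have nzw i : X (nth 0 zw i) = nth false z i.
  have [hi|hi] := ltnP i (size zw); first by rewrite -hz (nth_map 0).
  by rewrite !nth_default ?x0 // -hz size_map.
have szw : size zw = size z by rewrite -hz size_map.
(* [cell_init] reads its inputs 0 and 1, which must survive the truncation to [arity]. *)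
have a4 : 1 < arity.
  have : 0 < #|core| by apply/card_gt0P; exists core0.
  have : 0 < #|cell| by apply/card_gt0P; exists cell0.
  by rewrite /arity; lia.
have inv0 : inv 0.
  have s1 a (s : seq nat) : size (take arity (a :: s ++ nseq arity 0)) = arity.
    by rewrite st //= size_cat size_nseq; lia.
  have [hA hC] := layer_sat x0 x1 (s1 (nth 0 zw 0) [::]) (fun i _ => size_nseq arity 0)
    (fun i _ => s1 (nth 0 zw i.+1) [:: nat_of_bool (i.+1 < size zw)])
    (fun s => size_onehot _) (fun i s => size_onehot _) (fun i s => size_onehot _) h1.
  rewrite /inv mul0n addn0; split.
    rewrite hA.
    rewrite /core_init map_take /= /core_of nth_take ?arity_gt0 //= nzw.
    congr onehot; congr pair; apply/ffunP => r; rewrite !ffunE /=.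
    by case: eqP => // _; case: (z) z0.
  move=> d i; rewrite addn0 => hi; rewrite hC //.
  case: d; rewrite /cell_init; congr onehot; apply/ffunP => r; rewrite !ffunE.
    rewrite map_take (nth_take _ a4) (nth_take _ arity_gt0) /= nzw /= szw.
    case: eqP => _ /=; last by rewrite nth_nil.
    rewrite nth_behead; have [hs|hs] := ltnP i.+1 (size z); last first.
      by rewrite x0 nth_default // size_map.
    by rewrite x1 (nth_map false).
  rewrite map_nseq x0 (nth_nseq false arity) a4 andbF /=.
  by case: (r == ord0); rewrite nth_nil.
have invS t : t < T -> inv t -> inv t.+1.
  move=> tT [iA iC]; move: (allP h2 t); rewrite mem_iota => /(_ tT).
  have -> : b + lsize N + t * lsize N = b + t * lsize N + lsize N by lia.
  move=> hl.
  have sA s : size (core_fun s) = #|core|.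
    by rewrite /core_fun; case: (decode4 _) => [[[? ?] ?] ?]; apply: size_onehot.
  have sC d f s : size (cell_fun d f s) = #|cell|.
    by rewrite /cell_fun; case: (decode4 _) => [[[? ?] ?] ?]; apply: size_onehot.
  have [hA hC] := layer_sat x0 x1 (size_core_ins _ _) (fun i _ => size_cell_ins _ _ _ i)
    (fun i _ => size_cell_ins _ _ _ i) sA (fun i => sC _ _) (fun i => sC _ _) hl.
  have eb : b + t.+1 * lsize N = b + t * lsize N + lsize N by rewrite mulSn; lia.
  rewrite /inv eb; split.
    rewrite hA.
    rewrite /core_ins !map_cat iA !iC; try lia.
    by rewrite /core_fun decode4K -(core_step O).
  move=> d i hi; rewrite hC; last lia.
  have -> : (if d then cell_ins true N (b + t * lsize N) else cell_ins false N (b + t * lsize N)) i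
      = cell_ins d N (b + t * lsize N) i by case: d.
  have hi1 : i.+1 < N by lia.
  rewrite /cell_ins !map_cat iA /outer hi1 !iC; try lia.
  by case: d; rewrite /cell_fun decode4K -(cell_step O).
have invT : forall t, t <= T -> inv t by elim=> // t IH ht; apply: invS => //; apply: IH; lia.
have [iA _] := invT T (leqnn T).
have eb : b + lsize N + T * lsize N = b + T.+1 * lsize N by rewrite mulSn addnA.
rewrite eb in h3; rewrite /machine_out (emit_sat x0 x1 _ h3); last first.
  by apply: st; rewrite size_cat size_nseq; lia.
rewrite map_take map_cat iA /accept_fun /decode4 take_takel; last by rewrite leq_addr.
by rewrite take_size_cat ?size_onehot // onehotK.
Qed.

(** The bits of [x] are known when the circuit is built and become constant wires; only the witness
    is left as input, so that counting accepted inputs counts witnesses. *)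
Definition input_wires (x : seq bool) (k : nat) : seq nat :=
  flatten [seq [:: nat_of_bool b; nat_of_bool b] | b <- x] ++ [:: 0, 1 & iota 2 k].

Lemma input_wires_lt x k : all (fun v => v < k.+2) (input_wires x k).
Proof.
rewrite all_cat /=; apply/andP; split; last by apply/allP => v; rewrite mem_iota; lia.
by elim: x => //= b x ->; rewrite andbT; case: b.
Qed.

Lemma input_wiresE x k (w : k.-tuple bool) (X : nat -> bool) : X 0 = false -> X 1 ->
  (forall i, i < k -> X i.+2 = nth false w i) -> map X (input_wires x k) = pair_code x w.
Proof.
move=> x0 x1 hX; rewrite /input_wires /pair_code map_cat /= x0 x1; congr (_ ++ [:: _, _ & _]).
  by elim: x => //= b x ->; case: b; rewrite /= ?x0 ?x1.
apply: (@eq_from_nth _ false); rewrite size_map size_iota ?size_tuple // => i hi.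
by rewrite (nth_map 0) ?size_iota // nth_iota // hX.
Qed.

Definition accepting_gates T x k := machine_gates T.+1 T (input_wires x k) k.+2.
Definition accepting_out T k := machine_out T.+1 T k.+2.

Lemma accepting_gates_wf T x k : gates_wf k.+2 (accepting_gates T x k).
Proof. by rewrite gates_wfE; apply: machine_gates_wf => //; apply: input_wires_lt. Qed.

Lemma accepting_out_lt T x k : accepting_out T k < k.+2 + size (accepting_gates T x k).
Proof.
rewrite size_machine_gates addnA; apply: cout_lt; lia.
Qed.

Lemma nsat_accepting (O : seq bool -> seq bool) (R : pred (seq bool)) T x k :
  (forall w : k.-tuple bool, runs_in M O (pair_code x w) T [:: R (pair_code x w)]) ->
  nsat k (accepting_gates T x k) (accepting_out T k) = #|[set w : k.-tuple bool | R (pair_code x w)]|.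
Proof.
move=> hR; apply: eq_card => w; rewrite !inE.
have hw : gates_wf (size [:: false, true & w]) (accepting_gates T x k).
  by rewrite /= size_tuple; apply: accepting_gates_wf.
have hs := sat_ev hw; rewrite [size _]/= size_tuple in hs.
rewrite (@machine_gates_sat (nth false (ev [:: false, true & w] (accepting_gates T x k))) T.+1 T (input_wires x k) k.+2 O (pair_code x w)) //.
- have [_] := hR w; rewrite /contents ffunE /read.
  by case: ((iter _ _ _).2 ord0).2 => [|[[[]|]|] s] //= [] <-.
- exact: nth_ev.
- by rewrite (@nth_ev _ _ 1).
- by rewrite size_cat /= addnS.
by apply: input_wiresE => [||i hi]; rewrite nth_ev //= size_tuple.
Qed.

Section Pt.

Context {X : Type} {cX : code X}.

Lemma pt_nat_of_bool (f : X -> bool) : pt f -> pt (fun y => nat_of_bool (f y)).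
Proof.
move=> pf; apply: (pt_ext (f := fun y => if f y then 1 else 0)); last by pt_tac.
by move=> y; case: (f y).
Qed.

Lemma pt_core_wires (b : X -> nat) : pt b -> pt (fun y => core_wires (b y)).
Proof. exact: pt_vouts. Qed.

Lemma pt_cell_wires d (N b i : X -> nat) : pt N -> pt b -> pt i ->
  pt (fun y => cell_wires d (N y) (b y) (i y)).
Proof. by move=> pN pb pi; apply: pt_vouts; pt_tac. Qed.

Lemma pt_outer (N i : X -> nat) : pt N -> pt i -> pt (fun y => outer (N y) (i y)).
Proof. by move=> pN pi; rewrite /outer; pt_tac. Qed.

Lemma pt_lsize (N : X -> nat) : pt N -> pt (fun y => lsize (N y)).
Proof.
move=> pN; apply: (pt_ext (f := fun y => asz + (N y * bsz + N y * bsz))); last by pt_tac.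
by move=> y; rewrite /lsize addnn.
Qed.

End Pt.

Ltac pt_user3 ::= first
  [ apply: pt_nat_of_bool | apply: pt_core_wires | apply: pt_cell_wires | apply: pt_outer
  | apply: pt_lsize | apply: pt_vec | apply: pt_flatten ].

Section Pt2.

Context {X : Type} {cX : code X}.

Lemma pt_cell_ins d (N b i : X -> nat) : pt N -> pt b -> pt i ->
  pt (fun y => cell_ins d (N y) (b y) (i y)).
Proof. by move=> pN pb pi; rewrite /cell_ins; pt_tac. Qed.

Lemma pt_core_ins (N b : X -> nat) : pt N -> pt b -> pt (fun y => core_ins (N y) (b y)).
Proof. by move=> pN pb; rewrite /core_ins; pt_tac. Qed.

End Pt2.

Ltac pt_user2 ::= first
  [ apply: pt_cell_ins | apply: pt_core_ins ].

Section Pt3.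

Context {X : Type} {cX : code X}.

Lemma pt_block (N : X -> nat) F0 F1 (ins : X -> nat -> seq nat) (b : X -> nat) :
  pt N -> pt b -> pt (fun y : X * nat => ins y.1 y.2) ->
  pt (fun y => block (N y) (fun i => if i == 0 then F0 else F1) (ins y) (b y)).
Proof.
move=> pN pb pi; apply: pt_flatten.
apply: (pt_ext (f := fun y => [seq if i == 0 then vec arity #|cell| F0 (ins y i) (b y + i * bsz)
   else vec arity #|cell| F1 (ins y i) (b y + i * bsz) | i <- iota 0 (N y)])).
  by move=> y; apply: eq_map => i; case: ifP.
apply: pt_map; first by pt_tac.
have pi' : pt (fun y : X * nat => ins y.1 y.2) by [].
by apply: pt_if; [pt_tac | apply: pt_vec; pt_tac | apply: pt_vec; pt_tac].
Qed.

Lemma pt_step_layer (N b : X -> nat) : pt N -> pt b -> pt (fun y => step_layer (N y) (b y)).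
Proof.
move=> pN pb.
have eF d i : cell_fun d (i == 0) = if i == 0 then cell_fun d true else cell_fun d false.
  by case: ifP.
have e d : (fun i => cell_fun d (i == 0)) = fun i => if i == 0 then cell_fun d true else cell_fun d false.
  by apply: functional_extensionality.
rewrite /step_layer /layer !e; apply: pt_cat; [apply: pt_vec; by pt_tac |].
by apply: pt_cat; apply: pt_block; pt_tac.
Qed.

Lemma pt_init_layer (N b : X -> nat) (z : X -> seq nat) : pt N -> pt b -> pt z ->
  pt (fun y => init_layer (N y) (z y) (b y)).
Proof.
move=> pN pb pz.
have e : (fun=> cell_init) = fun i : nat => if i == 0 then cell_init else cell_init.
  by apply: functional_extensionality => i; case: ifP.
rewrite /init_layer /layer !e; apply: pt_cat; [apply: pt_vec; by pt_tac |].
by apply: pt_cat; apply: pt_block; pt_tac.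
Qed.

End Pt3.

Section Pt4.

Context {X : Type} {cX : code X}.

Lemma pt_machine_gates (N T b : X -> nat) (z : X -> seq nat) : pt N -> pt T -> pt b -> pt z ->
  pt (fun y => machine_gates (N y) (T y) (z y) (b y)).
Proof.
move=> pN pT pb pz; apply: pt_cat; first exact: pt_init_layer.
apply: pt_cat; last by apply: pt_emit; pt_tac.
apply: pt_flatten; apply: pt_map; first by pt_tac.
by apply: pt_step_layer; pt_tac.
Qed.

Lemma pt_input_wires (x : X -> seq bool) (k : X -> nat) : pt x -> pt k ->
  pt (fun y => input_wires (x y) (k y)).
Proof.
move=> px pk; apply: pt_cat; last by pt_tac.
by apply: pt_flatten; apply: pt_map => //; pt_tac.
Qed.

End Pt4.

Section Pt5.

Context {X : Type} {cX : code X}.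

Lemma pt_accepting_gates (T k : X -> nat) (x : X -> seq bool) : pt T -> pt k -> pt x ->
  pt (fun y => accepting_gates (T y) (x y) (k y)).
Proof. by move=> pT pk px; apply: pt_machine_gates; pt_tac; apply: pt_input_wires. Qed.

Lemma pt_accepting_out (T k : X -> nat) : pt T -> pt k -> pt (fun y => accepting_out (T y) (k y)).
Proof.
move=> pT pk; rewrite /accepting_out /machine_out /cout.
by case: arity => [|a]; pt_tac.
Qed.

End Pt5.

End Simulation.

(** * The constructions are computable in polynomial time *)

Ltac pt_user ::= fail.
Ltac pt_user2 ::= fail.
Ltac pt_user3 ::= fail.

(** A map over [iota] instead of a recursion that passes on its state: the closure lemmas apply to
    it directly. *)
Lemma path_opsE w r v n :
  path_ops w r v n
  = [seq ((if i == 0 then v else n + i.-1 * w) :: iota (n + i * w) w, w) | i <- iota 0 r].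
Proof.
elim: r v n => // r IH v n; rewrite [iota 0 _]/= [path_ops _ _ _ _]/= IH map_cons eqxx mul0n addn0.
congr (_ :: _); rewrite (iotaDl 1 0) -map_comp; apply: eq_map => -[|i] /=.
  by rewrite mul0n !addn0 mul1n.
by rewrite add1n !mulSn; congr (_ :: iota _ _, _); lia.
Qed.

Lemma path_endE w r v n : path_end w r v n = if r == 0 then v else n + r.-1 * w.
Proof. by case: r. Qed.

Lemma pad_opsE w D v n : pad_ops w D v n = [seq (v :: iota (n + i * w) w, w) | i <- iota 0 D].
Proof.
elim: D n => // D IH n; rewrite [iota 0 _]/= [pad_ops _ _ _ _]/= IH map_cons mul0n addn0.
congr (_ :: _); rewrite (iotaDl 1 0) -map_comp; apply: eq_map => i /=.
by rewrite mulSn; congr (_ :: iota _ _, _); lia.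
Qed.

Section GraphOps.

Variables (w r s : nat).

Fixpoint handles_after (E : seq (nat * nat)) (hs : seq nat) (n : nat) : seq nat :=
  if E is uv :: E' then handles_after E' (step_handles w r s hs uv n) (n + step_size w r s) else hs.

Lemma handles_rcons E uv hs n : handles_after (rcons E uv) hs n
  = step_handles w r s (handles_after E hs n) uv (n + size E * step_size w r s).
Proof.
elim: E hs n => [|e E IH] hs n /=; first by rewrite addn0.
by rewrite IH mulSn addnA.
Qed.

Lemma graph_ops_rcons E uv hs n : graph_ops w r s (rcons E uv) hs n
  = graph_ops w r s E hs n ++ step_ops w r s (handles_after E hs n) uv (n + size E * step_size w r s).
Proof.
elim: E hs n => [|e E IH] hs n; first by rewrite /= cats0 addn0.
by rewrite [rcons _ _]/= [graph_ops _ _ _ (_ :: _) _ _]/= IH [in RHS]/= mulSn addnA catA.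
Qed.

(* The current handle of [v] just before the [j]-th edge is treated. *)
Definition handle (E : seq (nat * nat)) (n0 v j : nat) : nat :=
  foldl (fun cur (x : (nat * nat) * nat) =>
      if v == x.1.2 then (step_out w r s x.2).2 else if v == x.1.1 then (step_out w r s x.2).1 else cur)
    v [seq (nth (0, 0) E i, n0 + i * step_size w r s) | i <- iota 0 j].

Lemma handleE E hs n0 v j : j <= size E -> nth 0 hs v = v ->
  nth 0 (handles_after (take j E) hs n0) v = handle E n0 v j.
Proof.
move=> hj hv; elim: j hj => [|j IH] hj; first by rewrite take0.
rewrite (take_nth (0, 0)) // handles_rcons size_takel 1?ltnW // /step_handles !nth_set_nth /=.
rewrite -[j.+1]addn1 /handle iotaD map_cat foldl_cat /= -/(handle _ _ _ _) -IH 1?ltnW //.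
by rewrite nth_set_nth.
Qed.

Definition step_ops_of (hu hv : nat) (n : nat) : seq op :=
  let n1 := n + r * w in let n2 := n1 + w in let n3 := n2 + r * w in
  let n4 := n3 + s * w in let n5 := n4 + r * w in let n6 := n5 + w.-1 in
  path_ops w r hu n
  ++ [:: (path_end w r hu n :: iota n1 w, w)]
  ++ path_ops w r n1 n2
  ++ path_ops w s n1.+1 n3
  ++ path_ops w r hv n4
  ++ [:: (path_end w r hv n4 :: path_end w s n1.+1 n3 :: iota n5 w.-1, w.-1)]
  ++ path_ops w r n5 n6.

(** The recursion threads the list of handles; here the j-th gadget is a function of j alone, its
    handles being found again by scanning the earlier edges. *)
Lemma graph_opsE E hs n0 : (forall v, nth 0 hs v = v \/ size hs <= v) ->
  all (fun uv => (uv.1 < size hs) && (uv.2 < size hs)) E ->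
  graph_ops w r s E hs n0 = flatten
    [seq let uv := nth (0, 0) E j in let n := n0 + j * step_size w r s in
       step_ops_of (handle E n0 uv.1 j)
         (if uv.2 == uv.1 then (step_out w r s n).1 else handle E n0 uv.2 j) n
    | j <- iota 0 (size E)].
Proof.
move=> hhs hE.
have main j : j <= size E -> graph_ops w r s (take j E) hs n0 = flatten
    [seq let uv := nth (0, 0) E j in let n := n0 + j * step_size w r s in
       step_ops_of (handle E n0 uv.1 j)
         (if uv.2 == uv.1 then (step_out w r s n).1 else handle E n0 uv.2 j) n
    | j <- iota 0 j]; last by rewrite -main // take_size.
elim: j => [|j IH] hj; first by rewrite take0.
rewrite (take_nth (0, 0)) // graph_ops_rcons IH 1?ltnW // size_takel 1?ltnW //.
rewrite -[j.+1]addn1 iotaD map_cat flatten_cat add0n [map _ (iota j 1)]/= [flatten [:: _]]/= cats0.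
congr (_ ++ _); have /andP[h1 h2] := allP hE _ (mem_nth (0, 0) hj).
have eq v : v < size hs -> nth 0 hs v = v by case: (hhs v) => // ?; lia.
rewrite /step_ops nth_set_nth /= !(@handleE E) ?eq // 1?ltnW //.
Qed.

End GraphOps.

Definition bits_of (n : nat) (es : seq (seq nat)) : seq bool :=
  nseq n true ++ false :: nseq (size es) true ++ false ::
  flatten [seq [seq v \in e | v <- iota 0 n] | e <- es].

Lemma encode_set_of n es : encode (map (vset n) es) = bits_of n es.
Proof.
rewrite /encode /bits_of size_map -map_comp; congr (_ ++ _ :: _ ++ _ :: flatten _).
apply: eq_map => e /=; rewrite -val_enum_ord -map_comp; apply: eq_map => i /=.
by rewrite inE.
Qed.

Section Pt.

Context {X : Type} {cX : code X}.

Lemma pt_path_ops w (r v n : X -> nat) : pt r -> pt v -> pt n ->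
  pt (fun x => path_ops w (r x) (v x) (n x)).
Proof.
move=> pr pv pn; apply: pt_ext => [x|]; first by rewrite path_opsE.
by pt_tac.
Qed.

Lemma pt_path_end w (r v n : X -> nat) : pt r -> pt v -> pt n ->
  pt (fun x => path_end w (r x) (v x) (n x)).
Proof.
move=> pr pv pn; apply: pt_ext => [x|]; first by rewrite path_endE.
by pt_tac.
Qed.

Lemma pt_mem (v : X -> nat) (e : X -> seq nat) : pt v -> pt e -> pt (fun x => v x \in e x).
Proof.
move=> pv pe; apply: (pt_ext (f := fun x => has (fun u => v x == u) (e x))); last by pt_tac.
by move=> x; rewrite -has_pred1; apply: eq_has => u /=; rewrite eq_sym.
Qed.

End Pt.

Ltac pt_user ::= first [ apply: pt_path_ops | apply: pt_path_end | apply: pt_mem ].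

Section Pt2.

Context {X : Type} {cX : code X}.

Lemma pt_step_out w (r s n : X -> nat) : pt r -> pt s -> pt n ->
  pt (fun x => step_out w (r x) (s x) (n x)).
Proof. by move=> pr ps pn; rewrite /step_out; pt_tac. Qed.

Lemma pt_step_size w (r s : X -> nat) : pt r -> pt s -> pt (fun x => step_size w (r x) (s x)).
Proof. by move=> pr ps; rewrite /step_size; pt_tac. Qed.

Lemma pt_step_ops_of w (r s a b n : X -> nat) : pt r -> pt s -> pt a -> pt b -> pt n ->
  pt (fun x => step_ops_of w (r x) (s x) (a x) (b x) (n x)).
Proof. by move=> pr ps pa pb pn; rewrite /step_ops_of; pt_tac. Qed.

Lemma pt_bits_of (n : X -> nat) (es : X -> seq (seq nat)) : pt n -> pt es ->
  pt (fun x => bits_of (n x) (es x)).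
Proof. by move=> pn pes; rewrite /bits_of; pt_tac. Qed.

Lemma pt_apex_pairs q (nv : X -> nat) : pt nv -> pt (fun x => apex_pairs q (nv x)).
Proof. by move=> pn; rewrite /apex_pairs; pt_tac. Qed.

Lemma pt_circuit_edges p (k : X -> nat) (gs : X -> seq (nat * nat)) : pt k -> pt gs ->
  pt (fun x => circuit_edges p (k x) (gs x)).
Proof. by move=> pk pg; rewrite /circuit_edges /gate_edges; pt_tac. Qed.

End Pt2.

Ltac pt_user2 ::= first
  [ apply: pt_step_out | apply: pt_step_size | apply: pt_step_ops_of | apply: pt_bits_of
  | apply: pt_apex_pairs | apply: pt_circuit_edges ].

Section Pt3.

Context {X : Type} {cX : code X}.

Lemma pt_spin_edges q (k out : X -> nat) (gs : X -> seq (nat * nat)) : pt k -> pt gs -> pt out ->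
  pt (fun x => spin_edges q (k x) (gs x) (out x)).
Proof. by move=> pk pg po; rewrite /spin_edges /half_edges; pt_tac. Qed.

Lemma pt_handle w (r s n v j : X -> nat) (E : X -> seq (nat * nat)) :
  pt r -> pt s -> pt n -> pt v -> pt j -> pt E ->
  pt (fun x => handle w (r x) (s x) (E x) (n x) (v x) (j x)).
Proof.
move=> pr ps pn pv pj pE; rewrite /handle.
apply: (pt_foldl_pt (g := fun y : X * ((nat * nat) * nat) => step_out w (r y.1) (s y.1) y.2.2) (c := 0)) => //;
  try by pt_tac.
move=> x y z; rewrite sze_pair /=; case: ifP => _; first by lia.
by case: ifP => _; lia.
Qed.

End Pt3.

Ltac pt_user3 ::= first [ apply: pt_handle | apply: pt_spin_edges ].

Lemma hyper_opsE w r s D E nv : spins_in nv E ->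
  hyper_ops w r s D E nv = flatten
    [seq let uv := nth (0, 0) E j in let n := nv.+1 + j * step_size w r s in
       step_ops_of w r s (handle w r s E nv.+1 uv.1 j)
         (if uv.2 == uv.1 then (step_out w r s n).1 else handle w r s E nv.+1 uv.2 j) n
    | j <- iota 0 (size E)]
  ++ [seq (nv :: iota (nv.+1 + size E * step_size w r s + i * w) w, w) | i <- iota 0 D].
Proof.
move=> hE; rewrite /hyper_ops pad_opsE graph_opsE //.
  by move=> v; rewrite size_iota; case: (ltnP v nv) => h; [left; rewrite nth_iota | right].
by rewrite size_iota.
Qed.

Section Pt4.

Context {X : Type} {cX : code X}.

Lemma pt_all_edges w0 D (r s nv : X -> nat) (E : X -> seq (nat * nat)) :
  pt r -> pt s -> pt nv -> pt E -> (forall x, spins_in (nv x) (E x)) ->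
  pt (fun x => all_edges w0 (r x) (s x) D (E x) (nv x)).
Proof.
move=> pr ps pn pE hE; apply: pt_map; last exact: (pt_fst (pt_snd pt_id)).
apply: pt_ext => [x|]; [by rewrite hyper_opsE | repeat (intros; pt1)].
Qed.

Lemma pt_all_size w0 D (r s nv : X -> nat) (E : X -> seq (nat * nat)) :
  pt r -> pt s -> pt nv -> pt E -> pt (fun x => all_size w0 (r x) (s x) D (E x) (nv x)).
Proof. by move=> pr ps pn pE; rewrite /all_size /main_size; pt_tac. Qed.

End Pt4.

(** * Hardness *)

Lemma pt_horner {X : Type} {cX : code X} (p : {poly nat}) (n : X -> nat) :
  pt n -> pt (fun x => (p.[n x])%R).
Proof.
move=> pn; rewrite /horner; elim: (polyseq p) => [|a s IH]; first exact: pt_const.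
exact: (pt_addn (pt_muln IH pn) (pt_const _)).
Qed.

Lemma count_hyper w0 r s D q E nv (i0 : 'I_q) : 1 < D -> 1 < q -> spins_in nv E ->
  count_colourings w0.+3 D q (bits_of (all_size w0 r s D E nv) (all_edges w0 r s D E nv))
  = ncol i0 (main_size w0 r s E nv) (main_edges w0 r s E nv) * (q ^ w0.+2 - 1) ^ D.
Proof.
move=> D1 q1 hE; have q0 : 0 < q by lia.
have [hw c0 c1] := @hyper_wf w0.+2 isT r s D E nv hE.
have eN : all_size w0 r s D E nv = nv.+1 + created (hyper_ops w0.+2 r s D E nv).
  by rewrite created_cat created_graph created_pad addnA.
have s0 : 0 < size (hyper_ops w0.+2 r s D E nv).
  by rewrite size_cat addn_gt0; apply/orP; right; case: D D1 {hw c0 c1 eN}.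
have [us hc] := hclass_ops D1 hw (ltnSn nv) c0 c1 s0.
rewrite -encode_set_of eN count_colourings_encode // (num_colourings_ncol i0).
  by rewrite -eN -(ncol_pad i0 w0 r s D q0 hE).
have := wf_edges hw; apply: sub_all => e /and3P[/eqP se _ ->].
by rewrite se.
Qed.

Section Reduction.

Variables (w0 D q : nat) (i0 : 'I_q) (D1 : 1 < D) (q1 : 1 < q).
Variables (g : seq bool -> nat) (r s nv : seq bool -> nat) (E : seq bool -> seq (nat * nat)).
Hypotheses (pr : pt r) (ps : pt s) (pn : pt nv) (pE : pt E).
Hypothesis hE : forall x, spins_in (nv x) (E x).
Variable fin : seq bool -> nat -> nat.
Hypothesis pfin : pt (fun y : seq bool * bin => Bin (fin y.1 (bval y.2))).
Hypothesis finE : forall x,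
  fin x (ncol i0 (main_size w0 (r x) (s x) (E x) (nv x)) (main_edges w0 (r x) (s x) (E x) (nv x))) = g x.

(** Bounds the length of the answer of the oracle, linearly in the query. *)
Lemma count_colourings_le m x : count_colourings m D q x <= q ^ size x.
Proof.
rewrite /count_colourings /count_colourings_on; case: pickP => // F _.
rewrite /num_colourings; apply: leq_trans (max_card _) _; rewrite card_ffun !card_ord.
by rewrite leq_pexp2l ?index_size //; lia.
Qed.

Lemma reduction : turing_reducible g (count_colourings w0.+3 D q).
Proof.
pose pre x := bits_of (all_size w0 (r x) (s x) D (E x) (nv x)) (all_edges w0 (r x) (s x) D (E x) (nv x)).
pose post (y : seq bool * seq bool) := binary (fin y.1 (val2 y.2 %/ (q ^ w0.+2 - 1) ^ D)).
have L0 : 0 < (q ^ w0.+2 - 1) ^ D.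
  by rewrite expn_gt0 subn_gt0 -[X in X < _](exp1n w0.+2) ltn_exp2r // q1.
have ppre : pt pre by apply: pt_bits_of; [apply: pt_all_size | apply: pt_all_edges].
have ppost : pt post.
  apply: pt_binary.
  have pz : pt (fun y : seq bool * seq bool => (y.1, Bin (val2 y.2 %/ (q ^ w0.+2 - 1) ^ D))).
    apply: pt_pair; first by pt_tac.
    by apply: pt_bin_div => //; [apply: pt_val2; pt_tac | exact: pt_const].
  exact: (pt_comp pfin pz).
have hs : pbd size (fun x => size (binary (count_colourings w0.+3 D q (pre x)))).
  apply: (@pbd_le _ _ _ (fun x => (size (pre x) * blen q).+1)).
    move=> x; apply: leq_trans (blen_mono (count_colourings_le _ _)) _; exact: blen_exp.
  apply: pbd_succ; apply: pbd_mul; last exact: pbd_const.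
  by apply: pbd_sze_bits; apply: pbd_size_bits; apply: pt_size.
have := @polytime_oracle_of_pt (fun x => binary (count_colourings w0.+3 D q x)) _ _ ppre ppost hs.
move=> [M [p h]]; exists M, p => x; have := h x.
rewrite /post /= val2_binary /pre (@count_hyper _ _ _ _ _ _ _ i0) // mulnK //.
by rewrite finE.
Qed.

End Reduction.

Ltac pt_user2 ::= fail.
Ltac pt_user3 ::= fail.

Ltac pt_bin :=
  lazymatch goal with
  | |- pt (fun x => Bin (@?f x + @?g x)) => first [ apply: pt_const | apply: pt_bin_add; pt_bin ]
  | |- pt (fun x => Bin (@?f x - @?g x)) => first [ apply: pt_const | apply: pt_bin_sub; pt_bin ]
  | |- pt (fun x => Bin (@?f x * @?g x)) => first [ apply: pt_const | apply: pt_bin_mul; pt_bin ]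
  | |- pt (fun x => Bin (@?f x ^ @?g x)) => first [ apply: pt_const | apply: pt_bin_exp; [ pt_bin | pt_tac ] ]
  | |- pt (fun x => Bin (@?f x %/ @?g x)) => first [ apply: pt_const | apply: pt_bin_div; [ pt_bin | pt_bin | idtac ] ]
  | |- pt (fun x => Bin (@?f x %% @?g x)) => first [ apply: pt_const | apply: pt_bin_mod; [ pt_bin | pt_bin | idtac ] ]
  | |- pt (fun x => Bin (bval (@?f x))) => apply: pt_bval; pt_tac
  | |- _ => first [ apply: pt_const | apply: pt_bin_of_nat; pt_tac ]
  end.

Lemma sharpP_hard m D q g : 2 < m -> 1 < D -> 1 < q -> sharpP g ->
  turing_reducible g (count_colourings m D q).
Proof.
move=> hm D1 q1 [p [R [[M [p' [nq hR]]] hg]]].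
have [w0 ->] : exists w0, m = w0.+3 by exists (m - 3); lia.
pose k (x : seq bool) := (p.[size x])%R.
(* The time of the verifier on [pair_code x w], which has exactly this length. *)
pose T (x : seq bool) := (p'.[(2 * size x + 2 + k x)%N])%R.
pose gs x := accepting_gates M (T x) x (k x).
pose out x := accepting_out M (T x) (k x).
pose nv x := q - 2 + ((k x).+2 + size (gs x)).
pose E x := spin_edges q (k x) (gs x) (out x).
(* Three monochromatic edges for each gate, in each of the two copies of [half_edges]. *)
pose t x := 6 * size (gs x).
have pk : pt k by apply: pt_horner; pt_tac.
have pT : pt T by apply: pt_horner; pt_tac.
have pgs : pt gs by apply: pt_accepting_gates => //; pt_tac.
have pout : pt out by apply: pt_accepting_out.
have pnv : pt nv by rewrite /nv; pt_tac.
have pE : pt E by apply: pt_spin_edges.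
have ptt : pt t by rewrite /t; pt_tac.
have hw x : gates_wf (k x).+2 (gs x) by apply: accepting_gates_wf.
have ho x : out x < (k x).+2 + size (gs x) by apply: accepting_out_lt.
have hE x : spins_in (nv x) (E x) by apply: spin_edges_in.
have satE x : nsat (k x) (gs x) (out x) = g x.
  rewrite hg; apply: (nsat_accepting nq (O := fun=> [::])) => w.
  have := hR (pair_code x w); congr (runs_in _ _ _ _ _); congr (horner _ _).
  rewrite /pair_code size_cat /= size_tuple.
  have -> (y : seq bool) : size (flatten [seq [:: b; b] | b <- y]) = 2 * size y.
    by elim: y => //= b y ->; lia.
  by rewrite -/(k x); lia.
have q0 : 0 < q by lia.
pose i0 := Ordinal q0.
have mE (i : 'I_q) x := @spin_min q i (k x) (gs x) (out x) q1 (hw x) (ho x).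
have nE (i : 'I_q) x : nmono i (nv x) (E x) (t x) = q`! * g x.
  by rewrite /nmono -satE; apply: nmono_spin.
have [q3|q2] := ltnP 2 q.
  pose B x := many_base q (nv x).
  have B0 x : 0 < B x by apply: leq_ltn_trans (many_base_gt q3 (nv x)).
  pose E' x := flatten (nseq (copies (nv x)) (E x)).
  have pE' : pt E' by rewrite /E' /copies; pt_tac.
  (* The factor q stems from the colour of the centre, q! from the permutations of the colours. *)
  pose fin x Z := ((q ^ size (E' x) * Z) %% B x ^ (t x).+1) %/ B x ^ t x %/ (q * q`!).
  apply: (@reduction w0 D q i0 D1 q1 g (fun=> 0) (fun x => many_len (nv x) (t x)) nv E' _ _ _ _ _ fin) => //.
  - exact: pt_const.
  - by rewrite /many_len /copies; pt_tac.
  - by move=> x; apply: spins_in_dup.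
  - have pB (Y : Type) (cY : code Y) (f : Y -> seq bool) : pt f -> pt (fun y => Bin (B (f y))).
      by move=> pf; rewrite /B /many_base /copies; pt_bin.
    rewrite /fin; apply: pt_bin_div; [| exact: pt_const | by move=> _; rewrite muln_gt0 q0 fact_gt0].
    apply: pt_bin_div; [| | by move=> y; rewrite expn_gt0 B0].
      apply: pt_bin_mod; [by pt_bin | | by move=> y; rewrite expn_gt0 B0].
      by apply: pt_bin_exp; [apply: pB; pt_tac | pt_tac].
    by apply: pt_bin_exp; [apply: pB; pt_tac | pt_tac].
  move=> x; have := @many_colours q i0 w0 q3 (nv x) (E x) (t x) (hE x) (fun f => mE i0 x _).
  rewrite -/(E' x) -/(B x) nE /fin => ->.
  by rewrite mulnK ?(expn_gt0 (B x)) ?B0 // mulnA mulKn // muln_gt0 q0 fact_gt0.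
have eq2 : q = 2 by lia.
subst q.
pose B x := two_base w0 (nv x); pose P x := two_modulus w0 (nv x) (size (E x)).
have B0 x : 0 < B x by apply: leq_ltn_trans (two_base_gt w0 (nv x)).
have P0 x : 0 < P x by apply: leq_ltn_trans (two_modulus_gt w0 (nv x) (size (E x))).
pose L := 2 ^ w0.+2 - 1; pose h x := two_half (nv x) (size (E x)).
have ph : pt h by rewrite /h /two_half /two_wire; pt_tac.
(* Reducing modulo P recovers the weighted sum itself; reducing modulo the power of B then keeps its
   low digits. *)
pose fin x Z := ((L ^ size (E x) * Z) %% P x) %% B x ^ (t x).+1 %/ B x ^ t x %/ (2 * 2`!).
apply: (@reduction w0 D 2 i0 D1 q1 g h (fun x => h x + two_wire (nv x) + h x) nv E _ _ _ _ _ fin) => //.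
- by rewrite /two_wire; pt_tac.
- have pB (Y : Type) (cY : code Y) (f : Y -> seq bool) : pt f -> pt (fun y => Bin (B (f y))).
    by move=> pf; rewrite /B /two_base /two_wire; pt_bin.
  have pP (Y : Type) (cY : code Y) (f : Y -> seq bool) : pt f -> pt (fun y => Bin (P (f y))).
    by move=> pf; rewrite /P /two_modulus /two_half /two_wire; pt_bin.
  rewrite /fin; apply: pt_bin_div; [| exact: pt_const | by []].
  apply: pt_bin_div; [| | by move=> y; rewrite expn_gt0 B0].
    apply: pt_bin_mod; [| | by move=> y; rewrite expn_gt0 B0].
      by apply: pt_bin_mod => //; [pt_bin | apply: pP; pt_tac].
    by apply: pt_bin_exp; [apply: pB; pt_tac | pt_tac].
  by apply: pt_bin_exp; [apply: pB; pt_tac | pt_tac].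
move=> x; have := @two_colours i0 w0 (nv x) (E x) (t x) (hE x) (odd_spin_edges _ _ _ _) (fun f => mE i0 x _).
rewrite -/(h x) -/(B x) -/L -/(P x) nE /fin => ->.
by rewrite mulnK ?(expn_gt0 (B x)) ?B0 // mulnA mulKn.
Qed.

(** * The tractable cases *)

Section Override.

Variables (V : finType) (q : nat) (i0 : 'I_q) (e : {set V}).

Definition override (c d : {ffun V -> 'I_q}) : {ffun V -> 'I_q} :=
  [ffun v => if v \in e then d v else c v].

(** [G] depends only on the colours outside [e] and [P] only on those inside, so the count
    factorises. The two restrictions are extended by [i0], which keeps both factors in the type of
    all colourings. *)
Lemma card_override (G P : pred {ffun V -> 'I_q}) :
  (forall c d, G (override c d) = G c) -> (forall c d, P (override c d) = P d) ->
  #|[set c | G c && P c]| =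
  #|[set c | G c && (override c [ffun=> i0] == c)]| * #|[set d | P d && (override [ffun=> i0] d == d)]|.
Proof.
move=> hG hP; set A := [set c | G c && (_ == _)]; set B := [set d | P d && (_ == _)].
rewrite -cardsX.
have oo c d : override (override c d) [ffun=> i0] = override c [ffun=> i0].
  by apply/ffunP => v; rewrite !ffunE; case: (v \in e).
have oi c d : override [ffun=> i0] (override c d) = override [ffun=> i0] d.
  by apply/ffunP => v; rewrite !ffunE; case: (v \in e).
have inj : {in setX A B &, injective (fun cd => override cd.1 cd.2)}.
  move=> [c d] [c' d']; rewrite !inE /= => /andP[/andP[_ /eqP c1] /andP[_ /eqP d1]].
  move=> /andP[/andP[_ /eqP c2] /andP[_ /eqP d2]] h.
  by congr pair; [rewrite -c1 -c2 -(oo c d) -(oo c' d') h | rewrite -d1 -d2 -(oi c d) -(oi c' d') h].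
rewrite -(card_in_imset inj); apply: eq_card => c; rewrite inE.
apply/andP/imsetP => [[gc pc]|[[a d]]].
  exists (override c [ffun=> i0], override [ffun=> i0] c).
    rewrite !inE /= hG hP gc pc /=; apply/andP; split; apply/eqP.
      by apply/ffunP => v; rewrite !ffunE; case: (v \in e).
    by apply/ffunP => v; rewrite !ffunE; case: (v \in e).
  by apply/ffunP => v; rewrite !ffunE; case: (v \in e).
by rewrite !inE /= => /andP[/andP[ga _] /andP[pd _]] ->; rewrite hG hP.
Qed.

Lemma card_local : #|[set d : {ffun V -> 'I_q} | override [ffun=> i0] d == d]| = q ^ #|e|.
Proof.
rewrite -[q in RHS]card_ord -(card_pffun_on i0 e (mem 'I_q)).
apply: eq_card => d; rewrite inE; apply/eqP/pffun_onP => [<-|[h _]].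
  split=> [|v _] //; apply/subsetP => v; rewrite inE ffunE /=.
  by case: (v \in e); rewrite // ffunE eqxx.
apply/ffunP => v; rewrite ffunE; case: ifP => // /negbT ve.
rewrite ffunE; apply/esym/eqP; apply: contraR ve => dv.
exact: (subsetP h).
Qed.

Lemma card_local_mono v0 : v0 \in e ->
  #|[set d : {ffun V -> 'I_q} | monochromatic d e && (override [ffun=> i0] d == d)]| = q.
Proof.
move=> ve; pose F (a : 'I_q) := override [ffun=> i0] [ffun=> a].
have inj : injective F by move=> a b /ffunP/(_ v0); rewrite !ffunE ve ?ffunE.
rewrite -[RHS]card_ord -(card_imset _ inj); apply: eq_card => d; rewrite inE.
apply/andP/imsetP => [[hm /eqP hd]|[a _ ->]].
  exists (d v0) => //; rewrite -hd; apply/ffunP => v; rewrite !ffunE.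
  case: ifP => // h; rewrite ?ffunE.
  by move/forallP/(_ v): hm; rewrite h => /forallP/(_ v0); rewrite ve => /eqP.
split; last by apply/eqP/ffunP => v; rewrite !ffunE; case: (v \in e).
apply/forallP => u; apply/implyP => ue; apply/forallP => v; apply/implyP => he.
by rewrite !ffunE ue he ?ffunE.
Qed.

Lemma mono_override (c d : {ffun V -> 'I_q}) : monochromatic (override c d) e = monochromatic d e.
Proof.
apply: eq_forallb => u; case ue: (u \in e) => //=; apply: eq_forallb => v.
by case ve: (v \in e) => //=; rewrite !ffunE ue ve.
Qed.

End Override.

(** Each edge replaces a factor q^m by q^m - q. The powers of q stay on the left side, so that the
    induction meets no subtraction in an exponent. *)
Lemma card_disjoint_colourings (V : finType) q (i0 : 'I_q) m (s : seq {set V}) : 0 < m ->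
  all (fun e : {set V} => #|e| == m) s -> pairwise (fun e f : {set V} => [disjoint e & f]) s ->
  #|[set c : {ffun V -> 'I_q} | all (fun e => ~~ monochromatic c e) s]| * q ^ (m * size s)
  = q ^ #|V| * (q ^ m - q) ^ size s.
Proof.
move=> m0; elim: s => [|e s IH] /=.
  move=> _ _; rewrite muln0 !muln1; have -> : [set c : {ffun V -> 'I_q} | true] = setT by apply/setP => c; rewrite !inE.
  by rewrite cardsT card_ffun card_ord.
move=> /andP[/eqP se hs] /andP[he hp]; have {IH} := IH hs hp.
pose G (c : {ffun V -> 'I_q}) := all (fun f => ~~ monochromatic c f) s.
have hG c d : G (override e c d) = G c.
  apply: eq_in_all => f fs; congr negb; have dis : [disjoint e & f] by apply: (allP he).
  apply: eq_forallb => u; case uf: (u \in f) => //=; apply: eq_forallb => v.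
  case vf: (v \in f) => //=; rewrite !ffunE.
  by rewrite !(disjointFl dis).
have [v0 ve] : exists v0, v0 \in e by apply/card_gt0P; rewrite se.
set K := #|[set c | G c && (override e c [ffun=> i0] == c)]|.
have e1 : #|[set c | G c]| = K * q ^ m.
  have := @card_override V q i0 e G predT hG (fun _ _ => erefl).
  rewrite /= -/K; have -> : [set c | G c && true] = [set c | G c] by apply/setP => c; rewrite !inE andbT.
  by move=> ->; congr (_ * _); rewrite -se -(card_local i0).
have e2 : #|[set c | ~~ monochromatic c e && G c]| = K * (q ^ m - q).
  have := @card_override V q i0 e G (fun c => ~~ monochromatic c e) hG (fun c d => congr1 negb (mono_override e c d)).
  have -> : [set c | G c && ~~ monochromatic c e] = [set c | ~~ monochromatic c e && G c].
    by apply/setP => c; rewrite !inE andbC.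
  move=> ->; congr (_ * _).
  have := cardsID [set d : {ffun V -> 'I_q} | monochromatic d e] [set d | override e [ffun=> i0] d == d].
  rewrite card_local se.
  have -> : [set d | override e [ffun=> i0] d == d] :&: [set d | monochromatic d e]
      = [set d | monochromatic d e && (override e [ffun=> i0] d == d)].
    by apply/setP => d; rewrite !inE andbC.
  rewrite (card_local_mono i0 ve) => <-; rewrite addKn; apply: eq_card => d.
  by rewrite !inE.
rewrite -/G e1 e2 => IH.
have q0 : 0 < q by apply: leq_ltn_trans (leq0n i0) (ltn_ord i0).
by rewrite mulnS expnD expnS [RHS]mulnCA -IH -!mulnA mulnCA.
Qed.

Definition disjoint_count (m q n k : nat) : nat := (q ^ m - q) ^ k * q ^ (n - m * k).

Lemma num_colourings_disjoint n q m D (s : seq {set 'I_n}) : 0 < m -> uniq s ->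
  hclass [set:: s] m D -> D <= 1 \/ q <= 1 ->
  num_colourings [set:: s] q = disjoint_count m q n (size s).
Proof.
move=> m0 us; rewrite hclass_rows // => /and3P[hm hd _] hc.
have sm : all (fun e : {set 'I_n} => #|e| == m) s.
  by move: hm; rewrite all_map; apply: sub_all => e /=; rewrite count_row.
have colE (c : {ffun 'I_n -> 'I_q}) :
    colouring [set:: s] c = all (fun e => ~~ monochromatic c e) s.
  apply/forallP/allP => [h e ee|h e]; first by have := h e; rewrite inE ee.
  by apply/implyP; rewrite inE => /h.
have -> : num_colourings [set:: s] q = #|[set c : {ffun 'I_n -> 'I_q} | all (fun e => ~~ monochromatic c e) s]|.
  by apply: eq_card => c; rewrite !inE colE.
(* For q <= 1 a single edge excludes every colouring, and q^m = q makes the formula vanish as well,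
   whatever the degrees. *)
rewrite /disjoint_count; have [q1|q1] := leqP q 1.
  case: s sm {us hm hd colE} => [_|e s /= /andP[/eqP se _]].
    have -> : [set c : {ffun 'I_n -> 'I_q} | all (fun e : {set 'I_n} => ~~ monochromatic c e) [::]] = setT.
      by apply/setP => c; rewrite !inE.
    by rewrite cardsT card_ffun !card_ord muln0 subn0 mul1n.
  have -> : q ^ m - q = 0 by case: q q1 {hc} => [|[|]] //; rewrite ?exp1n ?exp0n.
  rewrite exp0n // mul0n; apply/eqP; rewrite cards_eq0; apply/eqP/setP => c; rewrite !inE.
  apply/negP => /andP[/negP h _]; apply: h; apply/forallP => u; apply/implyP => _.
  apply/forallP => v; apply/implyP => _; apply/eqP; apply: ord_inj.
  by move: (ltn_ord (c u)) (ltn_ord (c v)) q1; move: (nat_of_ord _) (nat_of_ord _) => a b; lia.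
have D1 : D <= 1 by lia.
have q0 : 0 < q by lia.
have disj e f : e \in s -> f \in s -> e != f -> [disjoint e & f].
  move=> es fs ef; apply/pred0P => v /=; apply/negP => /andP[ve vf].
  have : row_degree (map (@row_of n) s) v <= D by apply: (allP hd); rewrite mem_iota ltn_ord.
  rewrite row_degreeE // leqNgt => /negP; apply; apply: leq_ltn_trans D1 _.
  have -> : 2 = #|[set e; f]| by rewrite cards2 ef.
  apply: subset_leq_card; apply/subsetP => h; rewrite !inE.
  by case/orP=> /eqP ->; rewrite ?es ?fs ?ve ?vf.
have pw : pairwise (fun e f : {set 'I_n} => [disjoint e & f]) s.
  elim: s us disj {sm hm hd colE} => //= e s IH /andP[es us] disj; apply/andP; split.
    apply/allP => f fs; apply: disj; rewrite ?inE ?eqxx ?fs ?orbT //.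
    by apply: contraNneq es => ->.
  by apply: IH => // f h fs hs; apply: disj; rewrite inE ?fs ?hs orbT.
have := card_disjoint_colourings (Ordinal q0) m0 sm pw; rewrite card_ord.
(* Disjoint edges of size m fit into n vertices, so the truncated subtraction in [disjoint_count] is
   exact. *)
have mk : m * size s <= n.
  have tI : trivIset [set:: s].
    by apply/trivIsetP => e f; rewrite !inE; apply: disj.
  have := max_card (mem (cover [set:: s])); rewrite card_ord; apply: leq_trans.
  move/eqP: tI => <-; rewrite (eq_bigr (fun=> m)); last first.
    by move=> e; rewrite inE => /(allP sm)/eqP.
  by rewrite sum_nat_const mulnC cardsE (card_uniqP us).
move=> h; apply/eqP; rewrite -(eqn_pmul2r (_ : 0 < q ^ (m * size s))); last by rewrite expn_gt0 q0.
by rewrite h -mulnA -expnD subnK // mulnC.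
Qed.

Lemma polytime_count m D q : 0 < m -> D <= 1 \/ q <= 1 ->
  polytime_counting (count_colourings m D q).
Proof.
move=> m0 hc; have e x : count_colourings m D q x
    = if valid m D x then disjoint_count m q (nvertices x) (nedges x) else 0.
  rewrite count_valid; case: ifP => // hv; have [_ us hcl _] := validP hv.
  rewrite (num_colourings_disjoint m0 us hcl hc); congr disjoint_count.
  by rewrite !size_map size_iota.
apply: polytime_of_pt; apply: (pt_ext (f := fun x =>
  if valid m D x then binary (disjoint_count m q (nvertices x) (nedges x)) else binary 0)).
  by move=> x; rewrite e; case: ifP.
apply: pt_if; [exact: pt_valid pt_id | | exact: pt_const].
have pn : pt (fun x => nvertices x) by apply: pt_nvertices; exact: pt_id.
have pk : pt (fun x => nedges x) by apply: pt_nedges; exact: pt_id.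
by apply: pt_binary; rewrite /disjoint_count; pt_bin.
Qed.

Theorem theorem6p1 (m Delta q : nat) (hm : 3 <= m) :
  (1 < Delta -> 1 < q -> sharpP_complete (count_colourings m Delta q)) /\
  (Delta <= 1 \/ q <= 1 -> polytime_counting (count_colourings m Delta q)).
Proof.
split=> [D1 q1|]; last by apply: polytime_count; lia.
split; first exact: sharpP_count.
by move=> g; apply: sharpP_hard.
Qed.
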